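(* Let $n\ge 3$ and let $M^n$ be a connected smooth $n$-manifold. Suppose that $\phi: M^n\to\mathbb{H}^{n+1}$ is an immersed, complete, horospherically convex hypersurface with principal curvatures $\kappa_1,\dots,\kappa_n$, with constant mean curvature $H=\sum_{i=1}^n\kappa_i$ and $$\sum_{i=1}^n\frac{2}{1-\kappa_i}\le n .$$ Then it is a horosphere if its boundary at infinity $\partial_\infty\phi(M^n)$ is a single point in $\mathbb{S}^n$.
   Context: $\mathbb{R}^{1,n+1}$ is $\mathbb{R}^{n+2}$ with $\langle\bar x,\bar x\rangle=-x_0^2+\sum_{i=1}^{n+1}x_i^2$, and $\mathbb{H}^{n+1}=\{\bar x:\langle\bar x,\bar x\rangle=-1,\ x_0>0\}$. The ideal boundary of $\mathbb{H}^{n+1}$ is the unit sphere $\mathbb{S}^n$. An immersed hypersurface $\phi:M^n\to\mathbb{H}^{n+1}$ is oriented by a unit normal field $\eta$, viewed as a map into $\{\bar x:\langle\bar x,\bar x\rangle=1\}$; its principal curvatures $\kappa_i$ are defined by $d\eta(e_i)=-\kappa_i\,d\phi(e_i)$ in an orthonormal basis of principal directions (so a geodesic sphere with outward normal has principal curvatures less than $-1$). ''Complete'' means that the induced metric on $M^n$ is complete. $\phi$ is horospherically convex if at each $p$ the hypersurface lies locally on one side of the horosphere $\mathcal{H}_p$ tangent to it at $\phi(p)$ with inward normal $\eta(p)$, touches it (near $p$) only at $p$, and the distance to $\mathcal{H}_p$ does not vanish to second order in any direction; equivalently, at each point all $\kappa_i<1$ or all $\kappa_i>1$. By convention the orientation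 is chosen so that all $\kappa_i<1$ everywhere. The boundary at infinity $\partial_\infty\phi(M^n)\subset\mathbb{S}^n$ is the set of $x\in\mathbb{S}^n$ that are limits, in the Euclidean topology of $\overline{\mathbb{B}^{n+1}}$, of sequences of points of the hypersurface in the Poincaré ball model $\mathbb{B}^{n+1}$. *)

(* Defs.v *)
From HB Require Import structures.
From mathcomp Require Import all_boot all_order all_algebra.
From mathcomp Require Import all_classical all_reals all_analysis.
Set Implicit Arguments.
Unset Strict Implicit.
Unset Printing Implicit Defensive.
Import Order.TTheory GRing.Theory Num.Theory.
Import numFieldNormedType.Exports.
Local Open Scope classical_set_scope.
Local Open Scope ring_scope.

(** * Smooth manifolds *)

(* Meaningful for [U] open: [f] is [k] times continuously differentiable. *)
Fixpoint Ck_on (R : realType) (V W : normedModType R) (k : nat) (U : set V)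
    (f : V -> W) : Prop :=
  if k is k'.+1 then
    (forall x, U x -> differentiable f x) /\
    (forall v : V, Ck_on k' U (fun x => 'D_v f x))
  else forall x, U x -> {for x, continuous f}.

Definition smooth_on (R : realType) (V W : normedModType R) (U : set V)
    (f : V -> W) : Prop := forall k, Ck_on k U f.

(* A homeomorphism from the open set [cdom] onto an open set of [R^n]; the
   values of [ccoord] and [cinv] outside these sets are irrelevant. *)
Record chart (R : realType) (n : nat) (M : topologicalType) := Chart {
  cdom : set M;
  ccoord : M -> 'rV[R]_n;
  cinv : 'rV[R]_n -> M;
  cdom_open : open cdom;
  cim_open : open (ccoord @` cdom);
  ccoordK : forall p, cdom p -> cinv (ccoord p) = p;
  ccoord_cont : forall p, cdom p -> {for p, continuous ccoord};
  cinv_cont : forall x, (ccoord @` cdom) x -> {for x, continuous cinv}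
}.

(* [atlas] need not be maximal. *)
Record smoothManifold (R : realType) (n : nat) := SmoothManifold {
  carrier :> topologicalType;
  manifold_hausdorff : hausdorff_space carrier;
  manifold_second_countable : @second_countable carrier;
  atlas : set (chart R n carrier);
  atlas_cover : forall p : carrier, exists2 a, atlas a & cdom a p;
  atlas_compat : forall a b, atlas a -> atlas b ->
    smooth_on (ccoord a @` (cdom a `&` cdom b)) (ccoord b \o cinv a)
}.

Definition chart_at (R : realType) (n : nat) (M : smoothManifold R n) (p : M) :
    set (chart R n M) := [set a | atlas a /\ cdom a p].

Definition smooth_map (R : realType) (n : nat) (M : smoothManifold R n)
    (W : normedModType R) (f : M -> W) : Prop :=
  forall a : chart R n M, atlas a ->
    smooth_on (ccoord a @` cdom a) (f \o cinv a).

(* The differential [df_p], tangent vectors at [p] being represented by their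
   coordinates in the chart [a]. *)
Definition mdiff (R : realType) (n : nat) (M : smoothManifold R n)
    (W : normedModType R) (f : M -> W) (a : chart R n M) (p : M)
    (v : 'rV[R]_n) : W :=
  'D_v (f \o cinv a) (ccoord a p).

Definition C1_curve (R : realType) (n : nat) (M : smoothManifold R n)
    (c : R -> M) : Prop :=
  continuous c /\
  forall a : chart R n M, atlas a ->
    Ck_on (V := R^o) 1 (c @^-1` cdom a) (ccoord a \o c).

(** * Hyperbolic space, in the hyperboloid model *)

Definition lorentz (R : realType) (n : nat) (x y : 'rV[R]_n.+2) : R :=
  - (x ord0 ord0 * y ord0 ord0)
  + \sum_(i < n.+1) x ord0 (lift ord0 i) * y ord0 (lift ord0 i).

Definition hyperbolic_space (R : realType) (n : nat) : set 'rV[R]_n.+2 :=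
  [set x | lorentz x x = -1 /\ 0 < x ord0 ord0].

Definition acosh (R : realType) (x : R) : R := ln (x + Num.sqrt (x ^+ 2 - 1)).

Definition hyp_dist (R : realType) (n : nat) (x y : 'rV[R]_n.+2) : R :=
  acosh (- lorentz x y).

Definition dist_to (R : realType) (n : nat) (x : 'rV[R]_n.+2)
    (S : set 'rV[R]_n.+2) : R :=
  inf [set hyp_dist x y | y in S].

Definition future_light_cone (R : realType) (n : nat) : set 'rV[R]_n.+2 :=
  [set nu | lorentz nu nu = 0 /\ 0 < nu ord0 ord0].

(* Every horosphere is the section of the hyperboloid by the degenerate affine
   hyperplane <x, nu> = -1 for a unique [nu] in the future light cone.  It
   bounds the horoball <x, nu> > -1, and its unit normal at [x] pointing into
   that horoball is [nu - x]. *)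
Definition horosphere (R : realType) (n : nat) (nu : 'rV[R]_n.+2) :
    set 'rV[R]_n.+2 :=
  [set x | hyperbolic_space x /\ lorentz x nu = -1].

Definition is_horosphere (R : realType) (n : nat) (S : set 'rV[R]_n.+2) :
    Prop :=
  exists2 nu, future_light_cone nu & S = horosphere nu.

Definition poincare_ball (R : realType) (n : nat) (x : 'rV[R]_n.+2) :
    'rV[R]_n.+1 :=
  \row_i (x ord0 (lift ord0 i) / (1 + x ord0 ord0)).

Definition unit_sphere (R : realType) (n : nat) : set 'rV[R]_n.+1 :=
  [set x | \sum_i x ord0 i ^+ 2 = 1].

(** * Hypersurfaces *)

Definition immersed_hypersurface (R : realType) (n : nat)
    (M : smoothManifold R n) (phi : M -> 'rV[R]_n.+2) : Prop :=
  [/\ smooth_map phi,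
      forall p, hyperbolic_space (phi p)
    & forall p a, chart_at p a ->
        forall v, mdiff phi a p v = 0 -> v = 0].

Definition unit_normal (R : realType) (n : nat) (M : smoothManifold R n)
    (phi eta : M -> 'rV[R]_n.+2) : Prop :=
  [/\ smooth_map eta,
      forall p, lorentz (eta p) (eta p) = 1,
      forall p, lorentz (eta p) (phi p) = 0
    & forall p a, chart_at p a ->
        forall v, lorentz (eta p) (mdiff phi a p v) = 0].

Definition principal_curvatures (R : realType) (n : nat)
    (M : smoothManifold R n) (phi eta : M -> 'rV[R]_n.+2)
    (kappa : M -> 'I_n -> R) : Prop :=
  forall p a, chart_at p a ->
    exists e : 'I_n -> 'rV[R]_n,
      (forall i j,
         lorentz (mdiff phi a p (e i)) (mdiff phi a p (e j)) = (i == j)%:R) /\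
      (forall i, mdiff eta a p (e i) = - kappa p i *: mdiff phi a p (e i)).

(* Length for the metric induced by [phi]. *)
Definition curve_length (R : realType) (n : nat) (M : smoothManifold R n)
    (phi : M -> 'rV[R]_n.+2) (c : R -> M) : \bar R :=
  (\int[lebesgue_measure]_(t in `[0%R, 1%R])
     (Num.sqrt (lorentz (derive1 (phi \o c) t) (derive1 (phi \o c) t)))%:E)%E.

(* Curves may have zero velocity, so a piecewise C^1 path can be reparametrised
   (stopping at its corners and end points) as a C^1 curve on the whole line
   with the same length: this is the usual Riemannian distance. *)
Definition induced_dist (R : realType) (n : nat) (M : smoothManifold R n)
    (phi : M -> 'rV[R]_n.+2) (p q : M) : \bar R :=
  ereal_inf [set curve_length phi c | c in
               [set c : R -> M | [/\ C1_curve c, c 0 = p & c 1 = q]]].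

Definition complete_hypersurface (R : realType) (n : nat)
    (M : smoothManifold R n) (phi : M -> 'rV[R]_n.+2) : Prop :=
  forall u : nat -> M,
    (forall eps : R, 0 < eps -> exists N : nat, forall i j : nat,
       (N <= i)%N -> (N <= j)%N ->
       (induced_dist phi (u i) (u j) < eps%:E)%E) ->
    exists p : M, forall eps : R, 0 < eps -> exists N : nat, forall i : nat,
      (N <= i)%N -> (induced_dist phi (u i) p < eps%:E)%E.

(* By the remark on [horosphere], this is the horosphere through [phi p] whose
   inward unit normal at that point is [eta p]. *)
Definition tangent_horosphere (R : realType) (n : nat)
    (M : smoothManifold R n) (phi eta : M -> 'rV[R]_n.+2) (p : M) :
    set 'rV[R]_n.+2 :=
  horosphere (phi p + eta p).

(* The two disjuncts are the two open sides of the
   tangent horosphere. *)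
Definition horospherically_convex (R : realType) (n : nat)
    (M : smoothManifold R n) (phi eta : M -> 'rV[R]_n.+2) : Prop :=
  forall p : M,
    ((\forall q \near p, q <> p -> lorentz (phi q) (phi p + eta p) < -1) \/
     (\forall q \near p, q <> p -> -1 < lorentz (phi q) (phi p + eta p))) /\
    (forall a, chart_at p a -> forall v : 'rV[R]_n, v <> 0 ->
       ~ ((fun t : R =>
             dist_to (phi (cinv a (ccoord a p + t *: v)))
                     (tangent_horosphere phi eta p) / t ^+ 2)
            @ 0^' --> 0)).

Definition boundary_at_infinity (R : realType) (n : nat)
    (M : smoothManifold R n) (phi : M -> 'rV[R]_n.+2) : set 'rV[R]_n.+1 :=
  [set x | unit_sphere x /\
           exists u : nat -> M,
             (fun k => poincare_ball (phi (u k))) @ \oo --> x].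

(* Main.v *)
(* Write a_k = 1 - kappa_k.  The two curvature conditions pinch every a_k between
   2/n and n - H, so the metric induced on M by phi is equivalent to the
   horospherical metric <d psi, d psi>, where psi = phi + eta takes values in the
   future light cone.  Let x be the only point at infinity.  In a chart of the
   sphere at infinity sending x to infinity, psi = s (1, |y|^2 / 2, y): the
   horospherical metric is s^2 |dy|^2, and the Gauss map y is a local
   diffeomorphism where s > 0.  Since x is the only boundary point, s is bounded
   where y is bounded, so completeness lets one lift rays of R^n and y has a global
   section E : R^n -> M.

   The function tau = 1/s on R^n satisfies
     (1 + |grad tau|^2) / 2 - tau Hess tau ~ diag (1/a_k),   sum a_k = n - H,
   an equation invariant under the Kelvin transform.  If |grad tau|^2 exceeded
   n - 1 at some point, tau would grow quadratically along the ray in the direction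
   of the gradient; this ray would have finite length and converge to a point where
   s = 0.  Such a point is not in the closure of E, as otherwise M would be compact.
   So grad tau is bounded, and the method of moving spheres, with Hopf's lemma as
   strong maximum principle, gives tau y >= <grad tau y, y - z> for every centre z;
   hence tau is constant.  Then E is onto, and phi - eta is a constant null vector
   whose horosphere is the image of phi. *)
Require Import Defs.
From mathcomp Require Import all_boot all_order all_algebra.
From mathcomp Require Import all_classical all_reals all_analysis.
From mathcomp Require Import measurable_realfun.
From mathcomp Require Import ring lra.
Set Implicit Arguments.
Unset Strict Implicit.
Unset Printing Implicit Defensive.
Import Order.TTheory GRing.Theory Num.Theory.
Import numFieldNormedType.Exports.
Local Open Scope classical_set_scope.
Local Open Scope ring_scope.

(** * Euclidean space and calculus on curves *)

(** The equation is fully nonlinear, yet comparing two solutions takes one linear inequality. If B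
    is the form with eigenvalues 1/a_k, the sum of the a_k is tr B^-1, a convex function of positive
    forms; so two solutions B, B' with the same sum c satisfy tr(B^-2 B') >= c. Where the Kelvin
    transform, corrected by a radial barrier, would touch tau from above, this inequality fails. The
    same barrier serves on the reflecting sphere and at interior contacts. The gradient bound keeps
    the spheres from stopping: tau then grows at most linearly while its Kelvin transforms grow
    quadratically, so for bounded radii contacts stay in a compact region. Its threshold n - 1 is
    2/a1 - 1 with a1 = 2/n. Nothing is known beforehand about injectivity of y or about the zeros of
    s. Hence sections of the Gauss map are built by lifting and gluing, and a second chart, with the
    two null directions exchanged, is used around zeros of s. There n >= 3 gives a direction
    orthogonal to two given points, along which one goes round a ball. *)

Section Dot.
Context {R : realType} {n : nat}.
Implicit Types u v w : 'rV[R]_n.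

Definition dot u v : R := \sum_i u ord0 i * v ord0 i.

Lemma dotC u v : dot u v = dot v u.
Proof. by apply: eq_bigr => i _; rewrite mulrC. Qed.

Lemma dotDl u v w : dot (u + v) w = dot u w + dot v w.
Proof. by rewrite -big_split /=; apply: eq_bigr => i _; rewrite mxE mulrDl. Qed.

Lemma dotDr u v w : dot w (u + v) = dot w u + dot w v.
Proof. by rewrite dotC dotDl !(dotC w). Qed.

Lemma dotZl a u v : dot (a *: u) v = a * dot u v.
Proof. by rewrite mulr_sumr; apply: eq_bigr => i _; rewrite mxE mulrA. Qed.

Lemma dotZr a u v : dot u (a *: v) = a * dot u v.
Proof. by rewrite dotC dotZl dotC. Qed.

Lemma dotNl u v : dot (- u) v = - dot u v.
Proof. by rewrite -scaleN1r dotZl mulN1r. Qed.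

Lemma dotNr u v : dot u (- v) = - dot u v.
Proof. by rewrite dotC dotNl dotC. Qed.

Lemma dotBl u v w : dot (u - v) w = dot u w - dot v w.
Proof. by rewrite dotDl dotNl. Qed.

Lemma dot0l v : dot 0 v = 0.
Proof. by rewrite -(scale0r 0) dotZl mul0r. Qed.

Lemma dot0r v : dot v 0 = 0.
Proof. by rewrite dotC dot0l. Qed.

Definition dotE := (dotDl, dotDr, dotNl, dotNr, dotZl, dotZr, dot0l, dot0r).

Lemma dot_suml I (r : seq I) (P : pred I) (F : I -> 'rV[R]_n) v :
  dot (\sum_(i <- r | P i) F i) v = \sum_(i <- r | P i) dot (F i) v.
Proof. exact: (big_morph (dot^~ v) (fun x y => dotDl x y v) (dot0l v)). Qed.

Lemma dot_sumr I (r : seq I) (P : pred I) (F : I -> 'rV[R]_n) v :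
  dot v (\sum_(i <- r | P i) F i) = \sum_(i <- r | P i) dot v (F i).
Proof. by rewrite dotC dot_suml; apply: eq_bigr => i _; rewrite dotC. Qed.

Lemma dot_ge0 u : 0 <= dot u u.
Proof. by apply: sumr_ge0 => i _; rewrite -expr2 sqr_ge0. Qed.

Lemma sqr_coord_le_dot u i : u ord0 i ^+ 2 <= dot u u.
Proof.
rewrite /dot (bigD1 i) //= -expr2 lerDl; apply: sumr_ge0 => j _.
by rewrite -expr2 sqr_ge0.
Qed.

Lemma dot_eq0 u : (dot u u == 0) = (u == 0).
Proof.
apply/eqP/eqP => [u0|->]; last exact: dot0l.
apply/rowP => i; rewrite mxE; apply/eqP; rewrite -sqrf_eq0 eq_le sqr_ge0 andbT.
by rewrite -u0 sqr_coord_le_dot.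
Qed.

Lemma dot_gt0 u : (0 < dot u u) = (u != 0).
Proof. by rewrite lt_def dot_eq0 dot_ge0 andbT. Qed.

Lemma CauchySchwarz_dot u v : dot u v ^+ 2 <= dot u u * dot v v.
Proof.
have [->|v0] := eqVneq v 0; first by rewrite !dot0r expr0n mulr0.
have v1 : 0 < dot v v by rewrite dot_gt0.
have := dot_ge0 (dot v v *: u - dot u v *: v).
rewrite !dotE (dotC v u).
rewrite [X in 0 <= X](_ : _ = dot v v * (dot u u * dot v v - dot u v ^+ 2)); last by ring.
by rewrite pmulr_rge0 // subr_ge0.
Qed.

Lemma dot_delta u i : dot u (delta_mx ord0 i) = u ord0 i.
Proof.
rewrite /dot (bigD1 i) //= big1 ?addr0 => [|j ji].
  by rewrite mxE !eqxx mulr1.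
by rewrite mxE (negbTE ji) andbF mulr0.
Qed.

Lemma eq_dotP u v : (forall w, dot u w = dot v w) -> u = v.
Proof. by move=> uv; apply/rowP => i; rewrite -!dot_delta uv. Qed.

Lemma coord_le_norm u i : `|u ord0 i| <= `|u|.
Proof.
rewrite [leRHS]/Num.Def.normr/= mx_normrE.
by apply: le_trans; last exact: (le_bigmax _ _ (ord0, i)).
Qed.

Lemma norm_le_coord u r : 0 <= r -> (forall i, `|u ord0 i| <= r) -> `|u| <= r.
Proof.
move=> r0 ur; rewrite [leLHS]/Num.Def.normr/= mx_normrE (bigmax_le _ r0) //=.
by move=> [i j] _; rewrite ord1.
Qed.

Lemma norm_le_dot u r : 0 <= r -> dot u u <= r ^+ 2 -> `|u| <= r.
Proof.
move=> r0 ur; apply: norm_le_coord => // i.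
rewrite -(@ler_pXn2r _ 2) ?nnegrE // real_normK ?num_real //.
exact: le_trans (sqr_coord_le_dot _ _) ur.
Qed.

Lemma dot_le_norm u : dot u u <= n%:R * `|u| ^+ 2.
Proof.
apply: (@le_trans _ _ (\sum_(i < n) `|u| ^+ 2)); last first.
  by rewrite sumr_const card_ord mulr_natl.
apply: ler_sum => i _; rewrite -expr2 -real_normK ?num_real //.
by rewrite ler_pXn2r ?nnegrE // coord_le_norm.
Qed.

End Dot.

Section RealInduction.
Context {R : realType}.

(** The supremum of the initial segments on which [P] holds is attained by the limit hypothesis, and
    below [b] it would be exceeded by the step hypothesis. This form serves for lifting paths, for
    growing spheres and for following curves. *)
Lemma real_induction (P : R -> Prop) (a b : R) :
  P a ->
  (forall t, a <= t -> t < b -> (forall s, a <= s <= t -> P s) ->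
     exists2 d, 0 < d & forall s, t < s < t + d -> P s) ->
  (forall t, a < t -> t <= b -> (forall s, a <= s < t -> P s) -> P t) ->
  forall t, a <= t <= b -> P t.
Proof.
move=> Pa step lim t /andP[at_ tb].
pose A := [set x | a <= x <= b /\ forall s, a <= s <= x -> P s].
have Aa : A a.
  split; first by rewrite lexx (le_trans at_ tb).
  by move=> s; rewrite -eq_le => /eqP <-.
have hA : has_sup A.
  by split; [exists a | exists b => x [/andP[]]].
pose m := sup A.
have am : a <= m by apply: sup_upper_bound.
have mb : m <= b by apply: ge_sup => [|x [/andP[]]] //; exists a.
have Plt s : a <= s < m -> P s.
  move=> /andP[as_ sm]; have [x [_ Ax] sx] := sup_adherent (eps := m - s)
    ltac:(by rewrite subr_gt0) hA.
  by apply: Ax; rewrite as_ ltW //; move: sx; rewrite /m opprB addrCA subrr addr0.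
have Pm s : a <= s <= m -> P s.
  rewrite le_eqVlt andbC le_eqVlt => /andP[/predU1P[->|sm]]; last first.
    by move=> as_; apply: Plt; rewrite sm andbT le_eqVlt.
  case/predU1P => [<- //|am'].
  by apply: lim => // s' s'm; apply: Plt.
have [mltb|] := ltP m b; last first.
  by move=> bm; apply: Pm; rewrite at_ (le_trans tb bm).
have [d d0 Pd] := step m am mltb Pm.
pose m' := m + Num.min (d / 2) (b - m).
have e0 : 0 < Num.min (d / 2) (b - m) by rewrite lt_min subr_gt0 mltb divr_gt0.
have mm' : m < m' by rewrite ltrDl.
have : A m'.
  split; first by rewrite (le_trans am (ltW mm')) /= /m' -lerBrDl ge_min lexx orbT.
  move=> s /andP[as_ sm']; have [sm|ms] := leP s m; first by apply: Pm; rewrite as_.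
  apply: Pd; rewrite ms (le_lt_trans sm') //= /m' ltrD2l gt_min.
  by apply/orP; left; rewrite ltr_pdivrMr // ltr_pMr // ltr1n.
by move=> /(sup_upper_bound hA); rewrite leNgt mm'.
Qed.

End RealInduction.

(** * Directional derivatives and a second-derivative test *)

Section CurveCalculus.
Context {R : realType}.
Implicit Types U V W : normedModType R.

Lemma is_deriveMf V (f g : V -> R) x v (df dg : R) :
  is_derive x v f df -> is_derive x v g dg ->
  is_derive x v (fun y => f y * g y) (df * g x + f x * dg).
Proof.
move=> Df Dg; apply: is_derive_eq.
by rewrite addrC mulrC.
Qed.

Lemma is_derive_sumf V W I (r : seq I) (h : I -> V -> W) x v (dh : I -> W) :
  (forall i, is_derive x v (h i) (dh i)) ->
  is_derive x v (fun y => \sum_(i <- r) h i y) (\sum_(i <- r) dh i).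
Proof.
move=> Dh; elim: r => [|i r IH].
  rewrite big_nil (_ : (fun _ => _) = cst 0) ?funeqE => [|y]; last by rewrite big_nil.
  exact: is_derive_cst.
rewrite big_cons (_ : (fun _ => _) = h i + (fun y => \sum_(i <- r) h i y)).
  exact: is_deriveD.
by rewrite funeqE => y; rewrite big_cons.
Qed.

Lemma is_derive_coord V n (f : V -> 'rV[R]_n) x v (df : 'rV[R]_n) (i : 'I_n) :
  is_derive x v f df -> is_derive x v (fun y => f y ord0 i) (df ord0 i).
Proof.
move=> Df; have Dxv : derivable f x v by [].
apply: DeriveDef; first by move/derivable_mxP: Dxv; apply.
by have := @derive_val _ _ _ _ _ _ _ Df; rewrite derive_mx // => <-; rewrite mxE.
Qed.

Lemma is_derive_row V n (f : V -> 'rV[R]_n) x v (df : 'rV[R]_n) :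
  (forall i, is_derive x v (fun y => f y ord0 i) (df ord0 i)) -> is_derive x v f df.
Proof.
move=> Df; have Dxv : derivable f x v.
  by apply/derivable_mxP => i j; rewrite ord1.
apply: DeriveDef => //; rewrite derive_mx //; apply/rowP => i; rewrite mxE.
exact: derive_val.
Qed.

Lemma is_derive_dot V n (f g : V -> 'rV[R]_n) x v (df dg : 'rV[R]_n) :
  is_derive x v f df -> is_derive x v g dg ->
  is_derive x v (fun y => dot (f y) (g y)) (dot df (g x) + dot (f x) dg).
Proof.
move=> Df Dg; rewrite /dot -big_split /=; apply: is_derive_sumf => i.
by apply: is_deriveMf; apply: is_derive_coord.
Qed.

Lemma is_deriveZf V n (k : V -> R) (f : V -> 'rV[R]_n) x v dk (df : 'rV[R]_n) :
  is_derive x v k dk -> is_derive x v f df ->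
  is_derive x v (fun y => k y *: f y) (dk *: f x + k x *: df).
Proof.
move=> Dk Df; apply: is_derive_row => i; rewrite !mxE.
rewrite (_ : (fun _ => _) = (fun y => k y * f y ord0 i)); last first.
  by rewrite funeqE => y; rewrite mxE.
by apply: is_deriveMf; apply: is_derive_coord.
Qed.

Lemma is_derive1P V W (f : V -> W) x v df :
  is_derive x v f df <-> is_derive (0 : R) (1 : R) (fun h : R => f (h *: v + x)) df.
Proof.
have eD : 'D_v f x = 'D_(1 : R) (fun h : R => f (h *: v + x)) (0 : R).
  rewrite /derive; set g1 := fun h => h^-1 *: _; set g2 := fun h => h^-1 *: _.
  suff -> : g1 = g2 by [].
  rewrite funeqE /g1 /g2 => h /=.
  by rewrite addr0 scale0r add0r [_%:A]mulr1.
split=> -[Df <-].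
  by rewrite eD; apply: DeriveDef (proj1 (derivable1P f x v) Df) _.
by rewrite -eD; apply: DeriveDef (proj2 (derivable1P f x v) Df) _.
Qed.

Lemma is_derive_chain U V W (g : U -> V) (f : V -> W) x v dg :
  is_derive x v g dg -> differentiable f (g x) ->
  is_derive x v (f \o g) ('D_dg f (g x)).
Proof.
move=> /is_derive1P Dg fgx; apply/is_derive1P.
set c := fun h : R => g (h *: v + x).
have c0 : c 0 = g x by rewrite /c scale0r add0r.
have dc : differentiable c 0 by apply/derivable1_diffP.
have dfc : differentiable (f \o c) 0 by apply: differentiable_comp; rewrite ?c0.
rewrite (_ : (fun _ => _) = f \o c) //; apply: DeriveDef; first exact: diff_derivable.
have Ec : ('d c 0 : R -> V) 1 = dg by rewrite -deriveE //; apply: derive_val.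
by rewrite deriveE // diff_comp //= ?c0 // Ec deriveE.
Qed.

Lemma is_derive_affine V (x v : V) (t : R) :
  is_derive t (1 : R) (fun s : R => x + s *: v) v.
Proof.
apply/is_derive1P; rewrite (_ : (fun _ => _) = cst (x + t *: v) + ( *:%R^~ v)).
  apply: is_derive_eq; last exact: add0r.
  apply: DeriveDef; first exact/derivable1_diffP.
  rewrite deriveE // diff_val /=. by rewrite !add0r; exact: scale1r.
by rewrite funeqE => h /=; rewrite scaler1 scalerDl addrCA addrC.
Qed.

Lemma is_derive_line V W (f : V -> W) x v (t : R) :
  differentiable f (x + t *: v) ->
  is_derive t (1 : R) (fun s : R => f (x + s *: v)) ('D_v f (x + t *: v)).
Proof.
move=> fx; apply: (is_derive_chain (g := fun s : R => x + s *: v)) => //.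
exact: is_derive_affine.
Qed.

(** If [q] were negative, [dh] would be negative just to the right of 0, and the mean value theorem
    would give a value of [h] below the minimum. Only the derivative of [dh] at 0 enters, not its
    continuity. *)
Lemma local_min_derive2 (h dh : R -> R) (q : R) :
  (\forall t \near 0, is_derive (t : R) 1 h (dh t)) ->
  is_derive (0 : R) 1 dh q ->
  (\forall t \near 0, h 0 <= h t) ->
  dh 0 = 0 /\ 0 <= q.
Proof.
move=> hD qD hmin.
have [r /= r0 rP] := (nbhs_ballP _ _).1 (filterI hD hmin).
have {}rP t : `|t| < r -> is_derive (t : R) 1 h (dh t) /\ h 0 <= h t.
  by move=> tr; apply: rP; rewrite -ball_normE /= sub0r normrN.
have dh0 : dh 0 = 0.
  have [D0 _] := rP 0 ltac:(by rewrite normr0).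
  have : is_derive (0 : R) 1 h 0.
    apply: (@derive1_at_min _ h (- r) r) => [|t||t].
    - by rewrite ge0_cp // ltW.
    - rewrite in_itv /= => tr; have [] := rP t; first by rewrite ltr_norml.
      by move=> ? _.
    - by rewrite in_itv /= oppr_lt0 r0.
    - by rewrite in_itv /= => tr; have [] := rP t; first by rewrite ltr_norml.
  by move=> D0'; rewrite -(@derive_val _ _ _ _ _ _ _ D0) derive_val.
split=> //; rewrite leNgt; apply/negP => q0.
have [cD vD] := qD.
have : (fun s : R => s^-1 *: ((dh \o shift 0) (s *: 1) - dh 0)) @ 0^' --> q.
  by rewrite -vD.
move=> /cvgrPdist_lt /(_ (- q)); rewrite oppr_gt0 => /(_ q0).
rewrite near_withinE => /nbhs_ballP[d /= d0 dP].
pose t := Num.min (d / 2) (r / 2).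
have t0 : 0 < t by rewrite lt_min !divr_gt0.
have td : t < d by rewrite gt_min ltr_pdivrMr // ltr_pMr // ltr1n.
have tr : t < r by rewrite gt_min orbC ltr_pdivrMr // ltr_pMr // ltr1n.
have dneg s : 0 < s -> s <= t -> dh s < 0.
  move=> s0 st; have := dP s; rewrite -ball_normE /= sub0r normrN gtr0_norm //.
  move=> /(_ (le_lt_trans st td) (lt0r_neq0 s0)); rewrite dh0 subr0 scaler1 addr0.
  rewrite ltr_norml => /andP[+ _]; rewrite opprK /GRing.scale /= => H.
  have : s^-1 * dh s < 0 by move: H; lra.
  by rewrite pmulr_rlt0 // invr_gt0.
have [s st] : exists2 c, c \in `]0, t[%R & h t - h 0 = dh c * (t - 0).
  apply: MVT => // [s|].
    rewrite in_itv /= => /andP[s0 st]; have [] := rP s => //.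
    by rewrite gtr0_norm // (lt_trans st).
  apply: derivable_within_continuous => s; rewrite in_itv /= => /andP[s0 st].
  have [] := rP s; first by rewrite ger0_norm // (le_lt_trans st).
  by move=> ? _.
rewrite subr0; have [_ ht] := rP t ltac:(by rewrite gtr0_norm).
move: st; rewrite in_itv /= => /andP[s0 st] hE.
have : dh s * t < 0 by rewrite pmulr_llt0 // dneg // ltW.
by rewrite -hE subr_lt0 ltNge ht.
Qed.

End CurveCalculus.

(** * Continuity and compactness for the Euclidean product *)

Section DotTopology.
Context {R : realType} {n : nat}.
Implicit Types (y : 'rV[R]_n).

Lemma cvg_coord (T : Type) (F : set_system T) (FF : Filter F)
    (f : T -> 'rV[R]_n) (u : 'rV[R]_n) (i : 'I_n) :
  f @ F --> u -> f x ord0 i @[x --> F] --> u ord0 i.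
Proof.
by move=> fu; apply: (@cvg_comp _ _ _ f (fun z : 'rV[R]_n => z ord0 i) F _ _ fu);
  exact: coord_continuous.
Qed.

Lemma cvg_dot (T : Type) (F : set_system T) (FF : Filter F)
    (f g : T -> 'rV[R]_n) (u v : 'rV[R]_n) :
  f @ F --> u -> g @ F --> v -> dot (f x) (g x) @[x --> F] --> dot u v.
Proof.
move=> fu gv; apply: (@cvg_big R _ +%R 0 xpredT) => [|i _].
  exact: add_continuous.
by apply: cvgM; apply: cvg_coord.
Qed.

Lemma continuous_dot (T : topologicalType) (f g : T -> 'rV[R]_n) (x : T) :
  {for x, continuous f} -> {for x, continuous g} ->
  {for x, continuous (fun z => dot (f z) (g z))}.
Proof. by move=> fx gx; apply: cvg_dot. Qed.

Lemma dotxx_continuous : continuous (fun y => dot y y).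
Proof. by move=> y; apply: continuous_dot. Qed.

(** One statement for balls ([a = 0]), shells and spheres ([a = b]). The ambient norm is the sup
    norm, hence the passage through [norm_le_dot]. *)
Lemma compact_annulus (a b : R) : compact [set y : 'rV[R]_n | a <= dot y y <= b].
Proof.
apply: bounded_closed_compact.
  exists (`|b| + 1); split; first exact: num_real.
  move=> M bM y /= /andP[_ yb]; apply: norm_le_dot.
    by rewrite (le_trans _ (ltW bM)) // addr_ge0.
  apply: le_trans yb _; apply: le_trans (ler_norm _) _.
  have M1 : 1 <= M by apply: le_trans (ltW bM); rewrite lerDr.
  have bM' : `|b| <= M by apply: le_trans (ltW bM); rewrite lerDl.
  by apply: le_trans bM' _; rewrite expr2 ler_peMr // (le_trans ler01).
rewrite (_ : [set _ | _] = (fun y : 'rV[R]_n => dot y y) @^-1` `[a, b]).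
  apply: preimage_closed => [y _|]; [exact: dotxx_continuous|exact: interval_closed].
by apply/seteqP; split=> y /=; rewrite in_itv.
Qed.

Lemma compact_pos_lb (T : topologicalType) (K : set T) (f : T -> R) :
  compact K -> (forall x, K x -> {for x, continuous f}) ->
  (forall x, K x -> 0 < f x) -> exists2 m, 0 < m & forall x, K x -> m <= f x.
Proof.
move=> cK cf f0; have [[x0 Kx0]|/set0P/negP/negPn/eqP K0] := pselect (K !=set0).
  have [||x /[!inE] Kx fx] := @compact_EVT_min T R f K _ cK; first by exists x0.
    by apply: continuous_in_subspaceT => x /[!inE]; exact: cf.
  by exists (f x); [exact: f0|move=> y Ky; apply: fx; rewrite inE].
by exists 1 => // x; rewrite K0.
Qed.

End DotTopology.

Section NearContinuous.
Context {R : realType} {T : topologicalType}.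
Implicit Types (f : T -> R) (x : T).

Lemma near_lt f x (c : R) : {for x, continuous f} -> f x < c ->
  \forall z \near x, f z < c.
Proof. by move=> /(cvgr_lt (f x)) fx; apply: fx. Qed.

Lemma near_gt f x (c : R) : {for x, continuous f} -> c < f x ->
  \forall z \near x, c < f z.
Proof. by move=> /(cvgr_gt (f x)) fx; apply: fx. Qed.

Lemma near_lt2 f g x : {for x, continuous f} -> {for x, continuous g} ->
  f x < g x -> \forall z \near x, f z < g z.
Proof.
move=> fx gx fg; have := @near_gt (g \- f) x 0 (continuousB gx fx).
by rewrite /= subr_gt0 => /(_ fg); apply: filterS => z /=; rewrite subr_gt0.
Qed.

End NearContinuous.

Section NearNorm.
Context {R : realType} {T : topologicalType} {W : normedModType R}.
Implicit Types (h : T -> W) (x : T).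

Lemma near_dist_lt h x (e : R) : {for x, continuous h} -> 0 < e ->
  \forall z \near x, `|h x - h z| < e.
Proof. by move=> /cvgrPdist_lt hx e0; apply: hx. Qed.

Lemma dist_lt_continuous h x :
  (forall e : R, 0 < e -> \forall z \near x, `|h x - h z| < e) ->
  {for x, continuous h}.
Proof. by move=> hx; apply/cvgrPdist_lt. Qed.

End NearNorm.

(** * The curvature equation and the Kelvin transform *)

Section Frames.
Context {R : realType} {n : nat}.
Implicit Types (f : 'I_n -> 'rV[R]_n) (v : 'rV[R]_n).

Definition orthonormal f := forall i j, dot (f i) (f j) = (i == j)%:R.

Lemma orthonormal_decomp f v : orthonormal f -> v = \sum_k dot v (f k) *: f k.
Proof.
move=> fo; pose F : 'M[R]_n := \matrix_k f k.
have dF u k : (u *m F^T) ord0 k = dot u (f k).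
  by rewrite mxE; apply: eq_bigr => j _; rewrite !mxE.
have FF : F *m F^T = 1%:M.
  apply/matrixP => i j; rewrite !mxE -fo; apply: eq_bigr => k _.
  by rewrite !mxE.
rewrite -[v in LHS]mulmx1 -(mulmx1C FF) mulmxA mulmx_sum_row.
by apply: eq_bigr => k _; rewrite dF rowK.
Qed.

Lemma orthonormal_dot f u v : orthonormal f ->
  dot u v = \sum_k dot u (f k) * dot v (f k).
Proof.
move=> fo; rewrite {1}(orthonormal_decomp v fo) dot_sumr.
by apply: eq_bigr => k _; rewrite dotZr mulrC.
Qed.

Lemma orthonormal_parseval f v : orthonormal f ->
  dot v v = \sum_k dot v (f k) ^+ 2.
Proof. by move=> /(orthonormal_dot v v) ->. Qed.

(* [dot (f k) (f' j) ^+ 2] is doubly stochastic and a^2/a' >= 2 a - a'. *)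
Lemma frame_trace_ge f f' (a a' : 'I_n -> R) (c : R) :
  orthonormal f -> orthonormal f' -> (forall j, 0 < a' j) ->
  \sum_k a k = c -> \sum_k a' k = c ->
  c <= \sum_k a k ^+ 2 * \sum_j dot (f k) (f' j) ^+ 2 / a' j.
Proof.
move=> fo fo' a'0 ac a'c.
have sk k : \sum_j dot (f k) (f' j) ^+ 2 = 1.
  by rewrite -orthonormal_parseval // fo eqxx.
have sj j : \sum_k dot (f k) (f' j) ^+ 2 = 1.
  under eq_bigr do rewrite dotC.
  by rewrite -orthonormal_parseval // fo' eqxx.
have -> : c = \sum_k \sum_j dot (f k) (f' j) ^+ 2 * (2 * a k - a' j).
  under eq_bigr do under eq_bigr do rewrite mulrBr.
  under eq_bigr do rewrite sumrB -mulr_suml sk mul1r.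
  rewrite sumrB -mulr_sumr ac exchange_big /=.
  under eq_bigr do rewrite -mulr_suml sj mul1r.
  by rewrite a'c; ring.
apply: ler_sum => k _; rewrite mulr_sumr; apply: ler_sum => j _.
rewrite mulrCA; apply: ler_wpM2l; first exact: sqr_ge0.
rewrite ler_pdivlMr //.
have : 0 <= (a k - a' j) ^+ 2 by exact: sqr_ge0.
by rewrite -subr_ge0 => H; rewrite -subr_ge0; move: H; rewrite subr0; congr (0 <= _); ring.
Qed.

End Frames.

Section CurveCalculus2.
Context {R : realType}.

Lemma is_deriveVf (V : normedModType R) (f : V -> R) x v (df : R) :
  is_derive x v f df -> f x != 0 -> is_derive x v (fun y => (f y)^-1) (- (df / f x ^+ 2)).
Proof.
move=> Df fx; apply: DeriveDef; first exact: derivableV.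
rewrite deriveV // derive_val /GRing.scale /= mulNr.
by congr (- _); rewrite mulrC.
Qed.

End CurveCalculus2.

Section Solution.
Context {R : realType} {n : nat}.
Implicit Types (tau : 'rV[R]_n -> R) (g : 'rV[R]_n -> 'rV[R]_n) (y v : 'rV[R]_n).

(* The metric [tau^-2 |dy|^2] has Schouten tensor
   [tau * Hess tau - |grad tau|^2 / 2]; its eigenvalues are [1/2 - 1/a_k]. *)
Definition curvature_frame tau g (a0 c : R) y :=
  exists (f : 'I_n -> 'rV[R]_n) (a : 'I_n -> R),
  [/\ orthonormal f, forall k, a0 <= a k, \sum_k a k = c
    & forall k, ((1 + dot (g y) (g y)) / 2) *: f k - tau y *: 'D_(f k) g y
                = (a k)^-1 *: f k].

Record solution tau g (a0 c : R) : Prop := Solution {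
  sol_gt0 : forall y, 0 < tau y;
  sol_diff : forall y, differentiable tau y;
  sol_grad : forall y v, 'D_v tau y = dot (g y) v;
  sol_gdiff : forall y, differentiable g y;
  sol_frame : forall y, curvature_frame tau g a0 c y
}.

(** The quadratic form B with eigenvalues 1/a_k: half the Euclidean metric minus the Schouten
    form. *)
Definition Bquad tau g y v : R :=
  (1 + dot (g y) (g y)) / 2 * dot v v - tau y * dot ('D_v g y) v.

Lemma Bquad_frame tau g y v (f : 'I_n -> 'rV[R]_n) (a : 'I_n -> R) :
  differentiable g y -> orthonormal f ->
  (forall k, ((1 + dot (g y) (g y)) / 2) *: f k - tau y *: 'D_(f k) g y
                = (a k)^-1 *: f k) ->
  Bquad tau g y v = \sum_k dot v (f k) ^+ 2 / a k.
Proof.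
move=> gy fo fB.
have Dv : 'D_v g y = \sum_k dot v (f k) *: 'D_(f k) g y.
  rewrite deriveE // {1}(orthonormal_decomp v fo) linear_sum.
  by apply: eq_bigr => k _; rewrite linearZ /= deriveE.
have Ev : dot v v = \sum_k dot v (f k) * dot (f k) v.
  by rewrite (orthonormal_dot v v fo); apply: eq_bigr => k _; rewrite (dotC (f k)).
rewrite /Bquad Dv Ev dot_suml.
rewrite !mulr_sumr -sumrB; apply: eq_bigr => k _.
rewrite dotZl -[dot v (f k) ^+ 2 / _]/(dot v (f k) * dot v (f k) / _).
transitivity (dot v (f k) * dot (((1 + dot (g y) (g y)) / 2) *: f k - tau y *: 'D_(f k) g y) v).
  by rewrite dotBl !dotZl; ring.
by rewrite fB dotZl (dotC (f k)); ring.
Qed.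

End Solution.

(** * Inversions and the solutions they transport *)

Section Kelvin.
Context {R : realType} {n : nat}.
Implicit Types (y v : 'rV[R]_n).

Definition inversion (l : R) y := (l ^+ 2 / dot y y) *: y.

(** The reflection in the hyperplane orthogonal to [y]. For [y != 0] the differential of
    [inversion l] at [y] is l^2 / |y|^2 times it. *)
Definition hrefl y v := v - (2 * dot y v / dot y y) *: y.

(** The inversion pulls the metric tau^-2 |dy|^2 back to the metric of the same kind for this
    function. *)
Definition kelvin (tau : 'rV[R]_n -> R) (l : R) y :=
  dot y y / l ^+ 2 * tau (inversion l y).

Definition kelvin_grad (tau : 'rV[R]_n -> R) (g : 'rV[R]_n -> 'rV[R]_n) (l : R) y :=
  (2 * tau (inversion l y) / l ^+ 2) *: y + hrefl y (g (inversion l y)).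

Lemma dot_hrefl y u v : dot (hrefl y u) v = dot u (hrefl y v).
Proof. by rewrite /hrefl !dotE (dotC u y); ring. Qed.

Lemma hreflK y : y != 0 -> involutive (hrefl y).
Proof.
move=> y0 v; rewrite /hrefl !dotE -addrA -opprD -scalerDl.
have yy : dot y y != 0 by rewrite dot_eq0.
rewrite [X in X *: _](_ : _ = 0) ?scale0r ?subr0 //.
by field.
Qed.

Lemma dot_hrefl2 y u v : y != 0 -> dot (hrefl y u) (hrefl y v) = dot u v.
Proof. by move=> y0; rewrite dot_hrefl hreflK. Qed.

Lemma is_derive_inversion (l : R) y v t : y + t *: v != 0 ->
  is_derive t 1 (fun s : R => inversion l (y + s *: v))
    ((l ^+ 2 / dot (y + t *: v) (y + t *: v)) *: hrefl (y + t *: v) v).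
Proof.
rewrite -dot_eq0 => Y0.
have DY := is_derive_affine y v t.
have DN := is_derive_dot DY DY.
have Di := is_deriveVf DN Y0.
have Dc := @is_derive_cst _ _ _ (l ^+ 2 : R) (t : R) 1.
have := is_deriveZf (is_deriveMf Dc Di) DY.
set Y := y + t *: v in Y0 *; rewrite mul0r add0r => H; apply: is_derive_eq H _.
rewrite /hrefl scalerBr scalerA addrC; congr (_ + _).
rewrite -scaleNr; congr (_ *: _).
by rewrite /cst /= (dotC v Y); field.
Qed.

Variables (tau : 'rV[R]_n -> R) (g : 'rV[R]_n -> 'rV[R]_n) (a0 c : R).
Hypothesis sol : solution tau g a0 c.

Lemma is_derive_kelvin (l : R) y v t : l != 0 -> y + t *: v != 0 ->
  is_derive t 1 (fun s : R => kelvin tau l (y + s *: v))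
    (dot (kelvin_grad tau g l (y + t *: v)) v).
Proof.
move=> l0 Y0.
have DY := is_derive_affine y v t.
have DN := is_derive_dot DY DY.
have Di := is_derive_inversion l Y0.
have Dt := is_derive_chain Di (sol_diff sol _).
have Dc := @is_derive_cst _ _ _ ((l ^+ 2)^-1 : R) (t : R) 1.
have := is_deriveMf (is_deriveMf DN Dc) Dt.
set Y := y + t *: v in Y0 *; rewrite mulr0 addr0 (sol_grad sol) // => H.
apply: is_derive_eq H _; rewrite /kelvin_grad /= -/Y; clearbody Y.
rewrite dotZr dotDl dotZl dot_hrefl (dotC v Y).
by field; rewrite l0 dot_eq0 Y0.
Qed.

(** Conformal invariance of the equation: the inversion is an isometry between the two metrics, so
    the form B of the transform at [y] is that of [tau] at the inverted point, in the reflected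
    direction. The number [q] is the second derivative in the direction [v]; this is all that a
    touching argument needs. *)
Lemma is_derive_kelvin2 (l : R) y v : l != 0 -> y != 0 -> exists2 q : R,
  is_derive (0 : R) 1 (fun s : R => dot (kelvin_grad tau g l (y + s *: v)) v) q
  & (1 + dot (kelvin_grad tau g l y) (kelvin_grad tau g l y)) / 2 * dot v v
    - kelvin tau l y * q
    = Bquad tau g (inversion l y) (hrefl y v).
Proof.
move=> l0 y0.
have Y0 : y + (0 : R) *: v != 0 by rewrite scale0r addr0.
have DY := is_derive_affine y v 0.
have DN := is_derive_dot DY DY.
have Di := is_derive_inversion l Y0.
have Dt := is_derive_chain Di (sol_diff sol _).
have Dg := is_derive_chain Di (sol_gdiff sol _).
have Dv := @is_derive_cst _ _ _ (v : 'rV[R]_n) (0 : R) 1.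
have Dyv := is_derive_dot DY Dv.
have Dyg := is_derive_dot DY Dg.
have Dgv := is_derive_dot Dg Dv.
have N0 : dot (y + (0 : R) *: v) (y + (0 : R) *: v) != 0 by rewrite dot_eq0.
have Dn := is_deriveVf DN N0.
have Dc := @is_derive_cst _ _ _ (2 / l ^+ 2 : R) (0 : R) 1.
have Dc2 := @is_derive_cst _ _ _ (2 : R) (0 : R) 1.
have D1 := is_deriveMf (is_deriveMf Dc Dt) Dyv.
have D2 := is_deriveMf (is_deriveMf (is_deriveMf Dc2 Dyg) Dyv) Dn.
have := is_deriveB (is_deriveD D1 Dgv) D2.
set q := (X in is_derive _ _ _ X) => Dq; exists q.
  rewrite (_ : (fun _ => _) = ((fun s : R => 2 / l ^+ 2 * tau (inversion l (y + s *: v)) * dot (y + s *: v) v) + (fun s : R => dot (g (inversion l (y + s *: v))) v)) - (fun s : R => 2 * dot (y + s *: v) (g (inversion l (y + s *: v))) * dot (y + s *: v) v * (dot (y + s *: v) (y + s *: v))^-1)) //.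
  rewrite funeqE => s /=; rewrite /kelvin_grad /hrefl !fctE !dotE; ring.
rewrite /q {Dq q} /= scale0r addr0 /cst /= -/(inversion l y).
rewrite !(sol_grad sol) // !mul0r !add0r.
have -> : 'D_((l ^+ 2 / dot y y) *: hrefl y v) g (inversion l y)
   = (l ^+ 2 / dot y y) *: 'D_(hrefl y v) g (inversion l y).
  by rewrite !deriveE ?linearZ //; exact: (sol_gdiff sol).
rewrite /Bquad dot_hrefl2 // /kelvin /kelvin_grad.
rewrite /= {D1 D2 Dc Dc2 Dn N0 Dgv Dyg Dyv Dv Dg Dt Di DN DY Y0}.
have {}y0 : dot y y != 0 by rewrite dot_eq0.
set Y := inversion l y; set h := 'D_(_) g Y; set G := g Y; set T := tau Y.
rewrite /hrefl; clearbody h G T; rewrite !dotE.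
rewrite (dotC h y) (dotC G y) (dotC v y) (dotC v G) (dotC h v).
by field; rewrite l0 y0.
Qed.

End Kelvin.

(** * Hopf lemma *)

Section Barrier.
Context {R : realType} {n : nat}.
Implicit Types (y v : 'rV[R]_n).

Lemma line_continuous (V : normedModType R) (x v : V) :
  continuous (fun t : R => x + t *: v).
Proof.
move=> t; apply: differentiable_continuous; apply/derivable1_diffP.
by have [] := is_derive_affine x v t.
Qed.

Lemma near_line (V : normedModType R) (x v : V) (P : set V) :
  nbhs x P -> \forall t \near (0 : R), P (x + t *: v).
Proof. by move=> xP; apply: line_continuous; rewrite scale0r addr0. Qed.

(** Evaluated at |y|^2. It vanishes on the sphere |y|^2 = r with positive radial slope, and a large
    [K] makes its radial second derivative dominate. *)
Definition barrier (K r y : R) := (y - r) + K * (y - r) ^+ 2.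

Definition barrier_grad (K r : R) y := (2 * (1 + 2 * K * (dot y y - r))) *: y.

Lemma is_derive_barrier K r y v t :
  is_derive t (1 : R) (fun s : R => barrier K r (dot (y + s *: v) (y + s *: v)))
    (dot (barrier_grad K r (y + t *: v)) v).
Proof.
have DY := is_derive_affine y v t.
have DX := is_deriveB (is_derive_dot DY DY) (@is_derive_cst _ _ _ (r : R) (t : R) 1).
have DK := @is_derive_cst _ _ _ (K : R) (t : R) 1.
have := is_deriveD DX (is_deriveMf DK (is_deriveMf DX DX)).
move=> H; apply: is_derive_eq H _; rewrite /barrier_grad !fctE /=.
by rewrite dotZl (dotC v (y + t *: v)); ring.
Qed.

Lemma is_derive_barrier2 K r y v :
  is_derive (0 : R) 1 (fun s : R => dot (barrier_grad K r (y + s *: v)) v)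
    (8 * K * dot y v ^+ 2 + 2 * (1 + 2 * K * (dot y y - r)) * dot v v).
Proof.
have DY := is_derive_affine y v 0.
have DX := is_deriveB (is_derive_dot DY DY) (@is_derive_cst _ _ _ (r : R) (0 : R) 1).
have D2 := @is_derive_cst _ _ _ (2 : R) (0 : R) 1.
have DK := @is_derive_cst _ _ _ (2 * K : R) (0 : R) 1.
have D1 := @is_derive_cst _ _ _ (1 : R) (0 : R) 1.
have Dv := @is_derive_cst _ _ _ (v : 'rV[R]_n) (0 : R) 1.
have := is_derive_dot (is_deriveZf (is_deriveMf D2 (is_deriveD D1 (is_deriveMf DK DX))) DY) Dv.
move=> H; apply: is_derive_eq H _; rewrite !fctE /= scale0r addr0 !dotE (dotC v y).
by ring.
Qed.

Variables (tau : 'rV[R]_n -> R) (g : 'rV[R]_n -> 'rV[R]_n) (a0 c G : R).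
Hypotheses (sol : solution tau g a0 c) (a0_gt0 : 0 < a0)
  (gG : forall y, dot (g y) (g y) <= G).

(** Convexity of tr B^-1, applied to the form of the Kelvin transform: its eigenvalues at [y] are
    those of [tau] at the inverted point, and the reflection carries orthonormal frames to
    orthonormal frames. It will be used with the frame of [tau] at [y] itself. *)
Lemma kelvin_trace_ge (l : R) y (f : 'I_n -> 'rV[R]_n) (a : 'I_n -> R) :
  y != 0 -> orthonormal f -> \sum_k a k = c ->
  c <= \sum_k a k ^+ 2 * Bquad tau g (inversion l y) (hrefl y (f k)).
Proof.
move=> y0 fo ac; have [f' [a' [fo' a0' ac' fB]]] := sol_frame sol (inversion l y).
under eq_bigr do rewrite (Bquad_frame _ (sol_gdiff sol _) fo' fB).
apply: (frame_trace_ge (f := fun k => hrefl y (f k)) _ fo' _ ac ac').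
  by move=> i j; rewrite dot_hrefl2 // fo.
by move=> j; apply: lt_le_trans (a0' j).
Qed.

Lemma inversion_continuous (l : R) y : y != 0 -> {for y, continuous (inversion l)}.
Proof.
move=> y0; rewrite /inversion; apply: continuousZ => //.
apply: (@continuousM _ _ (cst (l ^+ 2)) (fun z => (dot z z)^-1)).
  exact: cst_continuous.
by apply: continuousV; [rewrite dot_eq0|exact: dotxx_continuous].
Qed.

Lemma kelvin_continuous (l : R) y : y != 0 -> {for y, continuous (kelvin tau l)}.
Proof.
move=> y0; rewrite /kelvin.
apply: (@continuousM _ _ (fun z => dot z z / l ^+ 2) (tau \o inversion l)).
  apply: (@continuousM _ _ (fun z => dot z z) (cst (l ^+ 2)^-1)).
    exact: dotxx_continuous.
  exact: cst_continuous.
apply: continuous_comp; first exact: inversion_continuous.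
by apply: differentiable_continuous; exact: sol_diff sol _.
Qed.

(* At an interior minimum of [kelvin tau l - tau - eps * barrier]. *)
Lemma touching_ineq (l K r eps : R) y : l != 0 -> y != 0 ->
  (\forall z \near y,
     kelvin tau l y - tau y - eps * barrier K r (dot y y)
     <= kelvin tau l z - tau z - eps * barrier K r (dot z z)) ->
  kelvin_grad tau g l y = g y + eps *: barrier_grad K r y /\
  forall v, exists2 q : R,
    Bquad tau g (inversion l y) (hrefl y v) =
    (1 + dot (kelvin_grad tau g l y) (kelvin_grad tau g l y)) / 2 * dot v v
    - kelvin tau l y * q &
    dot ('D_v g y) v + eps * (8 * K * dot y v ^+ 2
       + 2 * (1 + 2 * K * (dot y y - r)) * dot v v) <= q.
Proof.
move=> l0 y0 ymin.
have H v : dot (kelvin_grad tau g l y) v - dot (g y) v - eps * dot (barrier_grad K r y) v = 0 /\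
  exists2 q : R,
    Bquad tau g (inversion l y) (hrefl y v) =
    (1 + dot (kelvin_grad tau g l y) (kelvin_grad tau g l y)) / 2 * dot v v
    - kelvin tau l y * q &
    dot ('D_v g y) v + eps * (8 * K * dot y v ^+ 2
       + 2 * (1 + 2 * K * (dot y y - r)) * dot v v) <= q.
  have [q Dq qE] := is_derive_kelvin2 sol v l0 y0.
  pose h (t : R) := kelvin tau l (y + t *: v) - tau (y + t *: v)
    - eps * barrier K r (dot (y + t *: v) (y + t *: v)).
  pose dh (t : R) := dot (kelvin_grad tau g l (y + t *: v)) v
    - dot (g (y + t *: v)) v - eps * dot (barrier_grad K r (y + t *: v)) v.
  have Deps (t : R) := @is_derive_cst _ _ _ (eps : R) (t : R) 1.
  have nz : \forall t \near (0 : R), y + t *: v != 0.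
    have ny : nbhs y [set z : 'rV[R]_n | z != 0].
      have := near_gt (@dotxx_continuous R n y) (c := 0).
      by rewrite dot_gt0 => /(_ y0); apply: filterS => z; rewrite dot_gt0.
    exact: (near_line v ny).
  have hD : \forall t \near (0 : R), is_derive (t : R) 1 h (dh t).
    apply: filterS nz => t t0.
    have D1 := is_derive_kelvin sol l0 t0.
    have D2 : is_derive (t : R) 1 (fun s : R => tau (y + s *: v)) (dot (g (y + t *: v)) v).
      by rewrite -(sol_grad sol); apply: is_derive_line; exact: sol_diff sol _.
    have D3 := is_deriveMf (Deps t) (is_derive_barrier K r y v t).
    have := is_deriveB (is_deriveB D1 D2) D3.
    by move=> H; apply: is_derive_eq H _; rewrite mul0r add0r.
  have dhD : is_derive (0 : R) 1 dh (q - dot ('D_v g y) v - eps * (8 * K * dot y v ^+ 2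
       + 2 * (1 + 2 * K * (dot y y - r)) * dot v v)).
    have Dg : is_derive (0 : R) 1 (fun s : R => dot (g (y + s *: v)) v) (dot ('D_v g y) v).
      have gd : differentiable g (y + (0 : R) *: v) by exact: sol_gdiff sol _.
      have := is_derive_dot (is_derive_line gd) (@is_derive_cst _ _ _ (v : 'rV[R]_n) (0 : R) 1).
      by rewrite scale0r addr0 dot0r addr0.
    have D3 := is_deriveMf (Deps 0) (is_derive_barrier2 K r y v).
    have := is_deriveB (is_deriveB Dq Dg) D3.
    by move=> H; apply: is_derive_eq H _; rewrite mul0r add0r.
  have hmin : \forall t \near (0 : R), h 0 <= h t.
    rewrite /h scale0r addr0; exact: (near_line v ymin).
  have [dh0 q0] := local_min_derive2 hD dhD hmin.
  split; first by move: dh0; rewrite /dh scale0r addr0.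
  exists q; first by rewrite -qE.
  by move: q0; rewrite -addrA -opprD subr_ge0.
split; last by move=> v; have [_] := H v.
apply: eq_dotP => v; have [H1 _] := H v.
by apply/eqP; rewrite -subr_eq0 dotDl dotZl opprD addrA; apply/eqP.
Qed.

End Barrier.

Section Hopf.
Context {R : realType} {n : nat}.
Implicit Types (y v : 'rV[R]_n).
Variables (tau : 'rV[R]_n -> R) (g : 'rV[R]_n -> 'rV[R]_n) (a0 c G : R).
Hypotheses (sol : solution tau g a0 c) (a0_gt0 : 0 < a0)
  (gG : forall y, dot (g y) (g y) <= G).

Lemma dot_le_half (u v : 'rV[R]_n) : dot u v <= (dot u u + dot v v) / 2.
Proof.
have := dot_ge0 (u - v); rewrite !dotE (dotC v u) => H.
by rewrite ler_pdivlMr // -subr_ge0; move: H; congr (0 <= _); ring.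
Qed.

(** At a touching point the gradients differ by [eps] times that of the barrier and the values by at
    most [eps] times the barrier, so the form of the transform differs from 1/a_k by terms of order
    [eps]. The only one containing [K] is the radial second derivative of the barrier, and it has
    the favourable sign. *)
Lemma Bquad_touching (K r eps m : R) y (f : 'I_n -> 'rV[R]_n) (a : 'I_n -> R) k
    (q tl : R) :
  orthonormal f -> a0 <= a k ->
  ((1 + dot (g y) (g y)) / 2) *: f k - tau y *: 'D_(f k) g y = (a k)^-1 *: f k ->
  0 < K -> 0 < r -> r <= dot y y -> dot y y <= r + 1 -> 2 * K * (dot y y - r) <= 1 ->
  0 < eps -> eps <= 1 -> 0 < m -> m <= tau y -> tau y <= tl ->
  tl - tau y <= eps * barrier K r (dot y y) ->
  dot ('D_(f k) g y) (f k) + eps * (8 * K * dot y (f k) ^+ 2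
       + 2 * (1 + 2 * K * (dot y y - r)) * dot (f k) (f k)) <= q ->
  (1 + dot (g y + eps *: barrier_grad K r y) (g y + eps *: barrier_grad K r y)) / 2
     * dot (f k) (f k) - tl * q <=
  (a k)^-1 + eps * (G / 2 + 16 * (r + 1) + 2 / (a0 * m)
                    - 8 * K * m * dot y (f k) ^+ 2).
Proof.
move=> fo ak fB K0 r0 ry yr KX e0 e1 m0 mt ttl wle.
have ffk : dot (f k) (f k) = 1 by rewrite fo eqxx.
have Eak : (1 + dot (g y) (g y)) / 2 - tau y * dot ('D_(f k) g y) (f k) = (a k)^-1.
  have := congr1 (fun z => dot z (f k)) fB.
  by rewrite /= dotBl !dotZl ffk !mulr1.
rewrite ffk !mulr1 => qge.
set H2 := dot ('D_(f k) g y) (f k) in Eak qge *; set p := dot y (f k) in qge *.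
set X := dot y y - r in KX qge *; set zg := barrier_grad K r y.
have X0 : 0 <= X by rewrite subr_ge0.
have X1 : X <= 1 by rewrite /X lerBlDr addrC.
have ak0 : 0 < a k by apply: lt_le_trans ak.
(* The scalar factor of [barrier_grad] is at most 4 because 2 K X <= 1, and |y|^2 <= r + 1. *)
have zgE : dot zg zg <= 16 * (r + 1).
  rewrite /zg /barrier_grad -/X dotZl dotZr.
  have b2 : 0 <= 2 * (1 + 2 * K * X) <= 4.
    have KX0 : 0 <= 2 * K * X by rewrite mulr_ge0 // mulr_ge0 // ltW.
    by apply/andP; split; lra.
  case/andP: b2; set b := 2 * (1 + 2 * K * X) => b20 b24.
  rewrite [leLHS]mulrA; apply: ler_pM => //; [exact: mulr_ge0|exact: dot_ge0|].
  by apply: (@le_trans _ _ (4 * 4)); [apply: ler_pM|lra].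
clearbody zg.
have zeta : barrier K r (dot y y) <= 2.
  rewrite /barrier -/X expr2; have : K * X * X <= 1 * 1.
    by apply: ler_pM => //; [rewrite mulr_ge0 // ltW|lra].
  by lra.
have G0 : 0 <= G by apply: le_trans (gG y); exact: dot_ge0.
(* The Hessian term has the nonnegative factor [tl - tau y], so an upper bound for [- H2] suffices;
   the equation at [y] and a_k >= a0 provide it. *)
have wH : - (tl - tau y) * H2 <= eps * (2 / (a0 * m)).
  have t0 : 0 < tau y by apply: lt_le_trans mt.
  have H2E : - H2 <= (a0 * m)^-1.
    have -> : H2 = ((1 + dot (g y) (g y)) / 2 - (a k)^-1) / tau y.
      by rewrite -Eak; field; rewrite gt_eqF.
    rewrite -mulNr opprB ler_pdivrMr //.
    apply: (@le_trans _ _ a0^-1).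
      have : (a k)^-1 <= a0^-1 by rewrite lef_pV2 ?posrE.
      by have := dot_ge0 (g y); lra.
    rewrite invfM -mulrA; apply: ler_peMr; first by rewrite invr_ge0 ltW.
    by rewrite mulrC ler_pdivlMr // mul1r.
  rewrite mulNr -mulrN; apply: (@le_trans _ _ ((tl - tau y) * (a0 * m)^-1)).
    by apply: ler_wpM2l => //; rewrite subr_ge0.
  rewrite mulrA; apply: ler_wpM2r.
    by rewrite invr_ge0 mulr_ge0 // ltW.
  by apply: le_trans wle _; rewrite ler_wpM2l // ltW.
have tlq : tl * (H2 + eps * (8 * K * p ^+ 2 + 2 * (1 + 2 * K * X))) <= tl * q.
  by apply: ler_wpM2l qge; apply: le_trans ttl; apply: le_trans mt; rewrite ltW.
have e2 : tl * (8 * K * p ^+ 2 + 2 * (1 + 2 * K * X)) >= m * (8 * K * p ^+ 2).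
  apply: ler_pM; rewrite ?(ltW m0) ?(le_trans mt ttl) //.
    by rewrite mulr_ge0 ?sqr_ge0 // mulr_ge0 // ltW.
  rewrite lerDl mulr_ge0 // addr_ge0 // mulr_ge0 // mulr_ge0 //; exact: ltW.
have e2' : eps * (tl * (8 * K * p ^+ 2 + 2 * (1 + 2 * K * X))) >= eps * (m * (8 * K * p ^+ 2)).
  by apply: ler_wpM2l => //; exact: ltW.
have gz : eps * dot (g y) zg <= eps * (G / 2 + 8 * (r + 1)).
  apply: ler_wpM2l; first exact: ltW.
  by have := dot_le_half (g y) zg; have := gG y; lra.
have zz : eps * (eps * dot zg zg) <= eps * (16 * (r + 1)).
  apply: ler_wpM2l; first exact: ltW.
  by apply: le_trans zgE; rewrite ler_piMl ?dot_ge0.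
rewrite !dotE (dotC zg (g y)); lra.
Qed.

(** Used with r = l^2 as Hopf's lemma on the reflecting sphere, and with larger [r] to exclude
    interior contacts. On a thin shell outside |y|^2 = r the difference dominates [eps] times the
    barrier, since a negative minimum of [W] would be interior and contradict [kelvin_trace_ge]. *)
Lemma hopf_kelvin (l r : R) : 0 < l -> l ^+ 2 <= r ->
  (forall y, l ^+ 2 <= dot y y -> tau y <= kelvin tau l y) ->
  (forall y, r < dot y y -> tau y < kelvin tau l y) ->
  exists eps d : R, [/\ 0 < eps, 0 < d & forall y, r <= dot y y <= r + d ->
     eps * (dot y y - r) <= kelvin tau l y - tau y].
Proof.
move=> l0 lr wge wgt.
have r0 : 0 < r by apply: lt_le_trans lr; rewrite exprn_gt0.
have ln0 : l != 0 by rewrite gt_eqF.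
have tcont y : {for y, continuous tau}.
  by apply: differentiable_continuous; exact: sol_diff sol _.
have nz y : r <= dot y y -> y != 0.
  by move=> ry; rewrite -dot_gt0 (lt_le_trans r0).
have wcont y : r <= dot y y -> {for y, continuous (fun z => kelvin tau l z - tau z)}.
  move=> ry; have kc := @kelvin_continuous _ _ _ _ _ _ sol l _ (nz _ ry).
  exact: (@continuousB _ _ _ (kelvin tau l) tau y kc (tcont y)).
have [m m0 mP] := compact_pos_lb (@compact_annulus R n r (r + 1))
  (fun y _ => tcont y) (fun y _ => sol_gt0 sol y).
have G0 : 0 <= G by apply: le_trans (gG 0); exact: dot_ge0.
pose D0 := G / 2 + 16 * (r + 1) + 2 / (a0 * m).
have D00 : 0 <= D0.
  have : 0 <= 2 / (a0 * m) by rewrite divr_ge0 // mulr_ge0 ?ltW.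
  by rewrite /D0; lra.
have den0 : 0 < 8 * m * a0 ^+ 2 * r by rewrite !mulr_gt0 // exprn_gt0.
(* Then 8 K m a0^2 r = c^2 D0 + 1: the radial term weighted by the a_k^2, at least 8 K m a0^2 r,
   beats [D0] times the sum of the a_k^2, at most c^2 D0. *)
pose K := (c ^+ 2 * D0 + 1) / (8 * m * a0 ^+ 2 * r).
have K0 : 0 < K.
  by rewrite divr_gt0 // ltr_wpDl // mulr_ge0 // sqr_ge0.
pose d := Num.min 1 (2 * K)^-1.
have d0 : 0 < d by rewrite lt_min ltr01 invr_gt0 mulr_gt0.
have [y|y|mu mu0 muP] := @compact_pos_lb _ _ _ (fun z => kelvin tau l z - tau z)
  (@compact_annulus R n (r + d) (r + d)).
- move=> /andP[ry _].
  by apply: wcont; apply: le_trans ry; rewrite lerDl ltW.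
- move=> /andP[ry _].
  by rewrite subr_gt0; apply: wgt; apply: lt_le_trans ry; rewrite ltrDl.
(* The barrier is at most 2 on the shell, so on the outer sphere [eps] times the barrier does not
   exceed the lower bound [mu] of the difference. *)
pose eps := Num.min 1 (mu / 2).
have e0 : 0 < eps by rewrite lt_min ltr01 divr_gt0.
have e1 : eps <= 1 by rewrite ge_min lexx.
pose W y := kelvin tau l y - tau y - eps * barrier K r (dot y y).
have Wcont y : r <= dot y y -> {for y, continuous W}.
  move=> ry; apply: (continuousB (wcont y ry)).
  apply: (@continuousM _ _ (cst eps) (fun z => barrier K r (dot z z))).
    exact: cst_continuous.
  have Xc : {for y, continuous (fun z => dot z z - r)}.
    by apply: (continuousB (@dotxx_continuous R n y)); exact: cst_continuous.
  apply: (continuousD Xc).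
  apply: (@continuousM _ _ (cst K) (fun z => (dot z z - r) ^+ 2)).
    exact: cst_continuous.
  exact: (continuousM Xc Xc).
suff W0 y : r <= dot y y <= r + d -> 0 <= W y.
  exists eps, d; split=> // y yrd; have := W0 _ yrd; rewrite /W subr_ge0.
  apply: le_trans; apply: ler_wpM2l; first exact: ltW.
  by rewrite /barrier lerDl mulr_ge0 ?sqr_ge0 ?ltW.
move=> yrd; rewrite leNgt; apply/negP => Wneg.
have [||z /[!inE] /andP[rz zr] zmin] :=
    @compact_EVT_min _ R W [set y | r <= dot y y <= r + d] _ (@compact_annulus R n r (r + d)).
- by exists y.
- by apply: continuous_in_subspaceT => z /[!inE] /= /andP[rz _]; exact: Wcont.
have Wz : W z < 0 by apply: le_lt_trans Wneg; apply: zmin; rewrite inE.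
have z0 := nz _ rz.
have wz0 : 0 <= kelvin tau l z - tau z by rewrite subr_ge0 wge // (le_trans lr).
have K20 : 0 < 2 * K by rewrite mulr_gt0.
have KXd : 2 * K * (dot z z - r) <= 1.
  have : dot z z - r <= (2 * K)^-1.
    by rewrite lerBlDl (le_trans zr) // lerD2l ge_min lexx orbT.
  by rewrite -(ler_pM2l K20) mulfV // gt_eqF.
have zr1 : dot z z <= r + 1.
  by apply: le_trans zr _; rewrite lerD2l ge_min lexx.
have rz' : r < dot z z.
  rewrite lt_def rz andbT; apply/negP => /eqP rE.
  by move: Wz; rewrite /W /barrier rE subrr expr0n /= mulr0 addr0 mulr0 subr0 ltNge wz0.
have zr' : dot z z < r + d.
  rewrite lt_def zr andbT; apply/negP => /eqP rE.
  have : mu <= kelvin tau l z - tau z by apply: muP; rewrite /= rE lexx.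
  have : eps * barrier K r (dot z z) <= mu / 2 * 2.
    apply: ler_pM; first exact: ltW.
    - by rewrite /barrier addr_ge0 ?subr_ge0 // mulr_ge0 ?sqr_ge0 // ltW.
    - by rewrite ge_min lexx orbT.
    have X0 : 0 <= dot z z - r by rewrite subr_ge0.
    have X1 : dot z z - r <= 1 by rewrite lerBlDl.
    have : K * (dot z z - r) * (dot z z - r) <= 1 * 1.
      by apply: ler_pM => //; [rewrite mulr_ge0 // ltW|lra].
    by rewrite /barrier expr2; lra.
  by move: Wz; rewrite /W; lra.
have zloc : \forall y \near z, W z <= W y.
  have A := near_gt (@dotxx_continuous R n z) rz'.
  have B := near_lt (@dotxx_continuous R n z) zr'.
  apply: filterS (filterI A B) => u [/= ru ur]; apply: zmin.
  by rewrite inE /= !ltW.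
have [kgE qP] := touching_ineq sol ln0 z0 zloc.
have [f [a [fo a0a ac fB]]] := sol_frame sol z.
have := kelvin_trace_ge sol a0_gt0 l z0 fo ac.
apply/negP; rewrite -ltNge.
have a_ge0 k : 0 <= a k by apply: le_trans (a0a k); exact: ltW.
have ack k : a k <= c by rewrite -ac (bigD1 k) //= lerDl sumr_ge0.
(* The terms a_k^2 / a_k add up to [c]; the remainder is [eps] times a quantity that the choice of
   [K] makes negative. *)
apply: (@le_lt_trans _ _ (\sum_k a k ^+ 2 * ((a k)^-1 + eps * (D0 - 8 * K * m * dot z (f k) ^+ 2)))).
  apply: ler_sum => k _; apply: ler_wpM2l; first exact: sqr_ge0.
  have [q -> qge] := qP (f k); rewrite kgE.
  apply: (Bquad_touching fo (a0a k) (fB k) K0 r0 (ltW rz') zr1 KXd e0 e1 m0) => //.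
  - by apply: mP; rewrite /= zr1 ltW.
  - by rewrite -subr_ge0.
  - by move: Wz; rewrite /W subr_lt0 => /ltW.
have -> : \sum_k a k ^+ 2 * ((a k)^-1 + eps * (D0 - 8 * K * m * dot z (f k) ^+ 2)) =
   c + eps * (D0 * (\sum_k a k ^+ 2)
              - 8 * K * m * \sum_k a k ^+ 2 * dot z (f k) ^+ 2).
  rewrite -ac !mulr_sumr -sumrB mulr_sumr -big_split /=; apply: eq_bigr => k _.
  have : a k != 0 by rewrite gt_eqF // (lt_le_trans a0_gt0).
  by move=> ak0; field.
rewrite gtrDl pmulr_rlt0 // subr_lt0.
apply: (@le_lt_trans _ _ (D0 * c ^+ 2)).
  apply: ler_wpM2l => //; rewrite expr2 -[X in _ <= X * _]ac mulr_suml.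
  by apply: ler_sum => k _; rewrite expr2 ler_wpM2l.
apply: (@lt_le_trans _ _ (8 * K * m * (a0 ^+ 2 * r))).
  have -> : 8 * K * m * (a0 ^+ 2 * r) = c ^+ 2 * D0 + 1.
    by rewrite /K; field; rewrite ?gt_eqF.
  by rewrite mulrC ltrDl.
have Km0 : 0 <= 8 * K * m by apply: ltW; rewrite mulr_gt0 // mulr_gt0.
apply: ler_wpM2l => //.
apply: (@le_trans _ _ (a0 ^+ 2 * dot z z)).
  by apply: ler_wpM2l => //; exact: sqr_ge0.
rewrite (orthonormal_parseval z fo) mulr_sumr; apply: ler_sum => k _.
apply: ler_wpM2r; first exact: sqr_ge0.
by rewrite ler_pXn2r ?nnegrE //; exact: ltW.
Qed.

End Hopf.

(** * Moving spheres *)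

Section MovingSpheres.
Context {R : realType} {n : nat}.
Implicit Types (y v : 'rV[R]_n).

Lemma derive_ge_right (h : R -> R) (d k : R) :
  is_derive (0 : R) 1 h d ->
  (exists2 e, 0 < e & forall t, 0 < t < e -> h 0 + k * t <= h t) -> k <= d.
Proof.
move=> [cD vD] [e e0 eP]; rewrite leNgt; apply/negP => dk.
have : (fun s : R => s^-1 *: ((h \o shift 0) (s *: 1) - h 0)) @ 0^' --> d.
  by rewrite -vD.
move=> /cvgrPdist_lt /(_ (k - d)); rewrite subr_gt0 => /(_ dk).
rewrite near_withinE => /nbhs_ballP[r /= r0 rP].
pose t := Num.min (r / 2) (e / 2).
have t0 : 0 < t by rewrite lt_min !divr_gt0.
have tr : t < r by rewrite gt_min ltr_pdivrMr // ltr_pMr // ltr1n.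
have te : t < e by rewrite gt_min orbC ltr_pdivrMr // ltr_pMr // ltr1n.
have := rP t; rewrite -ball_normE /= sub0r normrN gtr0_norm //.
move=> /(_ tr (lt0r_neq0 t0)); rewrite scaler1 addr0.
rewrite ltr_norml => /andP[+ _]; rewrite /GRing.scale /= => H.
have {H} : t^-1 * (h t - h 0) < k by move: H; lra.
rewrite ltr_pdivrMl // ltNge; apply/negP/negPn.
by rewrite lerBrDl mulrC eP // t0.
Qed.

Lemma dot_inversion (l : R) y : y != 0 ->
  dot (inversion l y) (inversion l y) = l ^+ 4 / dot y y.
Proof.
move=> y0; rewrite /inversion dotZl dotZr; field.
by rewrite dot_eq0.
Qed.

Variables (tau : 'rV[R]_n -> R) (g : 'rV[R]_n -> 'rV[R]_n) (a0 c G : R).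
Hypotheses (sol : solution tau g a0 c) (a0_gt0 : 0 < a0)
  (gG : forall y, dot (g y) (g y) <= G).

(** Its sign decides whether tau(s y) / s decreases in s along rays; on the sphere |y| = l, twice
    [Jac] is the derivative of [kelvin tau l - tau] in the direction [y]. *)
Definition Jac y := tau y - dot (g y) y.

Definition kelvin_le (l : R) := forall y, l ^+ 2 <= dot y y -> tau y <= kelvin tau l y.

Lemma sol_continuous : continuous tau.
Proof. by move=> y; apply: differentiable_continuous; exact: sol_diff sol _. Qed.

Lemma sol_grad_continuous : continuous g.
Proof. by move=> y; apply: differentiable_continuous; exact: sol_gdiff sol _. Qed.

Lemma Jac_continuous : continuous Jac.
Proof.
move=> y; have gy : {for y, continuous (fun z => dot (g z) z)}.
  by apply: continuous_dot; [exact: sol_grad_continuous|].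
exact: (continuousB (sol_continuous (x := y)) gy).
Qed.

Let G0 : 0 <= G.
Proof. by apply: le_trans (gG 0); exact: dot_ge0. Qed.

Lemma is_derive_ray y (s : R) :
  is_derive s (1 : R) (fun t : R => tau (t *: y)) (dot (g (s *: y)) y).
Proof.
have := @is_derive_line R _ _ tau 0 y s (sol_diff sol _).
rewrite sol.(sol_grad) add0r; congr (is_derive _ _ _ _).
by rewrite funeqE => t; rewrite add0r.
Qed.

(** Linear growth from the bounded gradient, written by Young's inequality with a quadratic part as
    small as desired, ready for comparison with the quadratic growth of the transforms. *)
Lemma tau_growth y (k : R) : 0 < k ->
  tau y <= tau 0 + (k * G + dot y y / k) / 2.
Proof.
move=> k0.
have [s _] : exists2 s, s \in `]0, 1[%R &
    tau ((1 : R) *: y) - tau ((0 : R) *: y) = dot (g (s *: y)) y * (1 - 0).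
  apply: (@MVT R (fun t : R => tau (t *: y)) (fun t => dot (g (t *: y)) y)) => //.
    by move=> t _; exact: is_derive_ray.
  apply: derivable_within_continuous => t _.
  by have [] := is_derive_ray y t.
rewrite scale1r scale0r subr0 mulr1 => E.
rewrite -lerBlDl E.
have kn : k != 0 by rewrite gt_eqF.
have -> : dot (g (s *: y)) y = dot (k *: g (s *: y)) y / k.
  by rewrite dotZl; field.
rewrite ler_pdivrMr //; apply: le_trans (dot_le_half _ _) _.
rewrite dotZl dotZr [leRHS](_ : _ = (k * (k * G) + dot y y) / 2); last by field.
rewrite ler_pM2r ?invr_gt0 // lerD2r; do 2 (apply: ler_wpM2l; first exact: ltW).
exact: gG.
Qed.

(** The derivative of tau(s y) / s is -Jac(s y) / s^2. *)
Lemma ray_mono y (th : R) : 0 < th -> th <= 1 ->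
  (forall s, th <= s <= 1 -> 0 <= Jac (s *: y)) -> tau y <= tau (th *: y) / th.
Proof.
move=> th0 th1 Jge.
have [s] : exists2 s, s \in `[th, 1]%R &
    tau ((1 : R) *: y) * 1^-1 - tau (th *: y) * th^-1
    = - Jac (s *: y) / s ^+ 2 * (1 - th).
  have D (t : R) : 0 < t -> is_derive t (1 : R) (fun t : R => tau (t *: y) * t^-1)
       (- Jac (t *: y) / t ^+ 2).
    move=> t0; have tn0 : t != 0 by rewrite gt_eqF.
    have Dt := is_deriveVf (is_derive_id t (1 : R)) tn0.
    apply: is_derive_eq (is_deriveMf (is_derive_ray y t) Dt) _.
    by rewrite /Jac dotZr; field.
  apply: (@MVT_segment R (fun t : R => tau (t *: y) * t^-1)
            (fun t => - Jac (t *: y) / t ^+ 2)) => //.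
    by move=> t; rewrite in_itv /= => /andP[tt _]; apply: D; apply: lt_trans tt.
  apply: derivable_within_continuous => t; rewrite in_itv /= => /andP[tt _].
  by have [] := D t (lt_le_trans th0 tt).
rewrite in_itv /= => s01 E; rewrite -subr_le0.
move: E; rewrite scale1r invr1 mulr1 => ->.
rewrite !mulNr oppr_le0 mulr_ge0 ?subr_ge0 // divr_ge0 ?sqr_ge0 //.
exact: Jge.
Qed.

Lemma kelvin_joint_continuous (l : R) y : l != 0 -> y != 0 ->
  {for (y, l), continuous (fun p : 'rV[R]_n * R => kelvin tau p.2 p.1)}.
Proof.
move=> l0 y0; rewrite /kelvin /inversion.
have fc : {for (y, l), continuous (fun p : 'rV[R]_n * R => p.1)} by exact: cvg_fst.
have sc : {for (y, l), continuous (fun p : 'rV[R]_n * R => p.2)} by exact: cvg_snd.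
have dc : {for (y, l), continuous (fun p : 'rV[R]_n * R => dot p.1 p.1)}.
  by apply: continuous_dot.
have s2c : {for (y, l), continuous (fun p : 'rV[R]_n * R => p.2 ^+ 2)}.
  exact: (continuousM sc sc).
have c1 : {for (y, l), continuous (fun p : 'rV[R]_n * R => dot p.1 p.1 / p.2 ^+ 2)}.
  by apply: (continuousM dc); apply: continuousV => //=; rewrite expf_neq0.
have c2 : {for (y, l), continuous (fun p : 'rV[R]_n * R => p.2 ^+ 2 / dot p.1 p.1)}.
  by apply: (continuousM s2c); apply: continuousV => //=; rewrite dot_eq0.
apply: (continuousM c1).
apply: (@continuous_comp _ _ _
  (fun p : 'rV[R]_n * R => (p.2 ^+ 2 / dot p.1 p.1) *: p.1) tau); last exact: sol_continuous.
exact: (continuousZ c2 fc).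
Qed.

(** Outside the sphere the inverted point lies in the ball of radius [L], where [tau >= m]; hence
    the transform is at least (m / L^2) |y|^2, uniformly in the radius. *)
Lemma kelvin_growth (L : R) : 0 < L -> exists2 r : R, 0 < r &
  forall (l : R) y, 0 < l -> l <= L -> l ^+ 2 <= dot y y -> r < dot y y ->
    tau y < kelvin tau l y.
Proof.
move=> L0; have [m m0 mP] := compact_pos_lb (@compact_annulus R n 0 (L ^+ 2))
  (fun y _ => sol_continuous (x := y)) (fun y _ => sol_gt0 sol y).
pose b := m / L ^+ 2.
have b0 : 0 < b by rewrite divr_gt0 // exprn_gt0.
(* With k = 1/b, [tau_growth] bounds [tau] by tau 0 + G / (2 b) + b |y|^2 / 2, which is below b
   |y|^2 exactly when |y|^2 > r. *)
pose r := 2 * (tau 0 + G / (2 * b)) / b.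
have T0 : 0 < tau 0 + G / (2 * b).
  by rewrite ltr_pwDl ?(sol_gt0 sol) // divr_ge0 // mulr_ge0 // ltW.
have r0 : 0 < r by rewrite divr_gt0 // mulr_gt0.
exists r => // l y l0 lL ly ry.
have y0 : y != 0 by rewrite -dot_gt0 (lt_trans r0).
have N0 : 0 < dot y y by rewrite dot_gt0.
have l20 : 0 < l ^+ 2 by rewrite exprn_gt0.
have lL2 : l ^+ 2 <= L ^+ 2 by rewrite ler_pXn2r ?nnegrE // ltW.
have : m <= tau (inversion l y).
  apply: mP; rewrite /= dot_ge0 /= dot_inversion // ler_pdivrMr //.
  rewrite (_ : l ^+ 4 = l ^+ 2 * l ^+ 2); last by ring.
  by apply: ler_pM => //; exact: ltW.
move=> mt; apply: (@lt_le_trans _ _ (dot y y * b)); last first.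
  rewrite /kelvin /b -!mulrA; apply: ler_wpM2l; first exact: ltW.
  have LV : (L ^+ 2)^-1 <= (l ^+ 2)^-1 by rewrite lef_pV2 ?posrE // exprn_gt0.
  rewrite mulrC; apply: ler_pM => //; last exact: ltW.
  by rewrite invr_ge0 sqr_ge0.
have bV : 0 < b^-1 by rewrite invr_gt0.
apply: le_lt_trans (tau_growth y bV) _; rewrite invrK.
have : r * b < dot y y * b by rewrite ltr_pM2r.
rewrite /r divfK ?gt_eqF // invfM.
set N := dot y y; have -> : b^-1 * G = 2 * (G * (2^-1 / b)) by field; rewrite gt_eqF.
lra.
Qed.

(** A strong maximum principle obtained from spheres centred at the origin only. Contacts lie in a
    compact set, so one is farthest from the origin; beyond its sphere the inequality is strict, and
    [hopf_kelvin] gives a positive radial derivative there, which is impossible at an interior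
    minimum. *)
Lemma kelvin_lt (l : R) : 0 < l -> kelvin_le l ->
  forall y, l ^+ 2 < dot y y -> tau y < kelvin tau l y.
Proof.
move=> l0 Cl y1 ly1; rewrite lt_neqAle Cl ?ltW // andbT; apply/eqP => E1.
have [r r0 rP] := kelvin_growth l0.
have ln0 : l != 0 by rewrite gt_eqF.
have l20 : 0 < l ^+ 2 by rewrite exprn_gt0.
pose w y := kelvin tau l y - tau y.
have wcont y : l ^+ 2 < dot y y -> {for y, continuous w}.
  move=> ly; have y0 : y != 0 by rewrite -dot_gt0 (lt_trans l20).
  exact: (continuousB (@kelvin_continuous _ _ _ _ _ _ sol l _ y0) (sol_continuous (x := y))).
pose A := [set y : 'rV[R]_n | dot y1 y1 <= dot y y <= r].
pose Z := A `&` [set y : 'rV[R]_n | w y <= 0].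
have Zclosed : closed Z.
  rewrite -openC openE => y; rewrite /interior /Z /A /= => nZ.
  have [yy1|y1y] := ltP (dot y y) (dot y1 y1).
    by apply: filterS (near_lt (@dotxx_continuous R n y) yy1) => z zy [/andP[zr _] _]; move: zr; rewrite leNgt zy.
  have [ry|yr] := ltP r (dot y y).
    by apply: filterS (near_gt (@dotxx_continuous R n y) ry) => z zy [/andP[_ zr] _]; move: zr; rewrite leNgt zy.
  have wy : 0 < w y by rewrite ltNge; apply/negP => wy; apply: nZ; rewrite y1y yr.
  have := near_gt (wcont y (lt_le_trans ly1 y1y)) wy.
  by apply: filterS => z wz [_ zw]; have := zw : w z <= 0; rewrite leNgt wz.
have Zc : compact Z by apply: subclosed_compact Zclosed (@compact_annulus R n (dot y1 y1) r) _ => y [].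
have Zy1 : Z y1.
  rewrite /Z /A /w /= lexx E1 subrr lexx; split=> //=.
  by rewrite leNgt; apply/negP => /(rP l _ l0 (lexx _) (ltW ly1)); rewrite E1 ltxx.
have [||z /[!inE] Zz zmax] := @compact_EVT_max _ R (fun y : 'rV[R]_n => dot y y) Z _ Zc.
- by exists y1.
- by apply: continuous_subspaceT; exact: dotxx_continuous.
have [[/andP[y1z zr] wz]] := (Zz : _ /\ _).
have lz : l ^+ 2 < dot z z by apply: lt_le_trans ly1 y1z.
have wz0 : w z = 0.
  by apply/eqP; rewrite eq_le wz subr_ge0 Cl // ltW.
have wgt y : dot z z < dot y y -> tau y < kelvin tau l y.
  move=> zy; have ly : l ^+ 2 <= dot y y by rewrite ltW // (lt_trans lz).
  have [ry|yr] := ltP r (dot y y); first exact: rP.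
  rewrite ltNge; apply/negP => wy; have : y \in Z.
    rewrite inE; split; rewrite /A /w /= ?subr_le0 //.
    by rewrite yr andbT (le_trans y1z) // ltW.
  by move/zmax; rewrite leNgt zy.
have [eps [d [e0 d0 edP]]] := hopf_kelvin sol a0_gt0 gG l0 (ltW lz) Cl wgt.
have z0 : z != 0 by rewrite -dot_gt0 (lt_trans l20).
have N0 : 0 < dot z z by rewrite dot_gt0.
pose D v := dot (kelvin_grad tau g l z) v - dot (g z) v.
have wD v : is_derive (0 : R) 1 (fun t : R => w (z + t *: v)) (D v).
  have z00 : z + (0 : R) *: v != 0 by rewrite scale0r addr0.
  have D1 := is_derive_kelvin sol ln0 z00.
  have D2 := @is_derive_line R _ _ tau z v 0 (sol_diff sol _).
  have := is_deriveB D1 D2.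
  by rewrite sol.(sol_grad) scale0r addr0; exact.
have dotl (t : R) : dot (z + t *: z) (z + t *: z) = (1 + t) ^+ 2 * dot z z.
  by rewrite !dotE; ring.
have : 2 * eps * dot z z <= D z.
  apply: (derive_ge_right (wD z)).
  (* The factor 3 comes from t (2 + t) <= 3 t for 0 < t < 1. *)
  exists (Num.min 1 (d / (3 * dot z z))).
    by rewrite lt_min ltr01 divr_gt0 // mulr_gt0.
  move=> t /andP[t0]; rewrite lt_min => /andP[t1].
  rewrite ltr_pdivlMr ?mulr_gt0 // => td.
  rewrite scale0r addr0 wz0 add0r.
  apply: le_trans (edP (z + t *: z) _); rewrite dotl.
    rewrite -subr_ge0 (_ : _ - _ = eps * (t ^+ 2 * dot z z)); last by ring.
    by rewrite mulr_ge0 ?(ltW e0) // mulr_ge0 ?sqr_ge0 // ltW.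
  have e : (1 + t) ^+ 2 * dot z z = dot z z + t * (2 + t) * dot z z by ring.
  rewrite e lerDl lerD2l; apply/andP; split.
    by rewrite !mulr_ge0 ?(ltW t0) ?(ltW N0) // addr_ge0 // ltW.
  apply: le_trans (ltW td); rewrite -mulrA; apply: ler_wpM2l; first exact: ltW.
  by apply: ler_wpM2r; [exact: ltW|lra].
have : 0 <= D (- z).
  apply: (derive_ge_right (wD (- z))).
  have : \forall t \near (0 : R), l ^+ 2 < dot (z + t *: (- z)) (z + t *: (- z)).
    exact: (near_line (- z) (near_gt (@dotxx_continuous R n z) lz)).
  case/nbhs_ballP => e /= e00 eP; exists e => // t /andP[t0 te].
  rewrite scale0r addr0 wz0 mul0r addr0 subr_ge0; apply: Cl; apply: ltW; apply: eP.
  by rewrite -ball_normE /= sub0r normrN gtr0_norm.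
rewrite /D !dotNr => Dn Dz.
have : 0 < eps * dot z z by rewrite mulr_gt0.
by move: Dn Dz; lra.
Qed.


End MovingSpheres.

Section MovingSpheresConclusion.
Context {R : realType} {n : nat}.
Implicit Types (y v : 'rV[R]_n).
Variables (tau : 'rV[R]_n -> R) (g : 'rV[R]_n -> 'rV[R]_n) (a0 c G : R).
Hypotheses (sol : solution tau g a0 c) (a0_gt0 : 0 < a0)
  (gG : forall y, dot (g y) (g y) <= G).

Lemma kelvin_sphere (l : R) y : l != 0 -> dot y y = l ^+ 2 ->
  inversion l y = y /\ kelvin tau l y = tau y.
Proof.
move=> l0 yl; rewrite /kelvin /inversion yl mulfV ?expf_neq0 // scale1r.
by rewrite mul1r.
Qed.

Lemma is_derive_kelvin_sphere (l : R) y : l != 0 -> dot y y = l ^+ 2 ->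
  is_derive (0 : R) 1 (fun t : R => kelvin tau l (y + t *: y) - tau (y + t *: y))
    (2 * Jac tau g y).
Proof.
move=> l0 yl; have [iy ky] := kelvin_sphere l0 yl.
have y0 : y + (0 : R) *: y != 0.
  by rewrite scale0r addr0 -dot_eq0 yl expf_neq0.
have D1 := is_derive_kelvin sol l0 y0.
have D2 := @is_derive_line R _ _ tau y y 0 (sol_diff sol _).
have := is_deriveB D1 D2.
rewrite sol.(sol_grad) scale0r addr0 => H; apply: is_derive_eq H _.
rewrite /kelvin_grad iy /Jac /hrefl !dotE yl (dotC y (g y)).
by field.
Qed.

(** On the reflecting sphere the difference vanishes, so Hopf's lemma bounds its radial derivative
    [2 * Jac] from below. *)
Lemma Jac_sphere_gt0 (l : R) : 0 < l -> kelvin_le tau l ->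
  forall y, dot y y = l ^+ 2 -> 0 < Jac tau g y.
Proof.
move=> l0 Cl y yl; have ln0 : l != 0 by rewrite gt_eqF.
have l20 : 0 < l ^+ 2 by rewrite exprn_gt0.
have [eps [d [e0 d0 edP]]] := hopf_kelvin sol a0_gt0 gG l0 (lexx _) Cl
  (kelvin_lt sol a0_gt0 gG l0 Cl).
suff : 2 * eps * l ^+ 2 <= 2 * Jac tau g y.
  have e2 : 0 < eps * l ^+ 2 by exact: mulr_gt0.
  by move=> H; lra.
apply: (derive_ge_right (is_derive_kelvin_sphere ln0 yl)).
have dotl (t : R) : dot (y + t *: y) (y + t *: y) = l ^+ 2 + t * (2 + t) * l ^+ 2.
  by rewrite !dotE yl; ring.
exists (Num.min 1 (d / (3 * l ^+ 2))).
  by rewrite lt_min ltr01 divr_gt0 // mulr_gt0.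
move=> t /andP[t0]; rewrite lt_min => /andP[t1].
rewrite ltr_pdivlMr ?mulr_gt0 // => td.
rewrite scale0r addr0 (kelvin_sphere ln0 yl).2 subrr add0r.
apply: le_trans (edP (y + t *: y) _); rewrite dotl.
  rewrite -subr_ge0 (_ : _ - _ = eps * (t ^+ 2 * l ^+ 2)); last by ring.
  by rewrite mulr_ge0 ?(ltW e0) // mulr_ge0 ?sqr_ge0.
rewrite lerDl lerD2l; apply/andP; split.
  by apply: mulr_ge0; [apply: mulr_ge0; [exact: ltW|lra]|exact: ltW].
apply: le_trans (ltW td); rewrite -mulrA; apply: ler_wpM2l; first exact: ltW.
by apply: ler_wpM2r; [exact: ltW|lra].
Qed.

(** With th = l^2 / |y|^2 the inverted point is th y and the transform is tau(th y) / th, so this is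
    monotonicity along the segment between them. It replaces a comparison near the sphere, where the
    difference degenerates. *)
Lemma kelvin_le_segment (l : R) y : l != 0 -> y != 0 -> l ^+ 2 <= dot y y ->
  (forall s, l ^+ 2 / dot y y <= s <= 1 -> 0 <= Jac tau g (s *: y)) ->
  tau y <= kelvin tau l y.
Proof.
move=> l0 y0 ly Jge; have N0 : 0 < dot y y by rewrite dot_gt0.
have th0 : 0 < l ^+ 2 / dot y y by rewrite divr_gt0 // exprn_even_gt0.
have th1 : l ^+ 2 / dot y y <= 1 by rewrite ler_pdivrMr // mul1r.
apply: le_trans (ray_mono sol th0 th1 Jge) _.
by rewrite /kelvin /inversion invf_div mulrC.
Qed.

(** By growth only a ball matters, and compactness reduces to one point [y]: inside the sphere there
    is nothing to prove nearby, outside it the strict inequality persists, and on it [Jac] is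
    positive on a neighbourhood that contains the segments of [kelvin_le_segment]. *)
Lemma kelvin_le_open (l : R) : 0 < l -> kelvin_le tau l ->
  \forall l' \near l, kelvin_le tau l'.
Proof.
move=> l0 Cl; have ln0 : l != 0 by rewrite gt_eqF.
have L0 : 0 < l + 1 by rewrite addr_gt0.
have [r r0 rP] := kelvin_growth sol gG L0.
have := @compact_annulus R n 0 r; move/compact_near_coveringP.
move=> /(_ R (nbhs l) (fun l' y => l' ^+ 2 <= dot y y -> tau y <= kelvin tau l' y)).
have l2c : {for l, continuous (fun z : R => z ^+ 2)}.
  by apply: (@continuousM _ _ (fun z : R => z) (fun z : R => z)).
have pos : \forall l' \near l, 0 < l' by apply: (@near_gt R _ id l 0).
move=> H; have {H} : \forall l' \near l, [set y : 'rV[R]_n | 0 <= dot y y <= r] `<=`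
    [set y | l' ^+ 2 <= dot y y -> tau y <= kelvin tau l' y].
  apply: H => y _.
  have [yl|ly|yl] := ltgtP (dot y y) (l ^+ 2).
  - pose m := (dot y y + l ^+ 2) / 2.
    have ym : dot y y < m by rewrite /m; lra.
    have ml : m < l ^+ 2 by rewrite /m; lra.
    exists ([set z | dot z z < m], [set l' | m < l' ^+ 2]) => /=.
      split; first exact: (near_lt (@dotxx_continuous R n y) ym).
      exact: (near_gt l2c ml).
    by move=> [z l'] [/= zm ml']; rewrite leNgt (lt_trans zm).
  - have y0 : y != 0 by rewrite -dot_gt0 (le_lt_trans _ ly) // sqr_ge0.
    have wy := kelvin_lt sol a0_gt0 gG l0 Cl ly.
    have tc : {for (y, l), continuous (fun p : 'rV[R]_n * R => tau p.1)}.
      apply: (@continuous_comp _ _ _ (fun p : 'rV[R]_n * R => p.1) tau).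
        exact: cvg_fst.
      exact: sol_continuous sol _.
    have := near_lt2 tc (kelvin_joint_continuous sol ln0 y0) wy.
    by apply: filterS => -[z l'] /= /ltW.
  have y0 : y != 0 by rewrite -dot_gt0 yl exprn_gt0.
  have Jy := Jac_sphere_gt0 l0 Cl yl.
  have [e /= e0 eP] := (nbhs_ballP _ _).1 (near_gt (Jac_continuous sol (x := y)) Jy).
  have ic : {for (y, l), continuous (fun p : 'rV[R]_n * R => inversion p.2 p.1)}.
    have fc : {for (y, l), continuous (fun p : 'rV[R]_n * R => p.1)} by exact: cvg_fst.
    have sc : {for (y, l), continuous (fun p : 'rV[R]_n * R => p.2)} by exact: cvg_snd.
    have dc : {for (y, l), continuous (fun p : 'rV[R]_n * R => dot p.1 p.1)}.
      by apply: continuous_dot.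
    have c2 : {for (y, l), continuous (fun p : 'rV[R]_n * R => p.2 ^+ 2 / dot p.1 p.1)}.
      apply: (continuousM (continuousM sc sc)).
      by apply: continuousV => //=; rewrite dot_eq0.
    exact: (continuousZ c2 fc).
  have ib : \forall p \near (y, l), ball y e (inversion p.2 p.1).
    by apply: ic; rewrite /= (kelvin_sphere ln0 yl).1; exact: nbhsx_ballx.
  have yb : \forall p \near (y, l), ball y e (p : 'rV[R]_n * R).1.
    have fc : {for (y, l), continuous (fun p : 'rV[R]_n * R => p.1)} by exact: cvg_fst.
    exact: (fc (ball y e) (nbhsx_ballx y e e0)).
  have yn0 : \forall p \near (y, l), 0 < dot (p : 'rV[R]_n * R).1 p.1.
    have dc : {for (y, l), continuous (fun p : 'rV[R]_n * R => dot p.1 p.1)}.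
      by apply: continuous_dot; exact: cvg_fst.
    by apply: (near_gt dc); rewrite /= dot_gt0.
  have lp : \forall p \near (y, l), 0 < (p : 'rV[R]_n * R).2.
    have sc : {for (y, l), continuous (fun p : 'rV[R]_n * R => p.2)} by exact: cvg_snd.
    exact: (sc [set l' | 0 < l'] pos).
  apply: filterS (filterI (filterI ib yb) (filterI yn0 lp)).
  move=> [z l'] [[/= ibz ybz] [zn0 l'0]] l'z.
  have z0 : z != 0 by rewrite -dot_gt0.
  apply: kelvin_le_segment => //; first by rewrite gt_eqF.
  move=> s /andP[s0 s1]; apply: ltW; apply: eP.
  move: ibz ybz; rewrite -ball_normE /= /inversion.
  set th := l' ^+ 2 / dot z z in s0 * => ibz ybz.
  have [th1|th1] := eqVneq th 1.
    have -> : s = 1 by apply/eqP; rewrite eq_le s1 -th1 s0.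
    by rewrite scale1r.
  have tl1 : th < 1 by rewrite lt_neqAle th1 (le_trans s0 s1).
  have u0 : 0 < 1 - th by rewrite subr_gt0.
  (* It writes [s *: z] as a convex combination of the inverted point [th *: z] and of [z], both in
     the ball where [Jac] is positive. *)
  pose a := (1 - s) / (1 - th).
  have a_ge0 : 0 <= a by rewrite divr_ge0 ?subr_ge0 // ltW.
  have a_le1 : a <= 1 by rewrite ler_pdivrMr // mul1r lerD2l lerN2.
  have -> : y - s *: z = a *: (y - th *: z) + (1 - a) *: (y - z).
    by apply/rowP => i; rewrite !mxE /a; field; rewrite gt_eqF.
  clearbody a; apply: le_lt_trans (ler_normD _ _) _; rewrite !normrZ.
  rewrite !ger0_norm ?subr_ge0 //.
  have [a1|an1] := eqVneq a 1; first by rewrite a1; lra.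
  have an1' : 0 < 1 - a by rewrite subr_gt0 lt_neqAle an1.
  apply: (@lt_le_trans _ _ (a * e + (1 - a) * e)); last first.
    by rewrite -mulrDl addrC subrK mul1r.
  by apply: ler_ltD; [apply: ler_wpM2l => //; exact: ltW|rewrite ltr_pM2l].
have near1 : \forall l' \near l, l' <= l + 1.
  have ll : l < l + 1 by rewrite ltrDl.
  by apply: filterS (@near_lt R _ id l _ _ ll) => // z /ltW.
move=> H; apply: filterS (filterI (filterI pos near1) H).
move=> l' [[l'0 l'L] HK] y l'y.
have [ry|yr] := ltP r (dot y y); first by apply: ltW; exact: rP.
by apply: HK => //=; rewrite dot_ge0.
Qed.

End MovingSpheresConclusion.

(** * Spheres of all radii and centres, and vanishing of the gradient *)

Section Liouville.
Context {R : realType} {n : nat}.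
Implicit Types (y v : 'rV[R]_n).

Section AllSpheres.
Variables (tau : 'rV[R]_n -> R) (g : 'rV[R]_n -> 'rV[R]_n) (a0 c G : R).
Hypotheses (sol : solution tau g a0 c) (a0_gt0 : 0 < a0)
  (gG : forall y, dot (g y) (g y) <= G).

(** Near the origin [Jac] is positive because Jac 0 = tau 0; far away the factor 1/l^2 in the
    transform wins for small radii. *)
Lemma kelvin_le_start : exists2 l0 : R, 0 < l0 &
  forall l, 0 < l -> l <= l0 -> kelvin_le tau l.
Proof.
have G0 : 0 <= G by apply: le_trans (gG 0); exact: dot_ge0.
have J0 : 0 < Jac tau g 0 by rewrite /Jac dot0r subr0 (sol_gt0 sol).
have [e /= e0 eP] := (nbhs_ballP _ _).1 (near_gt (Jac_continuous sol (x := 0)) J0).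
pose r := (e / 2) ^+ 2.
have r0 : 0 < r by rewrite exprn_gt0 // divr_gt0.
have Jr y : dot y y <= r -> 0 < Jac tau g y.
  move=> yr; apply: eP; rewrite -ball_normE /= sub0r normrN.
  apply: (@le_lt_trans _ _ (e / 2)); first by apply: norm_le_dot => //; rewrite divr_ge0 // ltW.
  by rewrite ltr_pdivrMr // ltr_pMr // ltr1n.
have [m m0 mP] := compact_pos_lb (@compact_annulus R n 0 r)
  (fun y _ => sol_continuous sol (x := y)) (fun y _ => sol_gt0 sol y).
(* For |y|^2 >= r, [tau_growth] with k = 1 gives tau y <= Q |y|^2. Radii l <= 1 with l <= m / Q
   satisfy m / l^2 >= Q. *)
pose Q := (tau 0 + G / 2) / r + 2^-1.
have T0 : 0 < tau 0 + G / 2.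
  by rewrite ltr_pwDl ?(sol_gt0 sol) // divr_ge0.
have Q0 : 0 < Q by rewrite addr_gt0 // divr_gt0.
exists (Num.min 1 (Num.min r (m / Q))).
  by rewrite !lt_min ltr01 r0 divr_gt0.
move=> l l0; rewrite !le_min => /and3P[l1 lr lm].
have l2l : l ^+ 2 <= l by rewrite expr2 ler_piMr // ltW.
have l20 : 0 < l ^+ 2 by rewrite exprn_gt0.
have ln0 : l != 0 by rewrite gt_eqF.
move=> y ly; have N0 : 0 < dot y y by apply: lt_le_trans ly.
have y0 : y != 0 by rewrite -dot_gt0.
have [yr|ry] := leP (dot y y) r.
  apply: (kelvin_le_segment sol ln0 y0 ly) => s /andP[s0 s1].
  apply/ltW/Jr; rewrite dotZl dotZr mulrA.
  have sge0 : 0 <= s by apply: le_trans s0; rewrite divr_ge0 // ltW.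
  by apply: le_trans yr; apply: ler_piMl; [exact: ltW|apply: mulr_ile1].
have : m <= tau (inversion l y).
  apply: mP; rewrite /= dot_ge0 /= dot_inversion // ler_pdivrMr //.
  rewrite (_ : l ^+ 4 = l ^+ 2 * l ^+ 2); last by ring.
  apply: ler_pM => //; rewrite ?(ltW l20) //; exact: le_trans lr.
move=> mt; apply: (@le_trans _ _ (dot y y * Q)).
  apply: le_trans (tau_growth sol gG y (ltr01)) _; rewrite mul1r divr1.
  have : tau 0 + G / 2 <= dot y y * ((tau 0 + G / 2) / r).
    by rewrite mulrA ler_pdivlMr // mulrC; apply: ler_wpM2r; exact: ltW.
  rewrite /Q mulrDr; set T := dot y y * (_ / r); lra.
rewrite /kelvin -mulrA; apply: ler_wpM2l; first exact: ltW.
rewrite mulrC ler_pdivlMr //; apply: le_trans mt.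
rewrite mulrC -ler_pdivlMr //; exact: le_trans lm.
Qed.

Lemma kelvin_le_closed (l0 l : R) : 0 < l0 -> l0 < l ->
  (forall s, l0 <= s < l -> kelvin_le tau s) -> kelvin_le tau l.
Proof.
move=> l00 l0l Hs y ly; rewrite leNgt; apply/negP => wy.
have lgt0 : 0 < l by apply: lt_trans l0l.
have ln0 : l != 0 by rewrite gt_eqF.
have y0 : y != 0 by rewrite -dot_gt0 (lt_le_trans _ ly) // exprn_gt0.
have [[A B] /= [nA nB] AB] := near_lt (kelvin_joint_continuous sol ln0 y0) wy.
have [e /= e0 eP] := (nbhs_ballP _ _).1 nB.
pose s := l - Num.min (e / 2) (l - l0).
have mn0 : 0 < Num.min (e / 2) (l - l0) by rewrite lt_min divr_gt0 // subr_gt0.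
have sl : s < l by rewrite /s gtrBl.
have l0s : l0 <= s by rewrite /s lerBrDr -lerBrDl ge_min lexx orbT.
have : kelvin tau s y < tau y.
  apply: (AB (y, s)); split; first exact: nbhs_singleton nA.
  apply: eP; rewrite -ball_normE /= /s opprB addrCA subrr addr0 gtr0_norm //.
  by rewrite gt_min ltr_pdivrMr // ltr_pMr // ltr1n.
rewrite ltNge; apply/negP/negPn; apply: Hs; first by rewrite l0s.
by apply: le_trans ly; rewrite ler_pXn2r ?nnegrE ?ltW // (lt_le_trans l00).
Qed.

Lemma kelvin_le_all (l : R) : 0 < l -> kelvin_le tau l.
Proof.
move=> l0; have [l1 l10 l1P] := kelvin_le_start.
have [ll1|l1l] := leP l l1; first exact: l1P.
apply: (@real_induction R (kelvin_le tau) l1 l); last by rewrite lexx ltW.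
- exact: l1P.
- move=> t l1t tl Hs.
  have t0 : 0 < t by apply: lt_le_trans l1t.
  have Ct : kelvin_le tau t by apply: Hs; rewrite l1t lexx.
  have [d /= d0 dP] := (nbhs_ballP _ _).1 (kelvin_le_open sol a0_gt0 gG t0 Ct).
  exists d => // s /andP[ts std]; apply: dP; rewrite -ball_normE /= distrC.
  by rewrite gtr0_norm ?subr_gt0 // ltrBlDl.
- move=> t l1t tl Hs; exact: (kelvin_le_closed l10 l1t).
Qed.

(** The sphere through [y] is admissible, and the difference, zero at [y], is nonnegative further
    along the ray. *)
Lemma Jac_ge0 y : 0 <= Jac tau g y.
Proof.
have [->|y0] := eqVneq y 0; first by rewrite /Jac dot0r subr0 ltW // (sol_gt0 sol).
have N0 : 0 < dot y y by rewrite dot_gt0.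
pose l := Num.sqrt (dot y y).
have l0 : 0 < l by rewrite sqrtr_gt0.
have l2 : dot y y = l ^+ 2 by rewrite sqr_sqrtr // ltW.
have ln0 : l != 0 by rewrite gt_eqF.
have : 0 <= 2 * Jac tau g y.
  apply: (derive_ge_right (is_derive_kelvin_sphere sol ln0 l2)).
  exists 1 => // t /andP[t0 t1].
  rewrite scale0r addr0 (kelvin_sphere _ ln0 l2).2 subrr add0r mul0r subr_ge0.
  apply: kelvin_le_all => //; rewrite !dotE -l2.
  have -> : dot y y + t * dot y y + (t * dot y y + t * (t * dot y y)) = dot y y + t * (2 + t) * dot y y.
    by ring.
  by rewrite lerDl !mulr_ge0 ?addr_ge0 // ltW.
by rewrite pmulr_rge0.
Qed.

End AllSpheres.

Lemma solution_shift (tau : 'rV[R]_n -> R) (g : 'rV[R]_n -> 'rV[R]_n) (a0 c : R) x :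
  solution tau g a0 c ->
  solution (fun y => tau (x + y)) (fun y => g (x + y)) a0 c.
Proof.
move=> [t0 td tg gd fr].
have shd (W : normedModType R) (h : 'rV[R]_n -> W) y :
    differentiable h (x + y) -> differentiable (fun z => h (x + z)) y /\
    forall v, 'D_v (fun z => h (x + z)) y = 'D_v h (x + y).
  move=> hd; split.
    by apply: (@differentiable_comp _ _ _ _ (fun z => x + z) h).
  move=> v; apply: (@derive_val _ _ _ _ _ _ _
    (is_derive_chain (g := fun z => x + z) _ hd)).
  have := is_deriveD (@is_derive_cst _ _ _ x y v) (@is_derive_id _ _ y v).
  by rewrite add0r; exact.
apply: Solution => [y|y|y v|y|y].
- exact: t0.
- exact: (shd _ tau y (td _)).1.
- by rewrite (shd _ tau y (td _)).2.
- exact: (shd _ g y (gd _)).1.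
- have [f [a [fo aa ac fB]]] := fr (x + y); exists f, a.
  split=> [|||k]; [exact: fo|exact: aa|exact: ac|].
  have E := (shd _ g y (gd _)).2 (f k); rewrite E; exact: fB.
Qed.

(** With spheres centred at z - y, [Jac_ge0] reads tau z >= <g z, y> for every y; a large multiple
    of a nonzero [g z] violates it. *)
Lemma solution_grad_eq0 (tau : 'rV[R]_n -> R) (g : 'rV[R]_n -> 'rV[R]_n) (a0 c G : R) :
  solution tau g a0 c -> 0 < a0 -> (forall y, dot (g y) (g y) <= G) ->
  forall y, g y = 0.
Proof.
move=> sol a00 gG z; apply/eqP; rewrite -dot_eq0 eq_le dot_ge0 andbT leNgt.
apply/negP => g0.
pose k := (tau z + 1) / dot (g z) (g z).
pose y := k *: g z.
have := Jac_ge0 (solution_shift (z - y) sol) a00 (fun y => gG _) y.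
rewrite /Jac subrK /y dotZr /k divfK ?gt_eqF //; lra.
Qed.

End Liouville.

(** * Inverse function theorem *)

Section InverseFunction.
Context {R : realType} {n : nat}.
Implicit Types (x y v : 'rV[R]_n).

Lemma mulmx_bound (L : 'M[R]_n) : exists2 K : R, 0 < K &
  forall u : 'rV[R]_n, `|u *m L| <= K * `|u|.
Proof.
pose S := \sum_i \sum_j `|L i j|.
have S0 : 0 <= S by apply: sumr_ge0 => i _; apply: sumr_ge0.
exists (S + 1); first by rewrite ltr_wpDl.
move=> u; apply: norm_le_coord; first by rewrite mulr_ge0 // addr_ge0.
move=> j; rewrite mxE; apply: le_trans (ler_norm_sum _ _ _) _.
apply: (@le_trans _ _ (S * `|u|)); last by rewrite ler_wpM2r // lerDl.
rewrite mulr_suml; apply: ler_sum => i _; rewrite normrM mulrC.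
apply: ler_pM => //; last exact: coord_le_norm.
by rewrite (bigD1 j) //= lerDl sumr_ge0.
Qed.

Lemma diff_near (f : 'rV[R]_n -> 'rV[R]_n) x (e : R) : differentiable f x -> 0 < e ->
  \forall z \near x, `|f z - f x - 'D_(z - x) f x| <= e * `|z - x|.
Proof.
move=> fx e0; have /diff_locally/eqaddoP/(_ e e0) H := fx.
have H' : \forall h \near (0 : 'rV[R]_n), `|f (h + x) - f x - 'd f x h| <= e * `|h|.
  by apply: filterS H => h /=; rewrite opprD addrA.
rewrite (near_shift 0 x); apply: filterS H' => h /=.
by rewrite subr0 addrK deriveE.
Qed.

Lemma near_diff (f : 'rV[R]_n -> 'rV[R]_n) x (T : 'M[R]_n) :
  (forall e : R, 0 < e -> \forall z \near x, `|f z - f x - (z - x) *m T| <= e * `|z - x|) ->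
  differentiable f x /\ forall v, 'D_v f x = v *m T.
Proof.
move=> fT; have [K K0 KT] := mulmx_bound T.
have Tc : continuous (mulmxr T : 'rV[R]_n -> 'rV[R]_n).
  move=> u; apply: dist_lt_continuous => e e0.
  apply/nbhs_ballP; exists (e / K) => /=.
    by rewrite divr_gt0.
  move=> w; rewrite -ball_normE /= ltr_pdivlMr // mulrC => H.
  by rewrite -mulmxBl (le_lt_trans (KT _)).
have fE : f \o shift x = cst (f x) + (mulmxr T : 'rV[R]_n -> 'rV[R]_n) +o_ (0 : 'rV[R]_n) id.
  apply/eqaddoP => e e0; have := fT e e0; rewrite (near_shift 0 x).
  by apply: filterS => h /=; rewrite subr0 addrK opprD addrA.
have dfE := diff_unique Tc fE.
have fx : differentiable f x by apply/diff_locallyP; rewrite dfE.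
by split=> // v; rewrite deriveE // dfE.
Qed.

Lemma derive_sum_delta (W : normedModType R) (f : 'rV[R]_n -> W) x v : differentiable f x ->
  'D_v f x = \sum_i v ord0 i *: 'D_(delta_mx ord0 i) f x.
Proof.
move=> fx; rewrite deriveE // {1}(row_sum_delta v) linear_sum.
by apply: eq_bigr => i _; rewrite linearZ /= deriveE.
Qed.

Variables (f : 'rV[R]_n -> 'rV[R]_n) (U : set 'rV[R]_n) (x0 : 'rV[R]_n).
Hypotheses (Uopen : open U) (Ux0 : U x0)
  (fdiff : forall x, U x -> differentiable f x)
  (fC1 : forall v x, U x -> {for x, continuous (fun z => 'D_v f z)})
  (finj : forall v, 'D_v f x0 = 0 -> v = 0).

Let A := jacobian f x0.
Let L := invmx A.

Let Aunit : A \in unitmx.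
Proof.
rewrite -row_free_unit; apply: inj_row_free => v vA.
by apply: finj; rewrite deriveEjacobian //; exact: fdiff.
Qed.

Let AL v : 'D_v f x0 *m L = v.
Proof. by rewrite deriveEjacobian ?mulmxK //; exact: fdiff. Qed.

(** It is enough to treat basis vectors, along which the derivatives are continuous. Taking [n.+1]
    rather than [n] keeps the tolerance positive when n = 0. *)
Let near_half : \forall x \near x0, U x /\
  forall v, `|v - 'D_v f x *m L| <= 2^-1 * `|v|.
Proof.
pose d i x := delta_mx ord0 i - 'D_(delta_mx ord0 i) f x *m L.
have [K K0 KP] := mulmx_bound L.
have near_i : \forall x \near x0, forall i, `|d i x| < (2 * n.+1%:R)^-1.
  apply: (@filter_forall _ _ (fun i => [set x | `|d i x| < (2 * n.+1%:R)^-1]) (nbhs x0) (nbhs_filter x0)) => i.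
  have : \forall x \near x0,
     `|'D_(delta_mx ord0 i) f x0 - 'D_(delta_mx ord0 i) f x| < (2 * n.+1%:R)^-1 / K.
    apply: (near_dist_lt (fC1 (v := delta_mx ord0 i) Ux0)).
    by rewrite divr_gt0 // invr_gt0 mulr_gt0.
  apply: filterS => x; rewrite ltr_pdivlMr // mulrC => H.
  have E : d i x = ('D_(delta_mx ord0 i) f x0 - 'D_(delta_mx ord0 i) f x) *m L.
    by rewrite /d mulmxBl; congr (_ - _); rewrite (AL (delta_mx ord0 i)).
  by rewrite /= E (le_lt_trans (KP _)).
have nU : \forall x \near x0, U x by apply: open_nbhs_nbhs.
apply: filterS (filterI nU near_i) => x [Ux dx]; split=> // v.
have -> : v - 'D_v f x *m L = \sum_i v ord0 i *: d i x.
  rewrite derive_sum_delta; last exact: fdiff.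
  rewrite [X in X - _](row_sum_delta v) mulmx_suml -sumrB.
  by apply: eq_bigr => i _; rewrite /d scalerBr scalemxAl.
apply: le_trans (ler_norm_sum _ _ _) _.
apply: (@le_trans _ _ (\sum_(i < n) `|v| * (2 * n.+1%:R)^-1)).
  apply: ler_sum => i _; rewrite normrZ; apply: ler_pM => //; first exact: coord_le_norm.
  exact: ltW.
rewrite sumr_const card_ord -[leLHS]mulr_natl mulrCA mulrC; apply: ler_wpM2r => //.
rewrite ler_pdivrMr ?mulr_gt0 // mulrA mulVf // mul1r ler_nat; exact: leqnSn.
Qed.

(** Composed with [L], [f] is a perturbation of the identity with Lipschitz constant 1/2 on a closed
    ball [K], hence injective there with a Lipschitz inverse. Surjectivity comes from minimising |(f
    x - y) L|^2 on [K]: the minimum is interior, and a critical point must be a zero. *)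
Lemma inverse_function : exists (r : R) (e : 'rV[R]_n -> 'rV[R]_n),
  [/\ 0 < r, e (f x0) = x0,
      forall y, ball (f x0) r y -> [/\ U (e y), f (e y) = y, differentiable e y,
        forall v, 'D_('D_v e y) f (e y) = v
      & forall v, {for y, continuous (fun z => 'D_v e z)}]
    & \forall x \near x0, ball (f x0) r (f x) /\ e (f x) = x].
Proof.
have [rho0 /= rho00 rhoP] := (nbhs_ballP _ _).1 near_half.
pose rho := rho0 / 2.
have rho_gt0 : 0 < rho by rewrite divr_gt0.
pose K := [set x : 'rV[R]_n | `|x - x0| <= rho].
have KP x : K x -> U x /\ forall v, `|v - 'D_v f x *m L| <= 2^-1 * `|v|.
  move=> Kx; apply: rhoP; rewrite -ball_normE /= distrC (le_lt_trans Kx) //.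
  by rewrite /rho ltr_pdivrMr // ltr_pMr // ltr1n.
have lip x x' : K x -> K x' -> `|(x - x') - (f x - f x') *m L| <= 2^-1 * `|x - x'|.
  move=> Kx Kx'; apply: norm_le_coord => [|j]; first by rewrite mulr_ge0.
  set d := x - x'.
  have Kt (t : R) : 0 <= t <= 1 -> K (x' + t *: d).
    move=> /andP[t0 t1]; rewrite /K /=.
    rewrite (_ : _ - x0 = t *: (x - x0) + (1 - t) *: (x' - x0)); last first.
      by apply/rowP => i; rewrite !mxE; ring.
    apply: le_trans (ler_normD _ _) _; rewrite !normrZ !ger0_norm ?subr_ge0 //.
    apply: (@le_trans _ _ (t * rho + (1 - t) * rho)).
      by apply: lerD; apply: ler_wpM2l => //; rewrite subr_ge0.
    by rewrite -mulrDl addrC subrK mul1r.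
  pose h (t : R) := ((x' + t *: d) - f (x' + t *: d) *m L) ord0 j.
  pose dh (t : R) := (d - 'D_d f (x' + t *: d) *m L) ord0 j.
  have hD (t : R) : 0 <= t <= 1 -> is_derive t (1 : R) h (dh t).
    move=> t01; apply: is_derive_coord; apply: is_deriveB.
      exact: is_derive_affine.
    have ft : differentiable f (x' + t *: d) by apply: fdiff; exact: (KP _ (Kt _ t01)).1.
    have fl := is_derive_line ft.
    apply: is_derive_row => i; rewrite mxE.
    rewrite (_ : (fun _ => _) = fun s => \sum_k f (x' + s *: d) ord0 k * L k i); last first.
      by rewrite funeqE => s; rewrite mxE.
    apply: is_derive_sumf => k.
    have := is_deriveMf (is_derive_coord k fl) (@is_derive_cst _ _ _ (L k i : R) t (1 : R)).
    by rewrite mulr0 addr0.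
  have [t] : exists2 t, t \in `[0, 1]%R & h 1 - h 0 = dh t * (1 - 0).
    apply: MVT_segment => //.
      by move=> t; rewrite in_itv /= => /andP[t0 t1]; apply: hD; rewrite !ltW.
    apply: derivable_within_continuous => t; rewrite in_itv /= => t01.
    by have [] := hD t t01.
  rewrite in_itv /= => t01; rewrite subr0 mulr1 => hE.
  have -> : (d - (f x - f x') *m L) ord0 j = dh t.
    rewrite -hE /h scale1r scale0r addr0 /d (addrC x') subrK mulmxBl !mxE; ring.
  apply: le_trans (coord_le_norm _ _) _; exact: (KP _ (Kt _ t01)).2.
have low x x' : K x -> K x' -> `|x - x'| <= 2 * `|(f x - f x') *m L|.
  move=> Kx Kx'; have H := lip _ _ Kx Kx'.
  have : `|x - x'| <= `|(x - x') - (f x - f x') *m L| + `|(f x - f x') *m L|.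
    by rewrite -[X in `|X| <= _](subrK ((f x - f x') *m L)) ler_normD.
  by lra.
have [KL KL0 KLP] := mulmx_bound L.
have Lunit : L \in unitmx by rewrite unitmx_inv.
have inj x x' : K x -> K x' -> f x = f x' -> x = x'.
  move=> Kx Kx' E; apply/eqP; rewrite -subr_eq0 -normr_eq0 eq_le normr_ge0 andbT.
  by apply: le_trans (low _ _ Kx Kx') _; rewrite E subrr mul0mx normr0 mulr0.
have half x v : K x -> `|v| <= 2 * `|'D_v f x *m L|.
  move=> Kx; have H := (KP x Kx).2 v.
  have : `|v| <= `|v - 'D_v f x *m L| + `|'D_v f x *m L|.
    by rewrite -[X in `|X| <= _](subrK ('D_v f x *m L)) ler_normD.
  by lra.
have fK x : K x -> differentiable f x by move=> Kx; apply: fdiff; exact: (KP x Kx).1.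
have Junit x : K x -> jacobian f x \in unitmx.
  move=> Kx; rewrite -row_free_unit; apply: inj_row_free => v vA.
  apply/eqP; rewrite -normr_eq0 eq_le normr_ge0 andbT.
  apply: le_trans (half _ v Kx) _.
  by rewrite deriveEjacobian ?vA ?mul0mx ?normr0 ?mulr0 //; exact: fK.
have Kc : compact K.
  apply: bounded_closed_compact.
    exists (`|x0| + rho); split; first exact: num_real.
    move=> M /ltW bM x Kx; apply: le_trans bM.
    by rewrite -[x](subrK x0) addrC (le_trans (ler_normD _ _)) // lerD2l.
  rewrite (_ : K = (fun x => `|x - x0|) @^-1` [set t | t <= rho]) //.
  apply: preimage_closed; last exact: closed_le.
  move=> x _; apply: (@continuous_comp _ _ _ (fun x => x - x0) (fun x => `|x|)).
    by apply: (@continuousB _ _ _ id (cst x0)); [exact: cvg_id|exact: cst_continuous].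
  exact: norm_continuous.
(* Makes [F x0] at most rho / 8 with a spare factor [n.+1], used to pass from the sup norm to
   [dot]. *)
pose r := rho / (8 * n.+1%:R * KL).
have N1 : 1 <= n.+1%:R :> R by rewrite ler1n.
have r0 : 0 < r by rewrite divr_gt0 // !mulr_gt0.
have rE : KL * r * n.+1%:R = rho / 8.
  by rewrite /r; field; rewrite gt_eqF //= -natr1 gt_eqF // natr1.
have Kx0 : K x0 by rewrite /K /= subrr normr0 ltW.
have surj y : ball (f x0) r y -> exists2 x, K x & f x = y.
  rewrite -ball_normE /= => yr.
  pose F x := (f x - y) *m L.
  have [||x /[!inE] Kx xmin] := @compact_EVT_min _ R (fun x => dot (F x) (F x)) K _ Kc.
  - by exists x0; rewrite /K /= subrr normr0 ltW.
  - apply: continuous_in_subspaceT => x /[!inE] Kx.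
    have Fc : {for x, continuous F}.
      apply: dist_lt_continuous => e e0.
      have := near_dist_lt (differentiable_continuous (fK x Kx)) (divr_gt0 e0 KL0).
      apply: filterS => z; rewrite ltr_pdivlMr // mulrC => H.
      by rewrite /F -mulmxBl opprB addrA subrK (le_lt_trans (KLP _)).
    exact: continuous_dot.
  have F0 : `|F x0| <= rho / 8 / n.+1%:R.
    rewrite -rE mulfK ?gt_eqF // (le_trans (KLP _)) //.
    by apply: ler_wpM2l; exact: ltW.
  have dF0 : dot (F x0) (F x0) < (rho / 4) ^+ 2.
    apply: le_lt_trans (dot_le_norm _) _.
    have F1 : n.+1%:R * `|F x0| <= rho / 8 by rewrite mulrC -ler_pdivlMr.
    have F2 : `|F x0| <= rho / 8.
      by apply: le_trans F1; rewrite ler_peMl.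
    apply: (@le_lt_trans _ _ ((rho / 8) * (rho / 8))).
      rewrite expr2 mulrA; apply: ler_pM => //; apply: le_trans F1.
      by apply: ler_wpM2r => //; rewrite ler_nat.
    have r2 : 0 < rho * rho by exact: mulr_gt0.
    by rewrite expr2; lra.
  (* On the boundary of [K], [low] forces |F x| >= rho / 4, so the value there exceeds the one at
     [x0]. *)
  have xint : `|x - x0| < rho.
    rewrite lt_neqAle Kx andbT; apply/eqP => xE.
    have := low _ _ Kx Kx0; rewrite xE => H.
    have F1 : `|(f x - f x0) *m L| <= `|F x| + `|F x0|.
      rewrite (_ : (f x - f x0) *m L = F x - F x0); first exact: ler_normB.
      by rewrite /F -mulmxBl opprB addrA subrK.
    have F2 : `|F x0| <= rho / 8.
      by apply: le_trans F0 _; rewrite ler_pdivrMr // ler_peMr // divr_ge0 // ltW.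
    have F3 : rho / 4 <= `|F x| by lra.
    have : (rho / 4) ^+ 2 <= dot (F x) (F x).
      have : `|F x| <= Num.sqrt (dot (F x) (F x)).
        by apply: norm_le_dot; rewrite ?sqrtr_ge0 // sqr_sqrtr // dot_ge0.
      move=> /(le_trans F3) H2; rewrite -[X in _ <= X](sqr_sqrtr (dot_ge0 _)).
      by rewrite ler_pXn2r ?nnegrE ?sqrtr_ge0 // divr_ge0 // ltW.
    have := xmin x0; rewrite inE => /(_ Kx0) Hm; move=> /le_trans /(_ Hm).
    by rewrite leNgt dF0.
  have Knear : \forall z \near x, K z.
    apply/nbhs_ballP; exists (rho - `|x - x0|); first by rewrite /= subr_gt0.
    move=> z; rewrite -ball_normE /= ltrBrDr => H; apply: ltW; apply: le_lt_trans H.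
    rewrite [X in X <= _](_ : _ = `|(x - x0) - (x - z)|).
      by rewrite [leRHS]addrC ler_normB.
    by congr `|_|; apply/rowP => i; rewrite !mxE; ring.
  have crit v : dot ('D_v f x *m L) (F x) = 0.
    pose D v := dot ('D_v f x *m L) (F x) + dot (F x) ('D_v f x *m L).
    have FD u : is_derive (0 : R) 1 (fun t : R => dot (F (x + t *: u)) (F (x + t *: u))) (D u).
      have fx0 : differentiable f (x + (0 : R) *: u) by rewrite scale0r addr0; exact: fK.
      have fl := is_deriveB (is_derive_line fx0) (@is_derive_cst _ _ _ y (0 : R) (1 : R)).
      have Fl : is_derive (0 : R) 1 (fun t : R => F (x + t *: u)) ('D_u f x *m L).
        apply: is_derive_row => i; rewrite mxE.
        rewrite (_ : (fun _ => _) = fun s => \sum_k (f (x + s *: u) - y) ord0 k * L k i); last first.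
          by rewrite funeqE => s; rewrite mxE.
        apply: is_derive_sumf => k.
        have := is_deriveMf (is_derive_coord k fl) (@is_derive_cst _ _ _ (L k i : R) (0 : R) (1 : R)).
        by rewrite mulr0 addr0 scale0r addr0 subr0.
      by have := is_derive_dot Fl Fl; rewrite scale0r addr0.
    have Dge u : 0 <= D u.
      apply: (derive_ge_right (FD u)).
      have [e /= e0 eP] := (nbhs_ballP _ _).1 (near_line u Knear).
      exists e => // t /andP[t0 te]; rewrite mul0r addr0 scale0r addr0.
      apply: xmin; rewrite inE; apply: eP.
      by rewrite -ball_normE /= sub0r normrN gtr0_norm.
    have DN : D (- v) = - D v.
      by rewrite /D !(deriveE _ (fK x Kx)) linearN mulNmx dotNl dotNr opprD.
    have : D v = 0 by apply/eqP; rewrite eq_le Dge -oppr_ge0 -DN Dge.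
    by rewrite /D (dotC (F x)) => /eqP; rewrite -mulr2n mulrn_eq0 /= => /eqP.
  (* The direction that the differential of [f] at [x], followed by [L], maps to [F x] itself. *)
  exists x => //; have := crit (F x *m A *m invmx (jacobian f x)).
  rewrite deriveEjacobian ?mulmxKV ?Junit //; last exact: fK.
  rewrite -/(F x) => /eqP; rewrite dot_eq0 => /eqP F00.
  by apply/eqP; rewrite -subr_eq0; apply/eqP; rewrite -[f x - y](mulmxK Lunit) -/(F x) F00 mul0mx.
pose e y := xget x0 [set x | K x /\ f x = y].
have eP y : ball (f x0) r y -> K (e y) /\ f (e y) = y.
  move=> /surj [x Kx fxy]; rewrite /e; case: xgetP => [z _ [] //|].
  by move=> /(_ x) H; exfalso; apply: H.
have eK x : K x -> ball (f x0) r (f x) -> e (f x) = x.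
  by move=> Kx /eP[Ke fe]; exact: inj.
have elip y z : ball (f x0) r y -> ball (f x0) r z -> `|e y - e z| <= 2 * KL * `|y - z|.
  move=> /eP[Ky fy] /eP[Kz fz]; apply: le_trans (low _ _ Ky Kz) _.
  by rewrite fy fz -mulrA ler_pM2l.
have bo y : ball (f x0) r y -> \forall z \near y, ball (f x0) r z.
  rewrite -ball_normE /= => yr; apply/nbhs_ballP; exists (r - `|f x0 - y|) => /=.
    by rewrite subr_gt0.
  move=> z; rewrite -ball_normE /= ltrBrDr => H; apply: le_lt_trans H.
  by rewrite [leRHS]addrC; exact: ler_distD.
have econt y : ball (f x0) r y -> {for y, continuous e}.
  move=> yb; apply: dist_lt_continuous => eps eps0.
  have d0 : 0 < eps / (2 * KL) by rewrite divr_gt0 // mulr_gt0.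
  have : \forall z \near y, ball y (eps / (2 * KL)) z by exact: nbhsx_ballx.
  move=> H; apply: filterS (filterI (bo y yb) H) => z [zb].
  rewrite -ball_normE /= ltr_pdivlMr ?mulr_gt0 // mulrC => yz.
  exact: le_lt_trans (elip _ _ yb zb) yz.
have ediff y : ball (f x0) r y -> differentiable e y /\
    forall v, 'D_v e y = v *m invmx (jacobian f (e y)).
  move=> yb; have [Ky fy] := eP _ yb.
  set T := invmx _; apply: near_diff => eps eps0.
  have [KT KT0 KTP] := mulmx_bound T.
  have eps'0 : 0 < eps / (2 * KL * KT) by rewrite divr_gt0 // !mulr_gt0.
  have H1 : \forall z \near y, `|f (e z) - f (e y) - 'D_(e z - e y) f (e y)|
       <= eps / (2 * KL * KT) * `|e z - e y|.
    exact: (econt y yb _ (diff_near (fK _ Ky) eps'0)).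
  apply: filterS (filterI (bo y yb) H1) => z [zb].
  have [Kz fz] := eP _ zb; rewrite fz fy => H2.
  have -> : e z - e y - (z - y) *m T = - ((z - y - 'D_(e z - e y) f (e y)) *m T).
    rewrite deriveEjacobian; last exact: fK.
    by rewrite [in RHS]mulmxBl mulmxK ?Junit // opprB.
  rewrite normrN; apply: le_trans (KTP _) _.
  apply: (@le_trans _ _ (KT * (eps / (2 * KL * KT) * (2 * KL * `|z - y|)))).
    apply: ler_wpM2l; first exact: ltW.
    apply: le_trans H2 _; apply: ler_wpM2l; first exact: ltW.
    exact: elip.
  rewrite le_eqVlt; apply/orP; left; apply/eqP; field.
  by rewrite !gt_eqF.
exists r, e; split=> //.
- by apply: eK => //; exact: ballxx.
- move=> y yb; have [Ky fy] := eP _ yb; have [ed eD] := ediff _ yb.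
  have DD z v : ball (f x0) r z -> 'D_('D_v e z) f (e z) = v.
    move=> zb; have [Kz fz] := eP _ zb; have [_ ->] := ediff _ zb.
    by rewrite deriveEjacobian ?mulmxKV ?Junit //; exact: fK.
  split=> //; [exact: (KP _ Ky).1|by move=> v; exact: DD|].
  (* The differential of [f] at [e z] maps ['D_v e z - w] to [v - 'D_w f (e z)], which tends to 0 as
     [z] tends to [y]; [half] converts this into the continuity sought. *)
  move=> v; set w := 'D_v e y.
  apply: dist_lt_continuous => eps eps0.
  have cc : {for y, continuous (fun z => 'D_w f (e z))}.
    apply: (@continuous_comp _ _ _ e (fun x => 'D_w f x)); first exact: econt.
    by apply: fC1; exact: (KP _ Ky).1.
  have d0 : 0 < eps / (2 * KL) by rewrite divr_gt0 // mulr_gt0.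
  apply: filterS (filterI (bo y yb) (near_dist_lt cc d0)) => z [zb].
  rewrite ltr_pdivlMr ?mulr_gt0 // => H; have [Kz fz] := eP _ zb.
  rewrite distrC; apply: le_lt_trans (half _ ('D_v e z - w) Kz) _.
  apply: le_lt_trans H; rewrite [leRHS]mulrC -mulrA ler_pM2l //.
  apply: le_trans (KLP _) _; apply: ler_wpM2l; first exact: ltW.
  rewrite deriveE; last exact: fK.
  by rewrite linearB /= -!deriveE ?(DD z v zb) ?(DD y v yb) //; exact: fK.
have f0c : {for x0, continuous f} by exact: (differentiable_continuous (fK _ Kx0)).
have nb : \forall x \near x0, ball (f x0) r (f x).
  exact: (f0c _ (nbhsx_ballx (f x0) r r0)).
have nK : \forall x \near x0, K x.
  apply/nbhs_ballP; exists rho => //= x; rewrite -ball_normE /= distrC => H; exact: ltW.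
by apply: filterS (filterI nb nK) => x [xb Kx]; split=> //; exact: eK.
Qed.

End InverseFunction.

(** * Null frames of Minkowski space *)

Section Lorentz.
Context {R : realType} {n : nat}.
Implicit Types (X Y Z : 'rV[R]_n.+2).

Definition spatial X : 'rV[R]_n.+1 := \row_i X ord0 (lift ord0 i).

Lemma lorentzE X Y : lorentz X Y = - (X ord0 ord0 * Y ord0 ord0) + dot (spatial X) (spatial Y).
Proof. by rewrite /lorentz /dot; congr (_ + _); apply: eq_bigr => i _; rewrite !mxE. Qed.

Lemma spatialD X Y : spatial (X + Y) = spatial X + spatial Y.
Proof. by apply/rowP => i; rewrite !mxE. Qed.

Lemma spatialZ k X : spatial (k *: X) = k *: spatial X.
Proof. by apply/rowP => i; rewrite !mxE. Qed.

Lemma lorentzC X Y : lorentz X Y = lorentz Y X.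
Proof. by rewrite !lorentzE mulrC dotC. Qed.

Lemma lorentzDl X Y Z : lorentz (X + Y) Z = lorentz X Z + lorentz Y Z.
Proof. by rewrite !lorentzE spatialD dotDl mxE; ring. Qed.

Lemma lorentzDr X Y Z : lorentz Z (X + Y) = lorentz Z X + lorentz Z Y.
Proof. by rewrite lorentzC lorentzDl !(lorentzC Z). Qed.

Lemma lorentzZl k X Z : lorentz (k *: X) Z = k * lorentz X Z.
Proof. by rewrite !lorentzE spatialZ dotZl mxE; ring. Qed.

Lemma lorentzZr k X Z : lorentz Z (k *: X) = k * lorentz Z X.
Proof. by rewrite lorentzC lorentzZl lorentzC. Qed.

Lemma lorentz0l Z : lorentz 0 Z = 0.
Proof. by rewrite -(scale0r 0) lorentzZl mul0r. Qed.

Lemma lorentz_suml I (r : seq I) (F : I -> 'rV[R]_n.+2) Z :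
  lorentz (\sum_(i <- r) F i) Z = \sum_(i <- r) lorentz (F i) Z.
Proof. exact: (big_morph (fun X => lorentz X Z) (fun X Y => lorentzDl X Y Z) (lorentz0l Z)). Qed.

Lemma lorentz_sumr I (r : seq I) (F : I -> 'rV[R]_n.+2) Z :
  lorentz Z (\sum_(i <- r) F i) = \sum_(i <- r) lorentz Z (F i).
Proof. by rewrite lorentzC lorentz_suml; apply: eq_bigr => i _; rewrite lorentzC. Qed.

Lemma is_derive_lorentz (V : normedModType R) (f g : V -> 'rV[R]_n.+2) x v
    (df dg : 'rV[R]_n.+2) :
  is_derive x v f df -> is_derive x v g dg ->
  is_derive x v (fun y => lorentz (f y) (g y)) (lorentz df (g x) + lorentz (f x) dg).
Proof.
move=> Df Dg.
have Dsp (h : V -> 'rV[R]_n.+2) (dh : 'rV[R]_n.+2) :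
    is_derive x v h dh -> is_derive x v (fun y => spatial (h y)) (spatial dh).
  move=> Dh; apply: is_derive_row => i; rewrite mxE.
  rewrite (_ : (fun _ => _) = fun y => h y ord0 (lift ord0 i)).
    exact: is_derive_coord.
  by rewrite funeqE => y; rewrite mxE.
have D1 := is_deriveMf (is_derive_coord ord0 Df) (is_derive_coord ord0 Dg).
have D2 := is_derive_dot (Dsp _ _ Df) (Dsp _ _ Dg).
have D := is_deriveB D2 D1.
rewrite (_ : (fun _ => _) = (fun y => dot (spatial (f y)) (spatial (g y))) -
   (fun y => f y ord0 ord0 * g y ord0 ord0)); last first.
  by rewrite funeqE => y; rewrite lorentzE addrC.
by apply: is_derive_eq D _; rewrite !lorentzE; ring.
Qed.

Lemma lorentz_nondeg X : (forall Y, lorentz X Y = 0) -> X = 0.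
Proof.
move=> X0; pose Y : 'rV[R]_n.+2 := \row_i (if i == ord0 then - X ord0 ord0 else X ord0 i).
have : lorentz X Y = X ord0 ord0 * X ord0 ord0 + dot (spatial X) (spatial X).
  rewrite lorentzE !mxE /= mulrN opprK; congr (_ + dot _ _).
  by apply/rowP => i; rewrite !mxE.
rewrite X0 => /esym/eqP; rewrite paddr_eq0 ?dot_ge0 -?expr2 ?sqr_ge0 //.
rewrite sqrf_eq0 dot_eq0 => /andP[/eqP x0 /eqP xs].
apply/rowP => i; rewrite mxE; case: (unliftP ord0 i) => [j ->|->]; last exact: x0.
by have := congr1 (fun Z : 'rV[R]_n.+1 => Z ord0 j) xs; rewrite !mxE.
Qed.

(* Linear coordinates adapted to the null directions dual to [a] and [b]:
   [dot X a], [dot X b] and [X *m P]. *)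
Record null_frame (a b : 'rV[R]_n.+2) (P : 'M[R]_(n.+2, n)) : Prop := NullFrame {
  nf_lorentz : forall X Y, lorentz X Y =
    - (dot X a * dot Y b) - dot X b * dot Y a + dot (X *m P) (Y *m P);
  nf_ge0 : forall X, lorentz X X <= 0 -> 0 <= X ord0 ord0 ->
    0 <= dot X a /\ 0 <= dot X b
}.

Lemma null_frame_sym a b P : null_frame a b P -> null_frame b a P.
Proof.
move=> [fl fp]; split=> [X Y|X X0 X1]; first by rewrite fl; ring.
by have [] := fp X X0 X1.
Qed.

Lemma null_frame_inj a b P X Y : null_frame a b P ->
  dot X a = dot Y a -> dot X b = dot Y b -> X *m P = Y *m P -> X = Y.
Proof.
move=> fr Ea Eb Ep; apply/eqP; rewrite -subr_eq0; apply/eqP.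
apply: lorentz_nondeg => Z; rewrite (nf_lorentz fr) !dotBl mulmxBl Ea Eb Ep !subrr.
by rewrite !mul0r dot0l; ring.
Qed.

(** Cauchy-Schwarz for the spatial parts. It makes both null vectors phi + eta and phi - eta future
    directed. *)
Lemma future_time (phi eta : 'rV[R]_n.+2) : lorentz phi phi = -1 -> 0 < phi ord0 ord0 ->
  lorentz eta eta = 1 -> lorentz eta phi = 0 ->
  `|eta ord0 ord0| < phi ord0 ord0.
Proof.
move=> pp p0 ee ep.
suff : `|eta ord0 ord0| ^+ 2 < phi ord0 ord0 ^+ 2.
  by rewrite ltr_pXn2r // ?nnegrE //; exact: ltW.
rewrite real_normK ?num_real //.
move: pp ee ep; rewrite !lorentzE => pp ee ep.
have cs := CauchySchwarz_dot (spatial eta) (spatial phi).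
set x := phi ord0 ord0 in pp ep p0 *; set z := eta ord0 ord0 in ee ep *.
have E1 : dot (spatial phi) (spatial phi) = x ^+ 2 - 1 by rewrite expr2; lra.
have E2 : dot (spatial eta) (spatial eta) = z ^+ 2 + 1 by rewrite expr2; lra.
have E3 : dot (spatial eta) (spatial phi) = z * x by lra.
move: cs; rewrite E1 E2 E3 => cs.
have : (z * x) ^+ 2 = z ^+ 2 * x ^+ 2 by ring.
have : (z ^+ 2 + 1) * (x ^+ 2 - 1) = z ^+ 2 * x ^+ 2 - z ^+ 2 + x ^+ 2 - 1 by ring.
move=> e1 e2; rewrite e1 e2 in cs; lra.
Qed.

(** The reflection exchanging [x] and the first basis vector, or the identity when they coincide. *)
Lemma householder (x : 'rV[R]_n.+1) : dot x x = 1 ->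
  exists Q : 'M[R]_n.+1, Q *m Q^T = 1%:M /\ forall j, Q j ord0 = x ord0 j.
Proof.
move=> x1; pose e0 : 'rV[R]_n.+1 := delta_mx ord0 ord0.
pose v := x - e0.
have [v0|v0] := eqVneq v 0.
  exists 1%:M; rewrite trmx1 mulmx1; split=> // j.
  by move/eqP: v0; rewrite subr_eq0 => /eqP ->; rewrite !mxE eqxx eq_sym.
have vv : dot v v != 0 by rewrite dot_eq0.
pose c := 2 / dot v v.
have vvE : v *m v^T = (dot v v)%:M.
  apply/matrixP => i j; rewrite !ord1 !mxE mulr1n; apply: eq_bigr => k _.
  by rewrite !mxE.
pose S : 'M[R]_n.+1 := c *: (v^T *m v).
have SS : S *m S = S + S.
  rewrite /S -scalemxAl -scalemxAr -mulmxA (mulmxA v) vvE mul_scalar_mx.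
  rewrite -scalemxAr !scalerA -scalerDl; congr (_ *: _).
  by rewrite /c; field.
have ST : S^T = S by rewrite /S linearZ /= trmx_mul trmxK.
pose Q : 'M[R]_n.+1 := 1%:M - S.
have QT : Q^T = Q by rewrite /Q linearB /= trmx1 ST.
exists Q; split.
  by rewrite QT /Q mulmxBl !mulmxBr !mul1mx !mulmx1 SS opprB addrK subrK.
move=> j; rewrite /Q /S !mxE big_ord1 !mxE eqxx /=.
have vvx : dot v v = 2 - 2 * x ord0 ord0.
  rewrite /v !dotE (dotC e0 x) x1 !dot_delta mxE !eqxx /=; ring.
have nz : 2 - 2 * x ord0 ord0 != 0 by rewrite -vvx.
by rewrite /c vvx; have [->|j0] := eqVneq j ord0; rewrite ?mulr1n ?mulr0n; field.
Qed.

End Lorentz.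

Section NullFrameAt.
Context {R : realType} {n : nat}.
Implicit Types (X Y : 'rV[R]_n.+2).

Lemma dot_spatial X Y : dot X Y = X ord0 ord0 * Y ord0 ord0 + dot (spatial X) (spatial Y).
Proof.
rewrite /dot big_ord_recl; congr (_ + _).
by apply: eq_bigr => i _; rewrite !mxE.
Qed.

Lemma dot_mulmx (u v : 'rV[R]_n.+1) (Q : 'M[R]_n.+1) : Q *m Q^T = 1%:M ->
  dot (u *m Q) (v *m Q) = dot u v.
Proof.
have dE w z : dot w z = (w *m z^T) ord0 ord0 :> R.
  by rewrite mxE; apply: eq_bigr => i _; rewrite mxE.
by move=> QQ; rewrite !dE trmx_mul -mulmxA (mulmxA Q) QQ mul1mx.
Qed.

(** [dot X a] and [dot X b] are minus the Lorentz products of [X] with (1, x) and (1, -x)/2. The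
    remaining coordinates are spatial ones orthogonal to [x], taken from an orthogonal matrix with
    first column [x]. *)
Lemma null_frame_at (x : 'rV[R]_n.+1) : dot x x = 1 -> exists a b P,
  [/\ null_frame a b P,
      forall X, dot X a = X ord0 ord0 - dot (spatial X) x,
      forall X, dot X b = (X ord0 ord0 + dot (spatial X) x) / 2
    & forall X, spatial X = X ord0 ord0 *: x -> X *m P = 0].
Proof.
move=> x1; have [Q [QQ Q0]] := householder x1.
pose vec (t : R) (u : 'rV[R]_n.+1) : 'rV[R]_n.+2 :=
  \row_i (if unlift ord0 i is Some j then u ord0 j else t).
have vec0 t u : vec t u ord0 ord0 = t by rewrite mxE unlift_none.
have vecS t u : spatial (vec t u) = u by apply/rowP => i; rewrite !mxE liftK.
pose P : 'M[R]_(n.+2, n) :=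
  \matrix_(i, k) (if unlift ord0 i is Some j then Q j (lift ord0 k) else 0).
have PE X k : (X *m P) ord0 k = (spatial X *m Q) ord0 (lift ord0 k).
  rewrite !mxE big_ord_recl mxE unlift_none mulr0 add0r.
  by apply: eq_bigr => i _; rewrite !mxE liftK.
have Q0E (u : 'rV[R]_n.+1) : (u *m Q) ord0 ord0 = dot u x.
  by rewrite mxE; apply: eq_bigr => i _; rewrite Q0.
have aE X : dot X (vec 1 (- x)) = X ord0 ord0 - dot (spatial X) x.
  by rewrite dot_spatial vec0 vecS mulr1 dotNr.
have bE X : dot X (vec 2^-1 (2^-1 *: x)) = (X ord0 ord0 + dot (spatial X) x) / 2.
  by rewrite dot_spatial vec0 vecS dotZr; ring.
exists (vec 1 (- x)), (vec 2^-1 (2^-1 *: x)), P; split=> // [|X sX].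
  split=> [X Y|X XX X0].
    rewrite lorentzE -(dot_mulmx (spatial X) (spatial Y) QQ) !aE !bE.
    rewrite [in LHS]/dot big_ord_recl !Q0E.
    rewrite [dot (X *m P) _](_ : _ = \sum_(i < n) (spatial X *m Q) ord0 (lift ord0 i) *
       (spatial Y *m Q) ord0 (lift ord0 i)); first by field.
    by apply: eq_bigr => i _; rewrite !PE.
  have : `|dot (spatial X) x| <= X ord0 ord0.
    have : `|dot (spatial X) x| ^+ 2 <= X ord0 ord0 ^+ 2.
      rewrite real_normK ?num_real //; apply: le_trans (CauchySchwarz_dot _ _) _.
      by rewrite x1 mulr1; move: XX; rewrite lorentzE expr2; lra.
    by rewrite ler_pXn2r // ?nnegrE.
  rewrite ler_norml aE bE => /andP[h1 h2]; split; first by rewrite subr_ge0.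
  by apply: divr_ge0 => //; lra.
apply/rowP => k; rewrite PE sX -scalemxAl !mxE.
rewrite [X in _ * X](_ : _ = 0) ?mulr0 //.
have /matrixP/(_ ord0 (lift ord0 k)) : Q^T *m Q = 1%:M by exact: mulmx1C.
rewrite !mxE /= => H; rewrite -[RHS]H; apply: eq_bigr => j _.
by rewrite !mxE Q0.
Qed.

End NullFrameAt.

(** * Horospherical coordinates of a hypersurface *)

Section DifferentiableRow.
Context {R : realType} {V : normedModType R} {n m : nat}.
Implicit Types (f : V -> 'rV[R]_n) (x : V).

Lemma differentiable_coordf f x i :
  differentiable f x -> differentiable (fun y => f y ord0 i : R) x.
Proof.
move=> fx; apply: (@differentiable_comp _ _ _ _ f (fun N : 'rV[R]_n => N ord0 i)) => //.
exact: differentiable_coord.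
Qed.

Lemma differentiable_sumf (W : normedModType R) k (h : 'I_k -> V -> W) x :
  (forall i, differentiable (h i) x) -> differentiable (fun y => \sum_i h i y) x.
Proof.
move=> hx; rewrite (_ : (fun _ => _) = \sum_i h i); first exact: differentiable_sum.
by rewrite funeqE => y; rewrite fct_sumE.
Qed.

Lemma differentiable_row f x :
  (forall i, differentiable (fun y => f y ord0 i : R) x) -> differentiable f x.
Proof.
move=> fx.
rewrite (_ : f = fun y => \sum_i f y ord0 i *: delta_mx ord0 i); last first.
  by rewrite funeqE => y; rewrite -row_sum_delta.
by apply: differentiable_sumf => i; exact: differentiableZl.
Qed.

Lemma differentiable_dotl f (c : 'rV[R]_n) x :
  differentiable f x -> differentiable (fun y => dot (f y) c) x.
Proof.
move=> fx; apply: differentiable_sumf => i.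
apply: (@differentiableM _ _ (fun y => f y ord0 i) (cst (c ord0 i))).
  exact: differentiable_coordf.
exact: differentiable_cst.
Qed.

Lemma differentiable_mulmx f (P : 'M[R]_(n, m)) x :
  differentiable f x -> differentiable (fun y => f y *m P) x.
Proof.
move=> fx; rewrite (_ : (fun y => f y *m P) = fun y => \sum_i f y ord0 i *: row i P).
  by apply: differentiable_sumf => i; apply: differentiableZl; exact: differentiable_coordf.
by rewrite funeqE => y; rewrite mulmx_sum_row.
Qed.

Lemma differentiable_scale (k : V -> R) f x :
  differentiable k x -> differentiable f x -> differentiable (fun y => k y *: f y) x.
Proof.
move=> kx fx; apply: differentiable_row => i.
rewrite (_ : (fun _ => _) = fun y => k y * f y ord0 i); last first.
  by rewrite funeqE => y; rewrite mxE.
by apply: differentiableM => //; exact: differentiable_coordf.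
Qed.

Lemma is_derive_mulmx f (P : 'M[R]_(n, m)) x v (df : 'rV[R]_n) :
  is_derive x v f df -> is_derive x v (fun y => f y *m P) (df *m P).
Proof.
move=> Df; apply: is_derive_row => j; rewrite mxE.
rewrite (_ : (fun _ => _) = fun y => \sum_k f y ord0 k * P k j); last first.
  by rewrite funeqE => s; rewrite mxE.
apply: is_derive_sumf => k.
have := is_deriveMf (is_derive_coord k Df) (@is_derive_cst _ _ _ (P k j : R) x v).
by rewrite mulr0 addr0.
Qed.

End DifferentiableRow.

Section ContinuousMulmx.
Context {R : realType} {n m : nat}.

Lemma continuous_mulmx (T : topologicalType) (h : T -> 'rV[R]_n) (P : 'M[R]_(n, m)) (x : T) :
  {for x, continuous h} -> {for x, continuous (fun y => h y *m P)}.
Proof.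
move=> hx; apply: (@continuous_comp _ _ _ h (fun u : 'rV[R]_n => u *m P)).
  exact: hx.
apply: differentiable_continuous.
have -> : (fun u : 'rV[R]_n => u *m P) = fun u : 'rV[R]_n => \sum_i u ord0 i *: row i P.
  by rewrite funeqE => y; rewrite mulmx_sum_row.
by apply: differentiable_sumf => i; apply: differentiableZl; exact: differentiable_coord.
Qed.

Lemma near_eq_continuous (T : topologicalType) (W : topologicalType) (h k : T -> W) (x : T) :
  (\forall y \near x, h y = k y) -> {for x, continuous k} -> {for x, continuous h}.
Proof.
move=> hk kx A; rewrite (nbhs_singleton hk) => /kx kA.
by apply: filterS (filterI hk kA) => y [/= ->].
Qed.

End ContinuousMulmx.

Section Hypersurface.
Context {R : realType} {n : nat} {M : smoothManifold R n}.
Implicit Types (phi eta : M -> 'rV[R]_n.+2) (p q : M) (a : chart R n M) (z v : 'rV[R]_n).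

Definition cim a := ccoord a @` cdom a.

Lemma cimP a p : cdom a p -> cim a (ccoord a p).
Proof. by move=> ap; exists p. Qed.

Lemma cinvK a z : cim a z -> cdom a (cinv a z) /\ ccoord a (cinv a z) = z.
Proof. by move=> [p ap <-]; rewrite ccoordK. Qed.

Lemma near_cim a z : cim a z -> \forall w \near z, cim a w.
Proof. by move=> az; apply: open_nbhs_nbhs; split=> //; exact: cim_open. Qed.

Lemma smooth_map_C1 (W : normedModType R) (f : M -> W) a z : smooth_map f -> atlas a ->
  cim a z -> differentiable (f \o cinv a) z /\
  forall v, {for z, continuous (fun w => 'D_v (f \o cinv a) w)}.
Proof.
move=> fs aa az; have [fd fc] := fs a aa 1%N.
by split=> [|v]; [exact: fd|exact: (fc v z az)].
Qed.

(* [pc_ge] and [pc_le] make the induced and the horospherical metrics equivalent. *)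
Record pinched phi eta (kappa : M -> 'I_n -> R) (a1 a2 : R) : Prop := Pinched {
  pc_imm : immersed_hypersurface phi;
  pc_normal : unit_normal phi eta;
  pc_kappa : principal_curvatures phi eta kappa;
  pc_gt0 : 0 < a1;
  pc_ge : forall p i, a1 <= 1 - kappa p i;
  pc_le : forall p i, 1 - kappa p i <= a2
}.

Variables (phi eta : M -> 'rV[R]_n.+2) (kappa : M -> 'I_n -> R) (a1 a2 : R).
Hypothesis H : pinched phi eta kappa a1 a2.

Definition psi p := phi p + eta p.

Let phi_smooth : smooth_map phi. Proof. by have [] := pc_imm H. Qed.
Let eta_smooth : smooth_map eta. Proof. by have [] := pc_normal H. Qed.

Lemma lorentz_phi_phi p : lorentz (phi p) (phi p) = -1.
Proof. by have [_ /(_ p) [] ] := pc_imm H. Qed.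

Lemma phi0_gt0 p : 0 < phi p ord0 ord0.
Proof. by have [_ /(_ p) [] ] := pc_imm H. Qed.

Lemma lorentz_eta_eta p : lorentz (eta p) (eta p) = 1.
Proof. by have [] := pc_normal H. Qed.

Lemma lorentz_eta_phi p : lorentz (eta p) (phi p) = 0.
Proof. by have [] := pc_normal H. Qed.

Lemma lorentz_psi_psi p : lorentz (psi p) (psi p) = 0.
Proof.
rewrite /psi lorentzDl !lorentzDr lorentz_phi_phi lorentz_eta_eta.
by rewrite (lorentzC (phi p) (eta p)) lorentz_eta_phi; ring.
Qed.

Lemma lorentz_phi_psi p : lorentz (phi p) (psi p) = -1.
Proof.
rewrite /psi lorentzDr lorentz_phi_phi (lorentzC (phi p) (eta p)) lorentz_eta_phi.
by rewrite addr0.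
Qed.

Lemma psi0_gt0 p : 0 < psi p ord0 ord0.
Proof.
have := future_time (lorentz_phi_phi p) (phi0_gt0 p) (lorentz_eta_eta p) (lorentz_eta_phi p).
by rewrite ltr_norml mxE => /andP[]; lra.
Qed.

Lemma psi0_lt p : psi p ord0 ord0 < 2 * phi p ord0 ord0.
Proof.
have := future_time (lorentz_phi_phi p) (phi0_gt0 p) (lorentz_eta_eta p) (lorentz_eta_phi p).
by rewrite ltr_norml mxE => /andP[]; lra.
Qed.

Section InChart.
Variables (a : chart R n M) (z : 'rV[R]_n).
Hypotheses (aa : atlas a) (az : cim a z).

Let Dphi v := 'D_v (phi \o cinv a) z.
Let Dpsi v := 'D_v (psi \o cinv a) z.

Lemma phi_chart_diff : differentiable (phi \o cinv a) z.
Proof. exact: (smooth_map_C1 phi_smooth aa az).1. Qed.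

Lemma psi_chart_diff : differentiable (psi \o cinv a) z.
Proof.
by apply: differentiableD; [exact: phi_chart_diff|exact: (smooth_map_C1 eta_smooth aa az).1].
Qed.

Lemma derive_psi v : Dpsi v = Dphi v + 'D_v (eta \o cinv a) z.
Proof.
apply: (@deriveD _ _ _ (phi \o cinv a) (eta \o cinv a)); apply: diff_derivable.
  exact: phi_chart_diff.
exact: (smooth_map_C1 eta_smooth aa az).1.
Qed.

Lemma psi_chart_C1 v : {for z, continuous (fun w => 'D_v (psi \o cinv a) w)}.
Proof.
apply: (@near_eq_continuous _ _ _ (fun w => 'D_v (phi \o cinv a) w + 'D_v (eta \o cinv a) w)).
  apply: filterS (near_cim az) => w aw.
  apply: (@deriveD _ _ _ (phi \o cinv a) (eta \o cinv a)); apply: diff_derivable.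
    exact: (smooth_map_C1 phi_smooth aa aw).1.
  exact: (smooth_map_C1 eta_smooth aa aw).1.
by apply: continuousD; [exact: (smooth_map_C1 phi_smooth aa az).2|
  exact: (smooth_map_C1 eta_smooth aa az).2].
Qed.

Lemma const_lorentz_derive (f g : M -> 'rV[R]_n.+2) (k : R) v :
  (forall p, lorentz (f p) (g p) = k) ->
  differentiable (f \o cinv a) z -> differentiable (g \o cinv a) z ->
  lorentz ('D_v (f \o cinv a) z) (g (cinv a z))
    + lorentz (f (cinv a z)) ('D_v (g \o cinv a) z) = 0.
Proof.
move=> fg fz gz.
have D := is_derive_lorentz (derivableP (diff_derivable (v := v) fz))
  (derivableP (diff_derivable (v := v) gz)).
rewrite -(@derive_val _ _ _ _ _ _ _ D).
rewrite (_ : (fun _ => _) = cst k); first exact: derive_cst.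
by rewrite funeqE => w; rewrite /= fg.
Qed.

Lemma lorentz_Dphi_psi v : lorentz (Dphi v) (psi (cinv a z)) = 0.
Proof.
have [za zz] := cinvK az.
rewrite /psi lorentzDr.
have := const_lorentz_derive v lorentz_phi_phi phi_chart_diff phi_chart_diff.
rewrite (lorentzC (phi _)) -mulr2n => /eqP; rewrite mulrn_eq0 /= => /eqP ->.
rewrite add0r lorentzC; have [_ _ _ /(_ (cinv a z) a)] := pc_normal H.
by move=> /(_ (conj aa za) v); rewrite /mdiff zz.
Qed.

Lemma lorentz_Dpsi_psi v : lorentz (Dpsi v) (psi (cinv a z)) = 0.
Proof.
have := const_lorentz_derive v lorentz_psi_psi psi_chart_diff psi_chart_diff.
rewrite (lorentzC (psi _)) -mulr2n => /eqP; rewrite mulrn_eq0 /= => /eqP ->.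
by [].
Qed.

(** Since d eta = -kappa d phi in principal directions, d psi = (1 - kappa) d phi: this is where the
    a_k enter. Orthonormality of the images makes the directions a basis. *)
Lemma principal_frame : exists e : 'I_n -> 'rV[R]_n,
  [/\ forall i j, lorentz (Dphi (e i)) (Dphi (e j)) = (i == j)%:R,
      forall i, Dpsi (e i) = (1 - kappa (cinv a z) i) *: Dphi (e i)
    & forall v, exists c : 'I_n -> R, v = \sum_i c i *: e i].
Proof.
have [za zz] := cinvK az.
have [e [e1 e2]] := pc_kappa H (conj aa za).
move: e1 e2; rewrite /mdiff zz => e1 e2; exists e; split=> //.
  by move=> i; rewrite derive_psi e2 scalerBl scale1r scaleNr.
pose E : 'M[R]_n := \matrix_i e i.
have Eu : E \in unitmx.
  rewrite -row_free_unit; apply: inj_row_free => u uE.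
  have uE0 : \sum_i u ord0 i *: e i = 0 :> 'rV[R]_n.
    by rewrite -[RHS]uE mulmx_sum_row; apply: eq_bigr => i _; rewrite rowK.
  have : Dphi (\sum_i u ord0 i *: e i) = \sum_i u ord0 i *: Dphi (e i).
    rewrite /Dphi deriveE ?linear_sum; last exact: phi_chart_diff.
    by apply: eq_bigr => i _; rewrite linearZ /= deriveE //; exact: phi_chart_diff.
  rewrite uE0 /Dphi deriveE ?linear0; last exact: phi_chart_diff.
  move=> S0; apply/rowP => j; rewrite mxE.
  have := congr1 (fun X => lorentz X (Dphi (e j))) S0.
  rewrite /= lorentz0l lorentz_suml (bigD1 j isT) /= big1; last first.
    by move=> i ij; rewrite lorentzZl (e1 i j) (negbTE ij) mulr0.
  by rewrite lorentzZl (e1 j j) eqxx mulr1 addr0.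
move=> v; exists (fun i => (v *m invmx E) ord0 i).
rewrite -[LHS](mulmxKV Eu) mulmx_sum_row; apply: eq_bigr => i _; by rewrite rowK.
Qed.

(** In a principal frame both metrics are diagonal, with entries 1 and a_k^2. *)
Lemma metric_compare v :
  [/\ 0 <= lorentz (Dphi v) (Dphi v),
      a1 ^+ 2 * lorentz (Dphi v) (Dphi v) <= lorentz (Dpsi v) (Dpsi v),
      lorentz (Dpsi v) (Dpsi v) <= a2 ^+ 2 * lorentz (Dphi v) (Dphi v)
    & lorentz (Dphi v) (Dphi v) = 0 -> v = 0].
Proof.
have [e [e1 e2 /(_ v) [c vE]]] := principal_frame.
have D (f : M -> 'rV[R]_n.+2) : differentiable (f \o cinv a) z ->
    'D_v (f \o cinv a) z = \sum_i c i *: 'D_(e i) (f \o cinv a) z.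
  move=> fz; rewrite deriveE // vE linear_sum; apply: eq_bigr => i _.
  by rewrite linearZ /= deriveE.
have S (k : 'I_n -> R) : lorentz (\sum_i k i *: Dphi (e i)) (\sum_i k i *: Dphi (e i))
    = \sum_i k i ^+ 2.
  rewrite lorentz_suml; apply: eq_bigr => i _; rewrite lorentz_sumr (bigD1 i isT) /= big1.
    by rewrite lorentzZl lorentzZr (e1 i i) eqxx mulr1 -expr2 addr0.
  by move=> j ji; rewrite lorentzZl lorentzZr (e1 i j) eq_sym (negbTE ji) !mulr0.
have E1 : lorentz (Dphi v) (Dphi v) = \sum_i c i ^+ 2.
  by rewrite /Dphi D ?S //; exact: phi_chart_diff.
have E2 : lorentz (Dpsi v) (Dpsi v) = \sum_i (c i * (1 - kappa (cinv a z) i)) ^+ 2.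
  rewrite /Dpsi D; last exact: psi_chart_diff.
  have -> : \sum_i c i *: 'D_(e i) (psi \o cinv a) z =
      \sum_i (c i * (1 - kappa (cinv a z) i)) *: Dphi (e i).
    by apply: eq_bigr => i _; rewrite -scalerA; congr (_ *: _); exact: e2.
  exact: S.
have a10 := pc_gt0 H.
have k0 i : 0 <= 1 - kappa (cinv a z) i.
  by apply: le_trans (pc_ge H _ _); exact: ltW.
split.
- by rewrite E1; apply: sumr_ge0 => i _; exact: sqr_ge0.
- rewrite E1 E2 mulr_sumr; apply: ler_sum => i _; rewrite exprMn mulrC.
  apply: ler_wpM2l; first exact: sqr_ge0.
  by rewrite ler_pXn2r ?nnegrE ?k0 ?(pc_ge H) //; exact: ltW.
- rewrite E1 E2 mulr_sumr; apply: ler_sum => i _; rewrite exprMn mulrC.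
  apply: ler_wpM2r; first exact: sqr_ge0.
  rewrite ler_pXn2r ?nnegrE ?k0 ?(pc_le H) //.
  exact: le_trans (k0 i) (pc_le H _ _).
- rewrite E1 => /eqP; rewrite psumr_eq0 => [/allP c0|i _]; last exact: sqr_ge0.
  rewrite vE big1 // => i _; have := c0 i; rewrite mem_index_enum /= sqrf_eq0.
  by move=> /(_ isT) /eqP ->; rewrite scale0r.
Qed.

End InChart.

End Hypersurface.

Section HorosphericalCoordinates.
Context {R : realType} {n : nat} {M : smoothManifold R n}.
Implicit Types (p q : M) (a : chart R n M) (z v : 'rV[R]_n).
Variables (phi eta : M -> 'rV[R]_n.+2) (kappa : M -> 'I_n -> R) (a1 a2 : R).
Hypothesis H : pinched phi eta kappa a1 a2.
Variables (fa fb : 'rV[R]_n.+2) (P : 'M[R]_(n.+2, n)).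
Hypothesis fr : null_frame fa fb P.

Local Notation psi := (psi phi eta).

(* In the chart of the sphere at infinity given by the null frame, [gmap] is the
   horospherical Gauss map and [hscale ^ 2 * |dy|^2] the horospherical metric. *)
Definition hscale p : R := dot (psi p) fa.

Definition gmap p : 'rV[R]_n := (hscale p)^-1 *: (psi p *m P).

Lemma hscale_ge0 p : 0 <= hscale p.
Proof.
have L0 : lorentz (psi p) (psi p) <= 0 by rewrite (lorentz_psi_psi H).
by have [] := nf_ge0 fr L0 (ltW (psi0_gt0 H p)).
Qed.

Lemma psi_mulmx p : 0 < hscale p -> psi p *m P = hscale p *: gmap p.
Proof. by move=> s0; rewrite scalerA mulfV ?scale1r // gt_eqF. Qed.

Lemma psi_fb p : 0 < hscale p ->
  dot (psi p) fb = hscale p * dot (gmap p) (gmap p) / 2.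
Proof.
move=> s0; have := lorentz_psi_psi H p; rewrite (nf_lorentz fr) psi_mulmx //.
rewrite dotZl dotZr -/(hscale p) => E.
have : hscale p * (hscale p * dot (gmap p) (gmap p) - 2 * dot (psi p) fb) = 0.
  by rewrite -E; ring.
by move/eqP; rewrite mulf_eq0 gt_eqF //= subr_eq0 => /eqP ->; field.
Qed.

(** At such a pole [psi] points to the point of the sphere that the chart sends to infinity; its
    [fb] coordinate cannot vanish too because <phi, psi> = -1. Hence the chart with the null
    directions exchanged is regular there. *)
Lemma hscale_eq0 p : hscale p = 0 -> psi p *m P = 0 /\ 0 < dot (psi p) fb.
Proof.
move=> s0; have := lorentz_psi_psi H p; rewrite (nf_lorentz fr) -/(hscale p) s0.
rewrite mul0r mulr0 !oppr0 !add0r => /eqP; rewrite dot_eq0 => /eqP PP; split=> //.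
have L0 : lorentz (psi p) (psi p) <= 0 by rewrite (lorentz_psi_psi H).
have [_ b_ge0] := nf_ge0 fr L0 (ltW (psi0_gt0 H p)).
rewrite lt_def b_ge0 andbT; apply/eqP => b0.
have := lorentz_phi_psi H p; rewrite (nf_lorentz fr) -/(hscale p) s0 b0 PP dot0r.
lra.
Qed.

(** The hypotheses describe vectors tangent to the cone at s (1, |Y|^2 / 2, Y). The part coming from
    the variation of [s] is along the generator, which is null and orthogonal to all of them, so
    only the variations [u], [u'] of [Y] count. *)
Lemma lorentz_conformal (X X' : 'rV[R]_n.+2) (Y u u' : 'rV[R]_n) (s : R) :
  X *m P = s *: u + dot X fa *: Y ->
  dot X fb = dot X fa * dot Y Y / 2 + s * dot u Y ->
  X' *m P = s *: u' + dot X' fa *: Y ->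
  dot X' fb = dot X' fa * dot Y Y / 2 + s * dot u' Y ->
  lorentz X X' = s ^+ 2 * dot u u'.
Proof.
by move=> E Eb E' Eb'; rewrite (nf_lorentz fr) E E' Eb Eb' !dotE (dotC Y u'); field.
Qed.

Section InChart.
Variables (a : chart R n M) (z : 'rV[R]_n).
Hypotheses (aa : atlas a) (az : cim a z).

Lemma hscale_chart_diff : differentiable (hscale \o cinv a) z.
Proof. exact: differentiable_dotl (psi_chart_diff H aa az). Qed.

Hypothesis s0 : 0 < hscale (cinv a z).

Lemma gmap_chart_diff : differentiable (gmap \o cinv a) z.
Proof.
apply: differentiable_scale; last exact: differentiable_mulmx (psi_chart_diff H aa az).
by apply: differentiableV; [exact: hscale_chart_diff|rewrite /= gt_eqF].
Qed.

Lemma derive_gmap v : hscale (cinv a z) *: 'D_v (gmap \o cinv a) z =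
  'D_v (psi \o cinv a) z *m P - dot ('D_v (psi \o cinv a) z) fa *: gmap (cinv a z).
Proof.
have Dpsi := derivableP (diff_derivable (v := v) (psi_chart_diff H aa az)).
have Ds := is_derive_dot Dpsi (@is_derive_cst _ _ _ (fa : 'rV[R]_n.+2) z v).
have sn0 : dot ((psi \o cinv a) z) (cst fa z) != 0 by rewrite gt_eqF.
have DY := is_deriveZf (is_deriveVf Ds sn0) (is_derive_mulmx P Dpsi).
rewrite (@derive_val _ _ _ _ _ _ _ DY) /cst /= dot0r addr0 /gmap -/(hscale (cinv a z)).
rewrite scalerDr addrC; congr (_ + _).
  by rewrite scalerA mulfV ?scale1r // gt_eqF.
rewrite -[RHS]scaleNr !scalerA; congr (_ *: _).
by field; rewrite gt_eqF.
Qed.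

Lemma gmap_conformal v w :
  lorentz ('D_v (psi \o cinv a) z) ('D_w (psi \o cinv a) z) =
  hscale (cinv a z) ^+ 2 * dot ('D_v (gmap \o cinv a) z) ('D_w (gmap \o cinv a) z).
Proof.
set s := hscale _; set Y := gmap (cinv a z).
have key u : 'D_u (psi \o cinv a) z *m P =
    s *: 'D_u (gmap \o cinv a) z + dot ('D_u (psi \o cinv a) z) fa *: Y.
  by rewrite derive_gmap subrK.
have keyb u : dot ('D_u (psi \o cinv a) z) fb =
   dot ('D_u (psi \o cinv a) z) fa * dot Y Y / 2 + s * dot ('D_u (gmap \o cinv a) z) Y.
  have := lorentz_Dpsi_psi H aa az u; rewrite (nf_lorentz fr) psi_mulmx // psi_fb //.
  rewrite -/(hscale _) -/s -/Y key dotZr dotDl !dotZl => E.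
  have sn0 : s != 0 by rewrite gt_eqF.
  apply/eqP; rewrite -(inj_eq (mulfI sn0)) -subr_eq0; apply/eqP; rewrite -[RHS]oppr0 -E.
  by field.
exact: (lorentz_conformal (key v) (keyb v) (key w) (keyb w)).
Qed.

(** Conformality kills the horospherical length of [v], and the lower pinching bound then kills its
    induced length. *)
Lemma gmap_chart_inj v : 'D_v (gmap \o cinv a) z = 0 -> v = 0.
Proof.
move=> D0; have [m0 m1 _ m2] := metric_compare H aa az v.
apply: m2; apply/eqP; rewrite eq_le m0 andbT.
move: m1; rewrite gmap_conformal D0 dot0r mulr0 pmulr_rle0 //.
by rewrite exprn_gt0 // (pc_gt0 H).
Qed.

Lemma near_hscale : \forall w \near z, cim a w /\ 0 < hscale (cinv a w).
Proof.
have sc : {for z, continuous (hscale \o cinv a)}.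
  exact: differentiable_continuous hscale_chart_diff.
exact: filterI (near_cim az) (near_gt sc s0).
Qed.

End InChart.

Lemma gmap_chart_C1 a z v : atlas a -> cim a z -> 0 < hscale (cinv a z) ->
  {for z, continuous (fun w => 'D_v (gmap \o cinv a) w)}.
Proof.
move=> aa az s0.
apply: (@near_eq_continuous _ _ _ (fun w => (hscale (cinv a w))^-1 *:
  ('D_v (psi \o cinv a) w *m P - dot ('D_v (psi \o cinv a) w) fa *: gmap (cinv a w)))).
  apply: filterS (near_hscale aa az s0) => w [aw sw].
  by rewrite -derive_gmap // scalerA mulVf ?scale1r // gt_eqF.
have Dc := psi_chart_C1 (v := v) H aa az.
have sc : {for z, continuous (hscale \o cinv a)}.
  exact: differentiable_continuous (hscale_chart_diff aa az).
have gc : {for z, continuous (gmap \o cinv a)}.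
  exact: differentiable_continuous (gmap_chart_diff aa az s0).
apply: continuousZ; first by apply: continuousV => //=; rewrite gt_eqF.
apply: continuousB; first exact: continuous_mulmx.
apply: continuousZ => //; apply: continuous_dot => //; exact: cst_continuous.
Qed.

Lemma local_section a p : atlas a -> cdom a p -> 0 < hscale p ->
  exists (r : R) (e : 'rV[R]_n -> 'rV[R]_n),
  [/\ 0 < r, e (gmap p) = ccoord a p,
      forall y, ball (gmap p) r y ->
        [/\ cim a (e y), 0 < hscale (cinv a (e y)), gmap (cinv a (e y)) = y,
            differentiable e y & (forall v, {for y, continuous (fun z => 'D_v e z)}) /\
            forall v, 'D_('D_v e y) (gmap \o cinv a) (e y) = v]
    & \forall q \near p, [/\ ball (gmap p) r (gmap q), cdom a q & cinv a (e (gmap q)) = q]].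
Proof.
move=> aa ap s0; have az := cimP ap; have pK : cinv a (ccoord a p) = p by rewrite ccoordK.
have sz : 0 < hscale (cinv a (ccoord a p)) by rewrite pK.
pose U := [set w | cim a w /\ 0 < hscale (cinv a w)].
have Uopen : open U.
  by rewrite openE => w [aw sw]; exact: near_hscale.
have Uz : U (ccoord a p) by [].
have [r [e [r0 e0 eP nearP]]] := inverse_function Uopen Uz
  (fun w Uw => gmap_chart_diff aa Uw.1 Uw.2)
  (fun v w Uw => @gmap_chart_C1 a w v aa Uw.1 Uw.2)
  (fun v => @gmap_chart_inj a (ccoord a p) aa az sz v).
rewrite /= pK in e0 eP nearP.
exists r, e; split=> // [y yr|].
  by have [[ce se] fe ed eD ec] := eP y yr.
have nd : \forall q \near p, cdom a q.
  by apply: open_nbhs_nbhs; split=> //; exact: cdom_open.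
have nc : \forall q \near p, ball (gmap p) r ((gmap \o cinv a) (ccoord a q)) /\
    e ((gmap \o cinv a) (ccoord a q)) = ccoord a q.
  exact: (ccoord_cont ap nearP).
apply: filterS (filterI nd nc) => q [aq]; rewrite /= ccoordK // => -[qb qe].
by split=> //; rewrite qe ccoordK.
Qed.

End HorosphericalCoordinates.

(** * Curves, lengths and local sections of the Gauss map *)

Section IntegralBounds.
Context {R : realType}.
Local Notation mu := (@lebesgue_measure R).

Lemma continuous_itv_measurable (f : R -> R) (a b : R) :
  {in `[a, b], continuous f} -> measurable_fun `[a, b] f.
Proof.
move=> fc.
apply: subspace_continuous_measurable_fun; first exact: measurable_itv.
by apply: continuous_in_subspaceT => x /[!inE]; exact: fc.
Qed.

Lemma integral_le_const (f : R -> R) (B : R) : continuous f ->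
  (forall t, 0 <= t <= 1 -> 0 <= f t <= B) ->
  (\int[mu]_(t in `[0%R, 1%R]) (f t)%:E <= B%:E)%E.
Proof.
move=> fc fB; apply: (@le_trans _ _ (\int[mu]_(t in `[0%R, 1%R]) (cst B%:E t))%E).
  apply: ge0_le_integral => //.
  - by move=> t /=; rewrite in_itv /= lee_fin => /fB /andP[].
  - by apply/measurable_EFinP; apply: continuous_itv_measurable => t _; exact: fc.
  - by move=> t /=; rewrite in_itv /= lee_fin => /fB /andP[].
rewrite integral_cst //= lebesgue_measure_itv /= lte_fin ltr01.
by rewrite oppr0 adde0 mule1.
Qed.

(** The increment is taken over [b, 1] because curves will be followed backwards from their end
    point, whereas the length is that of the whole curve. *)
Lemma increment_le_integral (f df sp : R -> R) (K eps b : R) :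
  0 <= K -> continuous sp -> (forall t, 0 <= sp t) -> 0 <= b -> b < 1 ->
  (forall t, b <= t <= 1 -> is_derive t (1 : R) f (df t)) ->
  (forall t, b <= t <= 1 -> {for t, continuous df}) ->
  (forall t, b <= t <= 1 -> `|df t| <= K * sp t) ->
  (\int[mu]_(t in `[0%R, 1%R]) (sp t)%:E < eps%:E)%E ->
  `|f 1 - f b| <= K * eps.
Proof.
move=> K0 spc sp0 b0 b1 fD dfc dfK spe.
have fcont t : b <= t <= 1 -> {for t, continuous f}.
  move=> tb; apply: differentiable_continuous; apply/derivable1_diffP.
  by have [] := fD t tb.
have FTC : (\int[mu]_(t in `[b, 1%R]) (df t)%:E = (f 1)%:E - (f b)%:E)%E.
  apply: continuous_FTC2 => //.
  - apply: continuous_in_subspaceT => t /[!inE] /=; rewrite in_itv /=; exact: dfc.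
  - split.
    + move=> t; rewrite in_itv /= => /andP[bt t1].
      by have [] := fD t; rewrite ?(ltW bt) ?(ltW t1).
    + by apply: cvg_at_right_filter; apply: fcont; rewrite lexx ltW.
    + by apply: cvg_at_left_filter; apply: fcont; rewrite lexx ltW.
  - move=> t; rewrite in_itv /= => /andP[bt t1]; rewrite derive1E.
    apply: derive_val; first by apply: fD; rewrite !ltW.
rewrite -lee_fin (_ : `|f 1 - f b|%:E = `|(f 1 - f b)%:E|%E) // EFinB -FTC.
have mdf : measurable_fun `[b, 1%R] df.
  by apply: continuous_itv_measurable => t; rewrite in_itv /=; exact: dfc.
apply: le_trans (le_abse_integral _ _ _) _; [exact: measurable_itv|exact/measurable_EFinP|].
apply: (@le_trans _ _ (\int[mu]_(t in `[b, 1%R]) (K%:E * (sp t)%:E))%E).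
  apply: ge0_le_integral => //.
  - by apply: measurableT_comp => //; exact/measurable_EFinP.
  - rewrite (_ : (fun _ => _) = EFin \o (fun t => K * sp t)); last first.
      by rewrite funeqE => t; rewrite /= EFinM.
    apply/measurable_EFinP; apply: continuous_itv_measurable => t _.
    by apply: (@continuousM _ _ (cst K) sp); [exact: cst_continuous|exact: spc].
have msp (c : R) : measurable_fun `[c, 1%R] sp.
  by apply: continuous_itv_measurable => t _; exact: spc.
rewrite ge0_integralZl_EFin //; last by apply/measurable_EFinP; exact: msp.
rewrite EFinM; apply: lee_pmul => //.
  by apply: integral_ge0 => t _; rewrite lee_fin.
apply: le_trans (ltW spe).
apply: ge0_subset_integral => //; first by apply/measurable_EFinP; exact: msp.
- by move=> t _; rewrite lee_fin.
- by move=> t /=; rewrite !in_itv /= => /andP[bt ->]; rewrite (le_trans b0 bt).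
- by move=> t _; rewrite lee_fin.
Qed.

End IntegralBounds.

Section ContinuousSum.
Context {R : realType}.

Lemma continuous_sumf (T : topologicalType) (W : normedModType R) k
    (h : 'I_k -> T -> W) (x : T) :
  (forall i, {for x, continuous (h i)}) -> {for x, continuous (fun y => \sum_i h i y)}.
Proof.
move=> hx; apply: (@cvg_big W _ +%R 0 xpredT) => [|i _]; first exact: add_continuous.
exact: hx.
Qed.

End ContinuousSum.

Section Curves.
Context {R : realType} {n : nat} {M : smoothManifold R n}.
Implicit Types (p q : M) (a : chart R n M) (z v : 'rV[R]_n) (c : R -> M).

Definition C1_at (W : normedModType R) (F : 'rV[R]_n -> W) z :=
  differentiable F z /\ forall v, {for z, continuous (fun w => 'D_v F w)}.

Lemma curve_chart c a t : C1_curve c -> atlas a -> cdom a (c t) ->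
  [/\ \forall s \near t, cdom a (c s),
      is_derive t (1 : R) (ccoord a \o c) ('D_(1 : R) (ccoord a \o c) t)
    & {for t, continuous (fun s : R => 'D_(1 : R) (ccoord a \o c) s)}].
Proof.
move=> [cc cC] aa act; have [cd cD] := cC a aa; split.
- by apply: (cc t); apply: open_nbhs_nbhs; split=> //; exact: cdom_open.
- by apply: derivableP; apply: diff_derivable; exact: cd.
- exact: (cD 1 t act).
Qed.

Lemma near_eq_derive_continuous (W : normedModType R) (f g : R -> W) (t : R) :
  (\forall s \near t, f s = g s) ->
  {for t, continuous (fun s : R => 'D_(1 : R) g s)} ->
  {for t, continuous (fun s : R => 'D_(1 : R) f s)}.
Proof.
move=> fg; apply: near_eq_continuous.
by apply: filterS (near_join fg) => s; exact: near_eq_derive.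
Qed.

Lemma C1_comp_curve (W : normedModType R) (F : 'rV[R]_n -> W) (x : R -> 'rV[R]_n) (t : R) :
  (\forall s \near t, derivable x s (1 : R)) ->
  {for t, continuous (fun s : R => 'D_(1 : R) x s)} ->
  (\forall z \near x t, C1_at F z) ->
  is_derive t (1 : R) (F \o x) ('D_('D_(1 : R) x t) F (x t)) /\
  {for t, continuous (fun s : R => 'D_(1 : R) (F \o x) s)}.
Proof.
move=> xd xc FC.
have step s : derivable x s (1 : R) -> C1_at F (x s) ->
    is_derive s (1 : R) (F \o x) ('D_('D_(1 : R) x s) F (x s)).
  by move=> xs [Fs _]; exact: is_derive_chain (derivableP xs) Fs.
have xt := nbhs_singleton xd.
have xcont : {for t, continuous x}.
  by apply: differentiable_continuous; apply/derivable1_diffP.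
split; first by apply: step => //; exact: nbhs_singleton FC.
have nF : \forall s \near t, C1_at F (x s) by exact: (xcont _ FC).
(* [C1_at] gives continuity of derivatives in fixed directions only, while the velocity varies;
   hence the expansion in the standard basis. *)
apply: (@near_eq_continuous _ _ _ (fun s => \sum_i ('D_(1 : R) x s) ord0 i
   *: 'D_(delta_mx ord0 i) F (x s))).
  apply: filterS (filterI xd nF) => s [xs Fs].
  by rewrite -derive_sum_delta; [case: (step s xs Fs)|case: Fs].
apply: continuous_sumf => i; apply: continuousZ.
  by apply: cvg_coord; exact: xc.
apply: (@continuous_comp _ _ _ x (fun z => 'D_(delta_mx ord0 i) F z)); first exact: xcont.
by have [_] := nbhs_singleton FC; exact.
Qed.

Lemma derive_along (W : normedModType R) (F : M -> W) c a t :
  C1_curve c -> atlas a -> cdom a (c t) ->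
  (\forall z \near ccoord a (c t), C1_at (F \o cinv a) z) ->
  is_derive t (1 : R) (F \o c)
     ('D_('D_(1 : R) (ccoord a \o c) t) (F \o cinv a) (ccoord a (c t))) /\
  {for t, continuous (fun s : R => 'D_(1 : R) (F \o c) s)}.
Proof.
move=> cC aa act FC; have [nd _ xc] := curve_chart cC aa act.
have xd : \forall s \near t, derivable (ccoord a \o c) s (1 : R).
  by apply: filterS nd => s acs; have [_ []] := curve_chart cC aa acs.
have [D Dc] := C1_comp_curve xd xc FC.
have E : \forall s \near t, (F \o c) s = ((F \o cinv a) \o (ccoord a \o c)) s.
  by apply: filterS nd => s acs; rewrite /= ccoordK.
split; last exact: near_eq_derive_continuous E Dc.
by apply: near_eq_is_derive D; apply: filterS E => s ->.
Qed.

Variables (phi eta : M -> 'rV[R]_n.+2) (kappa : M -> 'I_n -> R) (a1 a2 : R).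
Hypothesis H : pinched phi eta kappa a1 a2.
Variables (fa fb : 'rV[R]_n.+2) (P : 'M[R]_(n.+2, n)).
Hypothesis fr : null_frame fa fb P.

Local Notation hscale := (hscale phi eta fa).
Local Notation gmap := (gmap phi eta fa P).

Definition speed c (t : R) : R :=
  Num.sqrt (lorentz (derive1 (phi \o c) t) (derive1 (phi \o c) t)).

Lemma continuous_lorentz (T : topologicalType) (f g : T -> 'rV[R]_n.+2) (x : T) :
  {for x, continuous f} -> {for x, continuous g} ->
  {for x, continuous (fun u => lorentz (f u) (g u))}.
Proof.
move=> fx gx; have cs (h : T -> 'rV[R]_n.+2) (k : 'I_n.+2) :
    {for x, continuous h} -> {for x, continuous (fun u => h u ord0 k)}.
  by move=> hx; apply: cvg_coord.
apply: continuousD.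
  by apply: continuousN; apply: (continuousM (cs _ _ fx) (cs _ _ gx)).
apply: continuous_sumf => i; exact: (continuousM (cs _ _ fx) (cs _ _ gx)).
Qed.

Lemma phi_C1_at a z : atlas a -> cim a z ->
  \forall w \near z, C1_at (phi \o cinv a) w.
Proof.
move=> aa az; apply: filterS (near_cim az) => w aw.
exact: (smooth_map_C1 (let: And3 h _ _ := pc_imm H in h) aa aw).
Qed.

Lemma gmap_C1_at a z : atlas a -> cim a z -> 0 < hscale (cinv a z) ->
  \forall w \near z, C1_at (gmap \o cinv a) w.
Proof.
move=> aa az s0; apply: filterS (near_hscale H aa az s0) => w [aw sw].
split; first exact: (gmap_chart_diff H P aa aw sw).
by move=> v; exact: (gmap_chart_C1 H aa aw sw).
Qed.

Lemma derive1_phi_curve c a t : C1_curve c -> atlas a -> cdom a (c t) ->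
  derive1 (phi \o c) t =
    'D_('D_(1 : R) (ccoord a \o c) t) (phi \o cinv a) (ccoord a (c t)).
Proof.
move=> cC aa act; rewrite derive1E; apply: derive_val.
by case: (derive_along cC aa act (phi_C1_at aa (cimP act))).
Qed.

Lemma speed_continuous c : C1_curve c -> continuous (speed c).
Proof.
move=> cC t; have [a aa act] := atlas_cover (c t).
have [_ dc] := derive_along cC aa act (phi_C1_at aa (cimP act)).
apply: (@continuous_comp _ _ _ (fun s => lorentz (derive1 (phi \o c) s) (derive1 (phi \o c) s))
  (@Num.sqrt R)); last exact: sqrt_continuous.
rewrite (_ : derive1 (phi \o c) = fun s => 'D_(1 : R) (phi \o c) s); last first.
  by rewrite funeqE => s; rewrite derive1E.
exact: continuous_lorentz.
Qed.

Lemma speed_sqr c t : C1_curve c ->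
  speed c t ^+ 2 = lorentz (derive1 (phi \o c) t) (derive1 (phi \o c) t).
Proof.
move=> cC; have [a aa act] := atlas_cover (c t).
rewrite /speed sqr_sqrtr // (derive1_phi_curve cC aa act).
by have [] := metric_compare H aa (cimP act) ('D_(1 : R) (ccoord a \o c) t).
Qed.

Lemma gmap_curve c t : C1_curve c -> 0 < hscale (c t) ->
  [/\ derivable (gmap \o c) t (1 : R),
      {for t, continuous (fun s : R => 'D_(1 : R) (gmap \o c) s)},
      hscale (c t) ^+ 2 * dot ('D_(1 : R) (gmap \o c) t) ('D_(1 : R) (gmap \o c) t)
        <= a2 ^+ 2 * speed c t ^+ 2
    & a1 ^+ 2 * speed c t ^+ 2 <=
      hscale (c t) ^+ 2 * dot ('D_(1 : R) (gmap \o c) t) ('D_(1 : R) (gmap \o c) t)].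
Proof.
move=> cC s0; have [a aa act] := atlas_cover (c t).
have az := cimP act.
have pK : cinv a (ccoord a (c t)) = c t by rewrite ccoordK.
have sz : 0 < hscale (cinv a (ccoord a (c t))) by rewrite pK.
have [D Dc] := derive_along cC aa act (gmap_C1_at aa az sz).
have -> := @derive_val _ _ _ _ _ _ _ D.
have E := @gmap_conformal _ _ _ _ _ _ _ _ H _ _ _ fr _ _ aa az sz
  ('D_(1 : R) (ccoord a \o c) t) ('D_(1 : R) (ccoord a \o c) t).
rewrite pK in E.
have [_ m1 m2 _] := metric_compare H aa az ('D_(1 : R) (ccoord a \o c) t).
rewrite speed_sqr // (derive1_phi_curve cC aa act) -E.
split=> //; by case: D.
Qed.

End Curves.

Section Sections.
Context {R : realType} {n : nat} {M : smoothManifold R n}.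
Implicit Types (p q : M) (a : chart R n M) (z v y : 'rV[R]_n).
Variables (phi eta : M -> 'rV[R]_n.+2) (kappa : M -> 'I_n -> R) (a1 a2 : R).
Hypothesis H : pinched phi eta kappa a1 a2.
Variables (fa fb : 'rV[R]_n.+2) (P : 'M[R]_(n.+2, n)).
Hypothesis fr : null_frame fa fb P.

Local Notation psi := (psi phi eta).
Local Notation hscale := (hscale phi eta fa).
Local Notation gmap := (gmap phi eta fa P).

Lemma chart_continuous (W : topologicalType) (F : M -> W) a p : cdom a p ->
  {for ccoord a p, continuous (F \o cinv a)} -> {for p, continuous F}.
Proof.
move=> ap Fc; have nd : \forall q \near p, cdom a q.
  by apply: open_nbhs_nbhs; split=> //; exact: cdom_open.
apply: (@near_eq_continuous _ _ _ ((F \o cinv a) \o ccoord a)).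
  by apply: filterS nd => q aq; rewrite /= ccoordK.
by apply: continuous_comp Fc; exact: ccoord_cont.
Qed.

Lemma phi_continuous : continuous phi.
Proof.
move=> p; have [a aa ap] := atlas_cover p.
apply: (chart_continuous ap); apply: differentiable_continuous.
exact: (phi_chart_diff H aa (cimP ap)).
Qed.

Lemma psi_continuous : continuous psi.
Proof.
move=> p; have [a aa ap] := atlas_cover p.
apply: (chart_continuous ap); apply: differentiable_continuous.
exact: (psi_chart_diff H aa (cimP ap)).
Qed.

Lemma hscale_continuous : continuous hscale.
Proof.
move=> p; apply: continuous_dot; first exact: psi_continuous.
exact: cst_continuous.
Qed.

Lemma gmap_continuous p : 0 < hscale p -> {for p, continuous gmap}.
Proof.
move=> s0; apply: continuousZ.
  by apply: continuousV; [rewrite gt_eqF|exact: hscale_continuous].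
by apply: continuous_mulmx; exact: psi_continuous.
Qed.

(** Only continuity is required, which lifting and gluing preserve; by [csection_chart] such a
    section is locally the C^1 inverse of the Gauss map. *)
Definition csection (Om : set 'rV[R]_n) (sg : 'rV[R]_n -> M) :=
  open Om /\ forall y, Om y ->
    [/\ {for y, continuous sg}, 0 < hscale (sg y) & gmap (sg y) = y].

Lemma near_section p : 0 < hscale p -> exists (r : R) sg,
  [/\ 0 < r, csection (ball (gmap p) r) sg
    & \forall q \near p, ball (gmap p) r (gmap q) /\ sg (gmap q) = q].
Proof.
move=> s0; have [a aa ap] := atlas_cover p.
have [r [e [r0 e0 eP nearP]]] := local_section H fr aa ap s0.
exists r, (cinv a \o e); split=> //.
- split; first exact: ball_open.
  move=> y /eP [ay sy gy ed _]; split=> //.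
  apply: continuous_comp; first exact: differentiable_continuous.
  exact: cinv_cont.
- by apply: filterS nearP => q [].
Qed.

Lemma gmap_locally_inj p : 0 < hscale p -> exists2 U, nbhs p U &
  forall q q', U q -> U q' -> gmap q = gmap q' -> q = q'.
Proof.
move=> s0; have [r [sg [_ _ nearP]]] := near_section s0.
exists [set q | ball (gmap p) r (gmap q) /\ sg (gmap q) = q] => //.
by move=> q q' [_ qE] [_ q'E] E; rewrite -qE -q'E E.
Qed.

(** For [q] near [p], both [q] and [sg (gmap q)] lie where the Gauss map is injective, and they have
    the same image. In particular the image of a section is open. *)
Lemma near_csection Om sg p : csection Om sg -> Om (gmap p) -> sg (gmap p) = p ->
  \forall q \near p, Om (gmap q) /\ sg (gmap q) = q.
Proof.
move=> [Oo OP] Op sp; have [sc s0 _] := OP _ Op; rewrite sp in s0.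
have gc := gmap_continuous s0.
have nO : \forall q \near p, Om (gmap q).
  by apply: gc; apply: open_nbhs_nbhs; split.
have [U pU Uinj] := gmap_locally_inj s0.
have nU : \forall q \near p, U (sg (gmap q)).
  have : {for p, continuous (sg \o gmap)} by exact: continuous_comp gc sc.
  by move=> /(_ U); rewrite /= sp; exact.
apply: filterS (filterI nO (filterI nU pU)) => q [Oq [Usq Uq]]; split=> //.
by apply: Uinj => //; have [] := OP _ Oq.
Qed.

Lemma csection_sub Om Om' sg : csection Om sg -> open Om' -> Om' `<=` Om -> csection Om' sg.
Proof. by move=> [_ OP] O'o sub; split=> // y /sub /OP. Qed.

Lemma csection_closed Om sg (K : set 'rV[R]_n) : csection Om sg -> compact K -> K `<=` Om ->
  closed (sg @` K).
Proof.
move=> [_ OP] cK KO; apply: compact_closed; first exact: manifold_hausdorff.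
apply: continuous_compact => //; apply: continuous_in_subspaceT => y /[!inE] /KO /OP.
by case.
Qed.

Lemma csection_chart Om sg y a : csection Om sg -> Om y -> atlas a -> cdom a (sg y) ->
  exists2 e : 'rV[R]_n -> 'rV[R]_n, e y = ccoord a (sg y) &
    \forall w \near y, [/\ Om w, cim a (e w), sg w = cinv a (e w),
      C1_at e w & forall v, 'D_('D_v e w) (gmap \o cinv a) (e w) = v].
Proof.
move=> [Oo OP] Oy aa ay; have [sc s0 gy] := OP _ Oy.
have [r [e [r0 e0 eP nearP]]] := local_section H fr aa ay s0.
rewrite gy in e0 eP nearP.
exists e => //.
have nO : \forall w \near y, Om w by apply: open_nbhs_nbhs; split.
have nb : \forall w \near y, ball y r w by exact: nbhsx_ballx.
apply: filterS (filterI nO (filterI nb (sc _ nearP))) => w [Ow [bw [_ _ sE]]].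
have [aw sw gw ed [ec eD]] := eP w bw.
by split=> //; have [_ _ gsw] := OP _ Ow; rewrite -[in LHS]sE gsw.
Qed.

Lemma csection_curve Om sg (x : R -> 'rV[R]_n) : csection Om sg ->
  (forall t, Om (x t)) -> (forall t, derivable x t (1 : R)) ->
  continuous (fun t : R => 'D_(1 : R) x t) -> C1_curve (sg \o x).
Proof.
move=> sO xO xd xc.
have xcont : continuous x.
  by move=> t; apply: differentiable_continuous; apply/derivable1_diffP.
split=> [t|a aa].
  apply: continuous_comp; first exact: xcont.
  by have [] := sO.2 _ (xO t).
have key t : cdom a (sg (x t)) ->
  is_derive t (1 : R) (ccoord a \o (sg \o x)) ('D_(1 : R) (ccoord a \o (sg \o x)) t) /\
  {for t, continuous (fun s : R => 'D_(1 : R) (ccoord a \o (sg \o x)) s)}.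
  move=> /= at_; have [e _ eP] := csection_chart sO (xO t) aa at_.
  have xdn : \forall s \near t, derivable x s (1 : R).
    by apply: filterE => s; exact: xd.
  have [D Dc] := C1_comp_curve xdn (xc t)
    (filterS (fun w (h : [/\ Om w, cim a (e w), sg w = cinv a (e w), C1_at e w & _]) =>
       let: And5 _ _ _ h _ := h in h) eP).
  have E : \forall s \near t, (ccoord a \o (sg \o x)) s = (e \o x) s.
    have nE : \forall s \near t, cim a (e (x s)) /\ sg (x s) = cinv a (e (x s)).
      have nw : \forall w \near x t, cim a (e w) /\ sg w = cinv a (e w).
        by apply: filterS eP => w [].
      exact: (xcont t _ nw).
    apply: filterS nE => s [aw sE] /=.
    by rewrite sE; have [_ ->] := cinvK aw.
  split; last exact: near_eq_derive_continuous E Dc.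
  have E' : \forall s \near t, (e \o x) s = (ccoord a \o (sg \o x)) s.
    by apply: filterS E => s ->.
  apply: derivableP.
  by case: (near_eq_is_derive E' D).
split=> [t tc|v t tc].
  by apply/derivable1_diffP; case: (key t tc) => -[].
apply: (@near_eq_continuous _ _ _ (fun s : R => v *: 'D_(1 : R) (ccoord a \o (sg \o x)) s)).
  have nt : \forall s \near t, cdom a (sg (x s)).
    have [sc _ _] := sO.2 _ (xO t).
    have cc : {for t, continuous (sg \o x)}.
      by apply: continuous_comp; [exact: xcont|exact: sc].
    by apply: cc; apply: open_nbhs_nbhs; split=> //; exact: cdom_open.
  apply: filterS nt => s ts.
  have ds : differentiable (ccoord a \o (sg \o x)) s.
    by apply/derivable1_diffP; case: (key s ts) => -[].
  rewrite !deriveE // -linearZ /=; congr ('d _ _ _).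
  by rewrite /GRing.scale /= mulr1.
by apply: continuousZr; case: (key t tc).
Qed.

(** The lower pinching bound gives a1 * speed <= hscale * |x'| along the lifted curve. *)
Lemma csection_dist Om sg (x : R -> 'rV[R]_n) (B : R) : csection Om sg ->
  (forall t, Om (x t)) -> (forall t, derivable x t (1 : R)) ->
  continuous (fun t : R => 'D_(1 : R) x t) -> 0 <= B ->
  (forall t, 0 <= t <= 1 ->
     hscale (sg (x t)) ^+ 2 * dot ('D_(1 : R) x t) ('D_(1 : R) x t) <= B ^+ 2) ->
  (induced_dist phi (sg (x 0%R)) (sg (x 1%R)) <= (B / a1)%:E)%E.
Proof.
move=> sO xO xd xc B0 xB; have cC := csection_curve sO xO xd xc.
apply: (@le_trans _ _ (curve_length phi (sg \o x))).
  by apply: ereal_inf_lbound; exists (sg \o x).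
apply: integral_le_const; first exact: (speed_continuous H cC).
move=> t t01; rewrite sqrtr_ge0 /= -/(speed phi (sg \o x) t).
have [_ s0 _] := sO.2 _ (xO t).
have [_ _ _] := gmap_curve H fr cC s0.
have -> : gmap \o (sg \o x) = x.
  by rewrite funeqE => s /=; have [_ _ ->] := sO.2 _ (xO s).
move=> le1; have a10 := pc_gt0 H.
rewrite ler_pdivlMr // -(@ler_pXn2r _ 2%N) ?nnegrE //; last first.
  by apply: mulr_ge0; [exact: sqrtr_ge0|exact: ltW].
rewrite exprMn mulrC; apply: le_trans le1 _; exact: xB.
Qed.

End Sections.

(** * Induced distance and manifold topology *)

Section SmallDistance.
Context {R : realType} {n : nat} {M : smoothManifold R n}.
Implicit Types (p q : M) (y : 'rV[R]_n).
Variables (phi eta : M -> 'rV[R]_n.+2) (kappa : M -> 'I_n -> R) (a1 a2 : R).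
Hypothesis H : pinched phi eta kappa a1 a2.
Hypothesis a20 : 0 < a2.

Section Scale.
Variables (fa fb : 'rV[R]_n.+2) (P : 'M[R]_(n.+2, n)).
Hypothesis fr : null_frame fa fb P.

Local Notation hscale := (hscale phi eta fa).
Local Notation gmap := (gmap phi eta fa P).
Local Notation csection := (csection phi eta fa P).

Lemma compact_normball y (r : R) : compact (closed_ball_ Num.norm y r).
Proof.
apply: bounded_closed_compact; last exact: closed_closed_ball_.
exists (`|y| + r); split; first exact: num_real.
move=> C rC x /= xr; apply: ltW; apply: le_lt_trans rC.
have -> : x = y - (y - x) by rewrite opprB addrC subrK.
by apply: le_trans (ler_normB _ _) _; rewrite lerD2l.
Qed.

Lemma rowBE (u v : 'rV[R]_n) i : (u - v) ord0 i = u ord0 i - v ord0 i.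
Proof. by rewrite !mxE. Qed.

Lemma derive_coord_le (v : 'rV[R]_n) (s m sp : R) i : 0 < m -> m <= s -> 0 <= sp ->
  s ^+ 2 * dot v v <= a2 ^+ 2 * sp ^+ 2 -> `|v ord0 i| <= a2 / m * sp.
Proof.
move=> m0 ms sp0 sv.
rewrite -(@ler_pXn2r _ 2%N) ?nnegrE //; last first.
  by apply: mulr_ge0 => //; apply: divr_ge0; exact: ltW.
rewrite real_normK ?num_real // !exprMn exprVn mulrAC ler_pdivlMr ?exprn_gt0 //.
apply: le_trans sv; rewrite mulrC; apply: ler_pM; rewrite ?sqr_ge0 //.
  by rewrite ler_pXn2r ?nnegrE // ?(le_trans (ltW m0) ms) // ltW.
rewrite /dot (bigD1 i) //= expr2 lerDl; apply: sumr_ge0 => j _.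
by rewrite -expr2 sqr_ge0.
Qed.

(** A short curve ending at [p] cannot leave the image of a local section: its Gauss image moves by
    at most a2 / m times its length while [hscale > m]. *)
Lemma near_of_dist_scale p (U : set M) : 0 < hscale p -> nbhs p U ->
  exists2 eps : R, 0 < eps &
    forall q, (induced_dist phi q p < eps%:E)%E -> U q.
Proof.
move=> s0 pU; have [r [sg [r0 sec nearP]]] := near_section H fr s0.
set Y0 := gmap p in sec nearP.
have [_ sgY0] := nbhs_singleton nearP.
have [sgc _ _] := sec.2 Y0 (ballxx _ r0).
rewrite -/Y0 in sgY0.
pose m := hscale p / 2.
have m0 : 0 < m by rewrite divr_gt0.
have mp : m < hscale p by rewrite /m; lra.
have n1 : \forall y \near Y0, [/\ U (sg y), m < hscale (sg y) & ball Y0 r y].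
  have nU : \forall y \near Y0, U (sg y).
    by move: pU; rewrite -sgY0 => /sgc.
  have nm : \forall y \near Y0, m < hscale (sg y).
    apply: near_gt; last by rewrite sgY0.
    by apply: continuous_comp; [exact: sgc|exact: (hscale_continuous H)].
  have nb : \forall y \near Y0, ball Y0 r y by exact: nbhsx_ballx.
  by apply: filterS (filterI nU (filterI nm nb)) => y [? [? ?]].
have /nbhs_closedballP[rho' rhoP] := n1.
have rho0 : 0 < rho'%:num by [].
rewrite closed_ballE // in rhoP; move: (rho'%:num) rhoP rho0 => rho rhoP rho0.
have bP y : ball Y0 rho y -> [/\ U (sg y), m < hscale (sg y) & ball Y0 r y].
  by move=> yb; apply: rhoP; apply: ltW; move: yb; rewrite -ball_normE.
have secr : csection (ball Y0 rho) sg.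
  by apply: csection_sub sec _ _; [exact: ball_open|move=> y /bP[]].
(* Length below [eps] confines the Gauss image to the ball of half the radius, whose closure is
   compact inside the domain of the section. *)
pose eps := rho / 2 * m / a2.
have eps0 : 0 < eps by rewrite /eps !divr_gt0 // mulr_gt0 // divr_gt0.
have Keps : a2 / m * eps = rho / 2 by rewrite /eps; field; rewrite !gt_eqF.
exists eps => // q /ereal_inf_lt [_ [c [cC c0 c1] <-] len].
pose S (b : R) := ball Y0 rho (gmap (c b)) /\ sg (gmap (c b)) = c b.
have ccont : continuous c by case: cC.
have incr (b : R) : 0 <= b -> b <= 1 -> (forall t, b <= t <= 1 -> S t) ->
    closed_ball_ Num.norm Y0 (rho / 2) (gmap (c b)).
  move=> b0; rewrite le_eqVlt => /orP[/eqP -> _|b1 Sb].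
    by rewrite /closed_ball_ /= c1 subrr normr0 divr_ge0 // ltW.
  rewrite /closed_ball_ /= -Keps; apply: norm_le_coord => [|i].
    by rewrite Keps divr_ge0 // ltW.
  rewrite rowBE.
  have sb t : b <= t <= 1 -> m < hscale (c t).
    by move=> /Sb [/bP[_ mt _] sgE]; rewrite -sgE.
  have st t : b <= t <= 1 -> 0 < hscale (c t) by move=> /sb; exact: lt_trans.
  have -> : Y0 ord0 i = (fun t => gmap (c t) ord0 i) 1 by rewrite /= c1.
  apply: (@increment_le_integral _ (fun t => gmap (c t) ord0 i)
    (fun t => ('D_(1 : R) (gmap \o c) t) ord0 i) (speed phi c) (a2 / m) eps b) => //.
  - by apply: divr_ge0; exact: ltW.
  - exact: (speed_continuous H cC).
  - by move=> t; exact: sqrtr_ge0.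
  - move=> t tb; have [D _ _ _] := gmap_curve H fr cC (st t tb).
    by apply: is_derive_coord; exact: derivableP.
  - move=> t tb; have [_ D _ _] := gmap_curve H fr cC (st t tb).
    by apply: cvg_coord; exact: D.
  - move=> t tb; have [_ _ D _] := gmap_curve H fr cC (st t tb).
    by apply: (derive_coord_le i m0 (ltW (sb t tb)) _ D); exact: sqrtr_ge0.
(* The curve is followed backwards from [p]. At limit times the image of the compact half ball is
   closed, so the curve stays on the section. *)
have key t : 0 <= t <= 1 -> S (1 - t).
  apply: (@real_induction R (fun t => S (1 - t)) 0 1).
  - rewrite subr0 /S c1; split; [exact: ballxx|exact: sgY0].
  - move=> u u0 u1 Su; have [Sb Ss] : S (1 - u) by apply: Su; rewrite u0 lexx.
    have nS : \forall x \near (1 - u), S x.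
      exact: (ccont (1 - u) _ (near_csection H fr secr Sb Ss)).
    have /nbhs_ballP[d /= d0 dP] := nS.
    exists d => // s /andP[us sd]; apply: dP; rewrite -ball_normE /=.
    have -> : 1 - u - (1 - s) = s - u by ring.
    by rewrite ger0_norm; lra.
  - move=> u u0 u1 Su.
    pose K := closed_ball_ Num.norm Y0 (rho / 2).
    have Kr : K `<=` ball Y0 rho.
      by move=> y; rewrite -ball_normE /K /closed_ball_ /= => yK; lra.
    have cl : closed (sg @` K).
      apply: (csection_closed secr _ Kr); exact: compact_normball.
    have inK s : 0 <= s < u -> (sg @` K) (c (1 - s)).
      move=> /andP[s0' su]; have [_ Ss] : S (1 - s) by apply: Su; rewrite s0'.
      exists (gmap (c (1 - s))) => //; apply: incr; [lra|lra|].
      move=> x /andP[sx x1]; have -> : x = 1 - (1 - x) by ring.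
      by apply: Su; apply/andP; split; lra.
    have lim : c (1 - s) @[s --> u^'-] --> c (1 - u).
      apply: cvg_within_filter.
      apply: (@cvg_comp _ _ _ (fun s : R => 1 - s) c _ (nbhs (1 - u))); last exact: ccont.
      by apply: cvgB; [exact: cvg_cst|exact: cvg_id].
    have [y yK yE] : (sg @` K) (c (1 - u)).
      apply: (closed_cvg _ cl _ _ lim).
      near=> s; apply: inK; apply/andP; split; near: s; last exact: nbhs_left_lt.
      exact: nbhs_left_ge.
    have [_ _ gy] := secr.2 y (Kr y yK).
    by rewrite /S -yE gy; split=> //; exact: Kr.
have [Sb Ss] : S 0 by rewrite -(subrr 1); apply: key; rewrite ler01 lexx.
by rewrite -c0 -Ss; have [] := bP _ Sb.
Unshelve. all: by end_near. Qed.

End Scale.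

Lemma near_of_dist (fa fb : 'rV[R]_n.+2) (P : 'M[R]_(n.+2, n)) p (U : set M) : null_frame fa fb P -> nbhs p U ->
  exists2 eps : R, 0 < eps & forall q, (induced_dist phi q p < eps%:E)%E -> U q.
Proof.
move=> fr pU; have [s0|] := ltP 0 (hscale phi eta fa p).
  exact: (near_of_dist_scale fr s0 pU).
rewrite le_eqVlt ltNge (hscale_ge0 H fr) orbF => /eqP s0.
have [_ t0] := hscale_eq0 H fr s0.
exact: (near_of_dist_scale (null_frame_sym fr) t0 pU).
Qed.

End SmallDistance.

(** * The scale near the boundary at infinity *)

Section Boundary.
Context {R : realType}.

Lemma inv_le (u v : R) : 0 < u -> u <= v -> v^-1 <= u^-1.
Proof. by move=> u0 uv; rewrite lef_pV2 // posrE; exact: lt_le_trans uv. Qed.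

Lemma cvg_harmonic_bound (V : normedModType R) (f : nat -> V) (l : V) (C : R) :
  (forall k, `|l - f k| <= C * k.+1%:R^-1) -> f @ \oo --> l.
Proof.
move=> fC; apply/cvgrPdist_lt => e e0.
have : C * @harmonic R k @[k --> \oo] --> C * 0.
  by apply: cvgM; [exact: cvg_cst|exact: cvg_harmonic].
rewrite mulr0 => /(cvgr_lt 0) /(_ _ e0); apply: filterS => k; exact: le_lt_trans.
Qed.

Context {n : nat} {M : smoothManifold R n}.
Implicit Types (p q : M) (y : 'rV[R]_n).
Variables (phi eta : M -> 'rV[R]_n.+2) (kappa : M -> 'I_n -> R) (a1 a2 : R).
Hypothesis H : pinched phi eta kappa a1 a2.

Lemma poincare_spatial (X : 'rV[R]_n.+2) :
  poincare_ball X = (1 + X ord0 ord0)^-1 *: spatial X.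
Proof. by apply/rowP => i; rewrite !mxE mulrC. Qed.

Lemma poincare_dot p : dot (poincare_ball (phi p)) (poincare_ball (phi p)) =
  1 - 2 / (1 + phi p ord0 ord0).
Proof.
have p0 := phi0_gt0 H p; have := lorentz_phi_phi H p; rewrite lorentzE => E.
have Es : dot (spatial (phi p)) (spatial (phi p)) = phi p ord0 ord0 ^+ 2 - 1.
  by rewrite expr2; lra.
rewrite poincare_spatial dotZl dotZr Es; field.
by apply: lt0r_neq0; lra.
Qed.

(** In the compact closed ball, points with [Q] whose height [phi p ord0 ord0] tends to infinity
    accumulate somewhere; since |poincare_ball|^2 = 1 - 2 / (1 + height), the limit lies on the unit
    sphere, so it is the only boundary point [x]. *)
Lemma escape (x : 'rV[R]_n.+1) (Q : M -> Prop) : boundary_at_infinity phi = [set x] ->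
  (forall k : nat, exists2 p, Q p & k%:R <= phi p ord0 ord0) ->
  forall (K : nat) (e : R), 0 < e -> exists p,
    [/\ Q p, K%:R <= phi p ord0 ord0 & 1 - e < dot (poincare_ball (phi p)) x].
Proof.
move=> bd Qex K e e0; have [p pP] := choice (fun k => let: ex_intro2 p a b := Qex k in
  ex_intro (fun p => Q p /\ k%:R <= phi p ord0 ord0) p (conj a b)).
pose b k := poincare_ball (phi (p k)).
have bK k : closed_ball_ Num.norm 0 (1 : R) (b k).
  rewrite /closed_ball_ /= sub0r normrN; apply: norm_le_dot => //.
  rewrite poincare_dot expr1n lerBlDr lerDl; have := phi0_gt0 H (p k).
  by move=> h; rewrite divr_ge0 //; lra.
have [y [_ ycl]] : closed_ball_ Num.norm 0 (1 : R) `&` cluster (b @ \oo) !=set0.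
  by apply: (compact_normball (F := b @ \oo)); exists 0%N => // k _ /=; exact: bK.
have ch k : exists j, (k <= j)%N /\ `|y - b j| < k.+1%:R^-1.
  have [z [[j kj jE] yb]] : [set z | exists2 j, (k <= j)%N & b j = z] `&`
      ball y k.+1%:R^-1 !=set0.
    apply: ycl; last by apply: nbhsx_ballx; rewrite invr_gt0.
    by exists k => // j /= kj; exists j.
  by exists j; split=> //; rewrite jE; move: yb; rewrite -ball_normE.
have [j jP] := choice ch.
have lim : (fun k => b (j k)) @ \oo --> y.
  apply: (@cvg_harmonic_bound _ _ _ 1) => k; rewrite mul1r; apply: ltW.
  by have [] := jP k.
have big k : k%:R <= phi (p (j k)) ord0 ord0.
  apply: le_trans (pP (j k)).2; rewrite ler_nat; by have [] := jP k.
have y1 : dot y y = 1.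
  have l1 : (fun k => dot (b (j k)) (b (j k))) @ \oo --> dot y y by exact: cvg_dot.
  have l2 : (fun k => dot (b (j k)) (b (j k))) @ \oo --> (1 : R).
    apply: (@cvg_harmonic_bound R _ _ 2) => k.
    have k0 : 0 < (1 + k%:R : R) by rewrite ltr_pwDl.
    have kb : (1 + k%:R : R) <= 1 + phi (p (j k)) ord0 ord0 by rewrite lerD2l.
    rewrite poincare_dot opprB addrC subrK ger0_norm; last first.
      by apply: divr_ge0 => //; exact: le_trans (ltW k0) kb.
    rewrite -[k.+1%:R]nat1r; apply: ler_wpM2l => //.
    exact: inv_le.
  exact: (cvg_unique (@norm_hausdorff _ R^o) l1 l2).
have yx : y = x.
  have : boundary_at_infinity phi y.
    split; last by exists (p \o j).
    by rewrite /unit_sphere /= -y1; apply: eq_bigr => i _; rewrite expr2.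
  by rewrite bd.
have l3 : (fun k => dot (b (j k)) x) @ \oo --> (1 : R).
  have -> : (1 : R) = dot y x by rewrite -yx y1.
  by apply: cvg_dot; [exact: lim|exact: cvg_cst].
have nl : \forall k \near \oo, 1 - e < dot (b (j k)) x.
  by apply: (cvgr_gt (1 : R) l3); rewrite ltrBlDr ltrDl.
have [N _ NP] := nl.
exists (p (j (maxn N K))); split.
- exact: (pP _).1.
- by apply: le_trans (big _); rewrite ler_nat leq_maxr.
- by apply: NP => /=; exact: leq_maxl.
Qed.

Variables (x : 'rV[R]_n.+1) (fa fb : 'rV[R]_n.+2) (P : 'M[R]_(n.+2, n)).
Hypothesis fr : null_frame fa fb P.
Hypothesis faE : forall X, dot X fa = X ord0 ord0 - dot (spatial X) x.
Hypothesis fbE : forall X, dot X fb = (X ord0 ord0 + dot (spatial X) x) / 2.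

Local Notation hscale := (hscale phi eta fa).
Local Notation gmap := (gmap phi eta fa P).

Lemma hscale_le p : hscale p <= 4 * phi p ord0 ord0.
Proof.
have L0 : lorentz (psi phi eta p) (psi phi eta p) <= 0 by rewrite (lorentz_psi_psi H).
have [_] := nf_ge0 fr L0 (ltW (psi0_gt0 H p)).
have := psi0_lt H p; rewrite /hscale faE fbE; lra.
Qed.

(* [la, mu, pe] are the frame coordinates of a point with tangent null vector of
   coordinates [s, s * r / 2, s * Y]. *)
Lemma no_escape (la mu py pp s r : R) : 0 < mu -> mu < 1 -> 8 <= s ->
  - (la * r / 2) - mu + py + 1 / s >= 0 -> 0 <= la -> 0 <= r ->
  py ^+ 2 <= pp * r -> pp <= 2 * la * mu -> 1 / 2 < mu -> 32 * la * r < 1 -> False.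
Proof.
move=> mu0 mu1 s8 E la0 r0 cs ppE mu2 lar.
have s1 : 1 / s <= 1 / 8.
  by rewrite !div1r lef_pV2 // posrE; lra.
have lr0 : 0 <= la * r by apply: mulr_ge0.
have py1 : 3 / 8 <= py by lra.
have p1 : (3 / 8) ^+ 2 <= py ^+ 2.
  by rewrite ler_pXn2r // ?nnegrE; lra.
have p2 : pp * r <= 2 * la * mu * r by apply: ler_wpM2r.
have p3 : 2 * la * mu * r <= 2 * (la * r).
  have -> : 2 * la * mu * r = 2 * (la * r) * mu by ring.
  rewrite -[leRHS]mulr1; apply: ler_wpM2l; lra.
have : (3 / 8 : R) ^+ 2 = 9 / 64 by field.
lra.
Qed.

(** A large [hscale] makes the tangent horosphere small, so [phi p] is near its base point, which
    stays away from [x] while the Gauss image is bounded. But a large [hscale] also forces [phi p]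
    far out by [hscale_le], hence near [x]. *)
Lemma hscale_bounded (r : R) : boundary_at_infinity phi = [set x] -> 0 <= r ->
  exists C : R, forall p, 0 < hscale p -> dot (gmap p) (gmap p) <= r -> hscale p <= C.
Proof.
move=> bd r0; apply: contrapT => /forallNP noC.
have ex k : exists2 p, 8 <= hscale p /\ dot (gmap p) (gmap p) <= r &
    k%:R <= phi p ord0 ord0.
  (* The 8 is what [no_escape] asks of the scale; 4 k makes the height at least k by [hscale_le]. *)
  have /existsNP[p /not_implyP[s0 /not_implyP[gr /negP]]] := noC (8 + 4 * k%:R).
  rewrite -ltNge => sk; exists p.
    split=> //; apply: le_trans (ltW sk); by rewrite lerDl mulr_ge0.
  by have := hscale_le p; lra.
have e0 : 0 < Num.min (1 / 4) (1 / (64 * (r + 1))) :> R.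
  by rewrite lt_min !divr_gt0 //; lra.
have [p [[s8 gr] p4 pe]] := escape bd ex 4 e0.
set e := Num.min _ _ in e0 pe.
have e1 : e <= 1 / 4 by rewrite /e ge_min lexx.
have e2 : e <= 1 / (64 * (r + 1)) by rewrite /e ge_min lexx orbT.
have p0 := phi0_gt0 H p; have s0 : 0 < hscale p by lra.
set X0 := phi p ord0 ord0 in p0 p4 *.
(* Normalises the frame coordinates: as [phi p] approaches [x], [t * la] tends to 0 and [t * mu] to
   1. *)
pose t := (1 + X0)^-1.
have t0 : 0 < t by rewrite invr_gt0; lra.
have tX : t * (1 + X0) = 1 by rewrite mulVf // gt_eqF //; lra.
move: pe; rewrite poincare_spatial dotZl -/X0 -/t => pe.
have := lorentz_phi_psi H p; rewrite (nf_lorentz fr) (psi_mulmx P s0) (psi_fb H fr s0).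
rewrite -/(hscale p) dotZr => E.
have := lorentz_phi_phi H p; rewrite (nf_lorentz fr) => E2.
have cs := CauchySchwarz_dot (phi p *m P) (gmap p).
have la0 : 0 <= dot (phi p) fa.
  have L0 : lorentz (phi p) (phi p) <= 0 by rewrite (lorentz_phi_phi H); lra.
  by have [] := nf_ge0 fr L0 (ltW p0).
move: (faE (phi p)) (fbE (phi p)); rewrite -/X0 => Ea Eb.
set la := dot (phi p) fa in E E2 la0 Ea; set mu := dot (phi p) fb in E E2 Eb.
set py := dot (phi p *m P) (gmap p) in E cs.
set pp := dot (phi p *m P) (phi p *m P) in E2 cs.
set g2 := dot (gmap p) (gmap p) in gr E cs.
have g20 : 0 <= g2 by exact: dot_ge0.
set d := dot (spatial (phi p)) x in pe Ea Eb.
have tX0 : t * X0 = 1 - t by lra.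
have t1 : t <= 1 / 5 by rewrite div1r; apply: inv_le => //; lra.
have tla : t * la = 1 - t - t * d by rewrite Ea mulrBr tX0.
have tmu : t * mu = (1 - t + t * d) / 2 by rewrite Eb mulrA mulrDr tX0.
have tla0 : 0 <= t * la by apply: mulr_ge0 => //; exact: ltW.
have er : 32 * e * r < 1.
  have h : e * (64 * (r + 1)) <= 1 by rewrite -ler_pdivlMr //; lra.
  have : e * (64 * (r + 1)) = 2 * (32 * e * r) + 64 * e by ring.
  lra.
have tlag : 32 * (t * la) * g2 <= 32 * e * r.
  by apply: ler_pM => //; [lra|lra].
apply: (@no_escape (t * la) (t * mu) (t * py) (t ^+ 2 * pp) (hscale p) g2) => //.
- lra.
- lra.
- have sE : - (t * la * g2 / 2) - t * mu + t * py = - (t / hscale p).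
    have -> : - (t * la * g2 / 2) - t * mu + t * py =
        t / hscale p * (- (la * (hscale p * g2 / 2)) - mu * hscale p + hscale p * py).
      by field; rewrite gt_eqF.
    by rewrite E mulrN1.
  rewrite sE div1r addrC -[X in X - _]mul1r -mulrBl.
  apply: mulr_ge0; [lra|by rewrite invr_ge0 ltW].
- have -> : t ^+ 2 * pp * g2 = t ^+ 2 * (pp * g2) by ring.
  by rewrite exprMn; apply: ler_wpM2l => //; exact: sqr_ge0.
- have -> : 2 * (t * la) * (t * mu) = t ^+ 2 * (2 * la * mu) by ring.
  by apply: ler_wpM2l; [exact: sqr_ge0|lra].
- lra.
- lra.
Qed.

End Boundary.

(** * The global section *)

Section Lifts.
Context {R : realType} {n : nat} {M : smoothManifold R n}.
Implicit Types (p q : M) (y z v : 'rV[R]_n).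
Variables (phi eta : M -> 'rV[R]_n.+2) (kappa : M -> 'I_n -> R) (a1 a2 : R).
Hypothesis H : pinched phi eta kappa a1 a2.
Variables (fa fb : 'rV[R]_n.+2) (P : 'M[R]_(n.+2, n)).
Hypothesis fr : null_frame fa fb P.

Local Notation hscale := (hscale phi eta fa).
Local Notation gmap := (gmap phi eta fa P).
Local Notation csection := (csection phi eta fa P).

(** Local injectivity of the Gauss map makes the set of agreement open, and the Hausdorff property
    makes it closed. *)
Lemma lift_unique (c1 c2 : R -> M) :
  (forall t, 0 <= t <= 1 -> {for t, continuous c1}) ->
  (forall t, 0 <= t <= 1 -> {for t, continuous c2}) ->
  (forall t, 0 <= t <= 1 -> 0 < hscale (c1 t)) ->
  (forall t, 0 <= t <= 1 -> gmap (c1 t) = gmap (c2 t)) ->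
  c1 0 = c2 0 -> c1 1 = c2 1.
Proof.
move=> c1c c2c s0 gE c0.
suff : forall t, 0 <= t <= 1 -> c1 t = c2 t by apply; rewrite ler01 lexx.
apply: real_induction => // t.
- move=> t0 t1 Et; have t01 : 0 <= t <= 1 by rewrite t0 ltW.
  have ct : c1 t = c2 t by apply: Et; rewrite t0 lexx.
  have [U U1 Uinj] := gmap_locally_inj H fr (s0 t t01).
  have U2 : nbhs (c2 t) U by rewrite -ct.
  have /nbhs_ballP[d /= d0 dP] : \forall s \near t, U (c1 s) /\ U (c2 s).
    by apply: filterI; [exact: (c1c t t01 _ U1)|exact: (c2c t t01 _ U2)].
  exists (Num.min d (1 - t)); first by rewrite lt_min d0 subr_gt0.
  move=> s /andP[ts]; rewrite -ltrBlDl lt_min => /andP[sd s1].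
  have [|Us1 Us2] := dP s.
    by rewrite -ball_normE /= distrC ger0_norm //; lra.
  by apply: Uinj => //; apply: gE; apply/andP; split; lra.
- move=> t0 t1 Et; have t01 : 0 <= t <= 1 by rewrite t1 ltW.
  have lim (c : R -> M) : {for t, continuous c} -> c s @[s --> t^'-] --> c t.
    by move=> cc; apply: cvg_within_filter; exact: cc.
  have l2 := lim c2 (c2c t t01).
  apply: (cvg_unique (@manifold_hausdorff _ _ M) _ l2).
  apply: cvg_trans (lim c1 (c1c t t01)); apply: near_eq_cvg.
  near=> s; apply: Et; apply/andP; split; near: s; last exact: nbhs_left_lt.
  exact: nbhs_left_ge.
Unshelve. all: by end_near. Qed.

Lemma segment_continuous y z : continuous (fun t : R => y + t *: (z - y)).
Proof.
move=> t; apply: differentiable_continuous; apply/derivable1_diffP.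
by have [] := is_derive_affine y (z - y) t.
Qed.

Lemma csection_agree Om1 s1 Om2 s2 y z : csection Om1 s1 -> csection Om2 s2 ->
  (forall t, 0 <= t <= 1 -> Om1 (y + t *: (z - y)) /\ Om2 (y + t *: (z - y))) ->
  s1 y = s2 y -> s1 z = s2 z.
Proof.
move=> S1 S2 seg E; have [_ h1] := S1; have [_ h2] := S2; pose x (t : R) := y + t *: (z - y).
have x0 : x 0 = y by rewrite /x scale0r addr0.
have x1 : x 1 = z by rewrite /x scale1r addrC subrK.
have cc Om s t : csection Om s -> Om (x t) -> {for t, continuous (s \o x)}.
  move=> hs /hs.2[sc _ _]; apply: continuous_comp; last exact: sc.
  exact: segment_continuous.
have := @lift_unique (s1 \o x) (s2 \o x); rewrite /= x0 x1; apply=> // t t01.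
- by apply: (cc Om1) => //; exact: (seg t t01).1.
- by apply: (cc Om2) => //; exact: (seg t t01).2.
- by have [] := h1 _ (seg t t01).1.
- by have [_ _ ->] := h1 _ (seg t t01).1; have [_ _ ->] := h2 _ (seg t t01).2.
Qed.

(** Curves must be C^1 on the whole line although a section may exist only along a segment; this
    reparametrisation maps all of R into [0, 1]. Its derivative is at most pi / 2 < 2, whence the
    factor 2 in the distance estimates. *)
Definition smoothstep (t : R) : R := (1 - cos (pi * t)) / 2.

Lemma smoothstep01 t : 0 <= smoothstep t <= 1.
Proof.
have h1 := cos_le1 (pi * t); have h2 := cos_geN1 (pi * t).
by rewrite /smoothstep; apply/andP; split; lra.
Qed.

Lemma is_derive_smoothstep (t : R) :
  is_derive t (1 : R) smoothstep (pi / 2 * sin (pi * t)).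
Proof.
have D1 : is_derive t (1 : R) (fun s : R => pi * s) (pi : R).
  have := is_deriveMf (@is_derive_cst _ _ _ (pi : R) t (1 : R)) (@is_derive_id R R t 1).
  by rewrite mul0r add0r mulr1.
have D2 := is_derive1_comp (is_derive_cos (pi * t)) D1.
have D3 := is_deriveB (@is_derive_cst _ _ _ (1 : R) t (1 : R)) D2.
have D4 := is_deriveMf D3 (@is_derive_cst _ _ _ (2^-1 : R) t (1 : R)).
apply: is_derive_eq D4 _; rewrite /cst /=; ring.
Qed.

Lemma csection_segment_dist Om sg y z (C N : R) : csection Om sg ->
  (forall t, 0 <= t <= 1 -> Om (y + t *: (z - y))) ->
  (forall t, 0 <= t <= 1 -> hscale (sg (y + t *: (z - y))) <= C) ->
  0 <= N -> dot (z - y) (z - y) <= N ^+ 2 ->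
  (induced_dist phi (sg y) (sg z) <= (2 * C * N / a1)%:E)%E.
Proof.
move=> sO seg sC N0 yzN; pose x (t : R) := y + smoothstep t *: (z - y).
have x0 : x 0 = y by rewrite /x /smoothstep mulr0 cos0 subrr mul0r scale0r addr0.
have x1 : x 1 = z.
  by rewrite /x /smoothstep mulr1 cospi opprK divff // scale1r addrC subrK.
have xD (t : R) : is_derive t (1 : R) x ((pi / 2 * sin (pi * t)) *: (z - y)).
  have D := is_deriveZf (is_derive_smoothstep t)
    (@is_derive_cst _ _ _ (z - y : 'rV[R]_n) t (1 : R)).
  have D2 := is_deriveD (@is_derive_cst _ _ _ (y : 'rV[R]_n) t (1 : R)) D.
  by apply: is_derive_eq D2 _; rewrite /cst /= scaler0 addr0 add0r.
have C0 : 0 <= C.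
  have t01 : 0 <= (0 : R) <= 1 by rewrite lexx ler01.
  by apply: le_trans (sC 0 t01); apply: (hscale_ge0 H fr).
have := @csection_dist _ _ _ _ _ _ _ _ H _ _ _ fr Om sg x (2 * C * N) sO.
rewrite x0 x1; apply.
- by move=> t; apply: seg; exact: smoothstep01.
- by move=> t; have [] := xD t.
- rewrite (_ : (fun t : R => _) = fun t : R => (pi / 2 * sin (pi * t)) *: (z - y)); last first.
    by rewrite funeqE => t; have [_ ->] := xD t.
  move=> t; apply: (@continuousZ _ _ _ (fun s : R => pi / 2 * sin (pi * s)) (cst (z - y)));
    last exact: cst_continuous.
  apply: continuousM; first exact: cst_continuous.
  apply: (@continuous_comp _ _ _ (fun t : R => pi * t) (@sin R)); last exact: continuous_sin.
  by apply: continuousM; [exact: cst_continuous|exact: cvg_id].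
- by rewrite !mulr_ge0.
- move=> t t01; have -> := @derive_val _ _ _ _ _ _ _ (xD t).
  rewrite dotZl dotZr.
  have s0 := hscale_ge0 H fr (sg (x t)); have sC' := sC _ (smoothstep01 t).
  have p1 : (pi / 2 * sin (pi * t)) ^+ 2 <= 2 ^+ 2.
    rewrite -[leLHS]real_normK ?num_real // ler_pXn2r ?nnegrE //.
    rewrite normrM ger0_norm; last by apply: divr_ge0 => //; exact: pi_ge0.
    rewrite -[leRHS]mulr1; apply: ler_pM => //.
    + by apply: divr_ge0 => //; exact: pi_ge0.
    + by apply: ltW; exact: pihalf_lt2.
    + exact: sin_max.
  have s2 : hscale (sg (x t)) ^+ 2 <= C ^+ 2 by rewrite ler_pXn2r ?nnegrE.
  have -> : (2 * C * N) ^+ 2 = C ^+ 2 * (2 ^+ 2 * N ^+ 2) by ring.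
  apply: ler_pM => //; first exact: sqr_ge0.
    by rewrite mulrA -expr2 mulr_ge0 ?sqr_ge0 ?dot_ge0.
  by rewrite mulrA -expr2; apply: ler_pM; rewrite ?sqr_ge0 ?dot_ge0.
Qed.

End Lifts.

(** * Limits of lifted rays *)

Section RayLimit.
Context {R : realType} {n : nat} {M : smoothManifold R n}.
Implicit Types (p q : M) (y z v : 'rV[R]_n).
Variables (phi eta : M -> 'rV[R]_n.+2) (kappa : M -> 'I_n -> R) (a1 a2 : R).
Hypothesis H : pinched phi eta kappa a1 a2.
Hypothesis a20 : 0 < a2.
Variables (fa fb : 'rV[R]_n.+2) (P : 'M[R]_(n.+2, n)).
Hypothesis fr : null_frame fa fb P.
Hypothesis complete : complete_hypersurface phi.

Local Notation psi := (psi phi eta).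
Local Notation hscale := (hscale phi eta fa).
Local Notation gmap := (gmap phi eta fa P).
Local Notation csection := (csection phi eta fa P).

(** |gmap|^2 is twice the [fb] coordinate of [psi] divided by [hscale], and the [fb] coordinate is
    positive at a pole. *)
Lemma pole_repels p (r : R) : hscale p = 0 ->
  \forall q \near p, 0 < hscale q -> r < dot (gmap q) (gmap q).
Proof.
move=> s0; have [_ t0] := hscale_eq0 H fr s0.
have sc := @hscale_continuous _ _ _ _ _ _ _ _ H fa p.
have tc : {for p, continuous (fun q => dot (psi q) fb)}.
  exact: (@hscale_continuous _ _ _ _ _ _ _ _ H fb p).
have rc : {for p, continuous (fun q => r / 2 * hscale q)}.
  by apply: (@continuousM _ _ (cst (r / 2)) hscale); [exact: cst_continuous|exact: sc].
have nt := near_lt2 rc tc.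
have lt0 : r / 2 * hscale p < dot (psi p) fb by rewrite s0 mulr0.
apply: filterS (nt lt0) => q qt sq; move: qt.
rewrite (psi_fb H fr sq).
rewrite -mulrA [_^-1 * _]mulrC mulrA [hscale q * _]mulrC => qt.
by move: qt; rewrite ltr_pM2r // ltr_pM2r.
Qed.

Lemma archi_lt (K e : R) : 0 <= K -> 0 < e -> exists N : nat, K / N.+1%:R < e.
Proof.
move=> K0 e0; exists (Num.bound (K / e)).
have := archi_boundP (divr_ge0 K0 (ltW e0)).
rewrite ltr_pdivrMr // => h; rewrite ltr_pdivrMr //; apply: lt_le_trans h _.
by rewrite mulrC ler_pM2l // ler_nat.
Qed.

(** With [hscale] bounded, points of the lift at times tending to [T] form a Cauchy sequence, which
    converges by completeness. The limit is not a pole because the Gauss image stays bounded. *)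
Lemma ray_limit Om sg y0 v (T C : R) : csection Om sg -> 0 < T ->
  (forall t, 0 <= t < T -> Om (y0 + t *: v)) ->
  (forall t, 0 <= t < T -> hscale (sg (y0 + t *: v)) <= C) ->
  exists p, [/\ 0 < hscale p, gmap p = y0 + T *: v &
    forall (U : set M) (d : R), nbhs p U -> 0 < d ->
      exists t, [/\ 0 <= t < T, T - d < t & U (sg (y0 + t *: v))]].
Proof.
move=> sec T0 seg sC.
pose tk k : R := T - T / k.+1%:R.
have Tk k : 0 < T / k.+1%:R by rewrite divr_gt0.
have Tle N k : (N <= k)%N -> T / k.+1%:R <= T / N.+1%:R.
  move=> Nk; apply: ler_wpM2l; first exact: ltW.
  by apply: inv_le; rewrite ?ltr0n ?ler_nat.
have tk01 k : 0 <= tk k < T.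
  have h1 : T / k.+1%:R <= T by rewrite -[leRHS]divr1; exact: (Tle 0%N).
  by rewrite /tk subr_ge0 h1 /= ltrBlDr ltrDl Tk.
(* A bound for the Euclidean length of [v] that avoids square roots. *)
pose L := 1 + dot v v.
have L1 : 1 <= L by rewrite /L lerDl dot_ge0.
have vL : dot v v <= L ^+ 2.
    have d0 := dot_ge0 v; have d2 := sqr_ge0 (dot v v).
    have -> : L ^+ 2 = 1 + 2 * dot v v + dot v v ^+ 2 by rewrite /L; ring.
    lra.
have C0 : 0 <= C by apply: le_trans (sC _ (tk01 0%N)); exact: (hscale_ge0 H fr).
pose u k := sg (y0 + tk k *: v).
have a10 := pc_gt0 H.
have dist N i j : (N <= i)%N -> (N <= j)%N ->
    (induced_dist phi (u i) (u j) <= (2 * C * (T / N.+1%:R * L) / a1)%:E)%E.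
  move=> Ni Nj.
  have E : (y0 + tk j *: v) - (y0 + tk i *: v) = (tk j - tk i) *: v.
    by rewrite [RHS]scalerBl opprD addrACA subrr add0r.
  have ptE t : y0 + tk i *: v + t *: (y0 + tk j *: v - (y0 + tk i *: v)) =
      y0 + (tk i + t * (tk j - tk i)) *: v.
    by rewrite E scalerA -addrA -scalerDl.
  have pt t : 0 <= t <= 1 -> 0 <= tk i + t * (tk j - tk i) < T.
    move=> /andP[t0 t1]; have /andP[i0 iT] := tk01 i; have /andP[j0 jT] := tk01 j.
    have -> : tk i + t * (tk j - tk i) = (1 - t) * tk i + t * tk j by ring.
    have h1 : 0 <= (1 - t) * tk i by apply: mulr_ge0 => //; lra.
    have h2 : 0 <= t * tk j by apply: mulr_ge0.
    have m : Num.max (tk i) (tk j) < T by rewrite gt_max iT jT.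
    have mi : tk i <= Num.max (tk i) (tk j) by rewrite le_max lexx.
    have mj : tk j <= Num.max (tk i) (tk j) by rewrite le_max lexx orbT.
    have h3 : (1 - t) * tk i <= (1 - t) * Num.max (tk i) (tk j).
      by apply: ler_wpM2l => //; lra.
    have h4 : t * tk j <= t * Num.max (tk i) (tk j) by apply: ler_wpM2l.
    apply/andP; split; first lra.
    apply: le_lt_trans m; move: h3 h4; set m := Num.max _ _ => h3 h4.
    have : m = (1 - t) * m + t * m by ring.
    lra.
  apply: (csection_segment_dist H fr sec).
  - by move=> t /pt; rewrite ptE; exact: seg.
  - by move=> t /pt; rewrite ptE; exact: sC.
  - by apply: mulr_ge0; [exact: ltW|lra].
  - rewrite E dotZl dotZr mulrA -expr2 exprMn; apply: ler_pM => //.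
    + exact: sqr_ge0.
    + exact: dot_ge0.
    + rewrite -[leLHS]real_normK ?num_real // ler_pXn2r ?nnegrE //; last exact: ltW.
      have := Tle N i Ni; have := Tle N j Nj; have := Tk i; have := Tk j.
      rewrite /tk; move: (T / i.+1%:R) (T / j.+1%:R) (T / N.+1%:R) => wi wj wN h1 h2 h3 h4.
      rewrite ler_norml; apply/andP; split; lra.
have cauchy : exists p, forall U, nbhs p U -> exists N : nat, forall i, (N <= i)%N -> U (u i).
  have [|p pP] := complete (u := u).
    move=> e e0; have K0 : 0 <= 2 * C * T * L / a1.
      by rewrite divr_ge0 ?mulr_ge0 //; [exact: ltW|lra|exact: ltW].
    have [N NP] := archi_lt K0 e0; exists N => i j Ni Nj.
    apply: le_lt_trans (dist N i j Ni Nj) _; rewrite lte_fin.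
    by move: NP; congr (_ < _); field; rewrite gt_eqF //= pnatr_eq0.
  exists p => U pU; have [e e0 eP] := near_of_dist H a20 fr pU.
  have [N NP] := pP e e0; exists N => i Ni; exact: eP (NP i Ni).
have [p pP] := cauchy.
have gu k : gmap (u k) = y0 + tk k *: v.
  by have [_ _] := sec.2 _ (seg _ (tk01 k)).
have su k : 0 < hscale (u k) by have [_] := sec.2 _ (seg _ (tk01 k)).
have s0 : 0 < hscale p.
  rewrite lt_def (hscale_ge0 H fr) andbT; apply/eqP => /pole_repels.
  move=> /(_ (2 * dot y0 y0 + 2 * (T ^+ 2 * dot v v))) /pP [N] /(_ N (leqnn N)) /(_ (su N)).
  rewrite gu ltNge => /negP; apply.
  have := dot_ge0 (y0 - tk N *: v); rewrite !dotE (dotC v y0) => h.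
  have /andP[t0 tT] := tk01 N.
  have : tk N ^+ 2 * dot v v <= T ^+ 2 * dot v v.
    apply: ler_wpM2r; first exact: dot_ge0.
    by rewrite ler_pXn2r ?nnegrE // ltW.
  lra.
exists p; split=> //.
  have l1 : (fun k => gmap (u k)) @ \oo --> gmap p.
    apply: (@cvg_comp _ _ _ u gmap \oo (nbhs p)); last by apply: gmap_continuous s0; exact: H.
    by move=> U /pP[N NP]; exists N.
  have l2 : (fun k => gmap (u k)) @ \oo --> y0 + T *: v.
    apply: (@cvg_harmonic_bound _ _ _ _ (T * `|v|)) => k.
    rewrite gu opprD addrACA subrr add0r -scalerBl /tk opprB addrC subrK normrZ.
    by rewrite ger0_norm ?(ltW (Tk k)) // mulrAC.
  exact: (cvg_unique (@norm_hausdorff _ _) l1 l2).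
move=> U d pU d0; have [N NP] := pP U pU.
have [N' N'P] := archi_lt (ltW T0) d0.
exists (tk (maxn N N')); split=> //; last by apply: NP; exact: leq_maxl.
have := Tle N' (maxn N N') (leq_maxr _ _); rewrite /tk.
by move: (T / (maxn _ _).+1%:R) (T / N'.+1%:R) N'P => w w' h1 h2; lra.
Qed.

End RayLimit.

(** * The maximal star-shaped section *)

Section GlobalSection.
Context {R : realType} {n : nat} {M : smoothManifold R n}.
Implicit Types (p q : M) (y z v : 'rV[R]_n) (Om : set 'rV[R]_n) (sg : 'rV[R]_n -> M).
Variables (phi eta : M -> 'rV[R]_n.+2) (kappa : M -> 'I_n -> R) (a1 a2 : R).
Hypothesis H : pinched phi eta kappa a1 a2.
Hypothesis a20 : 0 < a2.
Variables (fa fb : 'rV[R]_n.+2) (P : 'M[R]_(n.+2, n)).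
Hypothesis fr : null_frame fa fb P.
Hypothesis complete : complete_hypersurface phi.

Local Notation hscale := (hscale phi eta fa).
Local Notation gmap := (gmap phi eta fa P).
Local Notation csection := (csection phi eta fa P).

Hypothesis bounded : forall r, 0 <= r -> exists C : R,
  forall p, 0 < hscale p -> dot (gmap p) (gmap p) <= r -> hscale p <= C.

(** Two sections over domains star-shaped about the same centre agree on the whole intersection, by
    uniqueness of lifts along segments from the centre; therefore all of them glue together. *)
Definition star y0 Om := forall y t, Om y -> 0 <= t <= 1 -> Om (y0 + t *: (y - y0)).

Definition star_section p0 Om sg :=
  [/\ csection Om sg, star (gmap p0) Om, Om (gmap p0) & sg (gmap p0) = p0].

Lemma star_section_agree p0 Om1 s1 Om2 s2 y : star_section p0 Om1 s1 ->
  star_section p0 Om2 s2 -> Om1 y -> Om2 y -> s1 y = s2 y.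
Proof.
move=> [c1 st1 _ e1] [c2 st2 _ e2] y1 y2.
apply: (csection_agree H fr c1 c2 (y := gmap p0)); last by rewrite e1 e2.
by move=> t t01; split; [exact: st1|exact: st2].
Qed.

Definition star_domain p0 : set 'rV[R]_n :=
  [set y | exists Om sg, star_section p0 Om sg /\ Om y].

Lemma star_section_exists p0 : 0 < hscale p0 -> star_domain p0 (gmap p0).
Proof.
move=> s0; have [r [sg [r0 sec nearP]]] := near_section H fr s0.
have [b0 sE] := nbhs_singleton nearP.
exists (ball (gmap p0) r), sg; split=> //; split=> // y t.
rewrite -ball_normE /= => yr /andP[t0 t1].
rewrite opprD addrA subrr add0r normrN normrZ ger0_norm //.
by rewrite distrC; apply: le_lt_trans yr; rewrite ler_piMl.
Qed.

Lemma max_star_section p0 : 0 < hscale p0 -> exists sg, star_section p0 (star_domain p0) sg.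
Proof.
move=> s0; have [E EP] : exists E : 'rV[R]_n -> M, forall y, star_domain p0 y ->
    exists Om sg, [/\ star_section p0 Om sg, Om y & E y = sg y].
  have ch y : exists q, star_domain p0 y ->
      exists Om sg, [/\ star_section p0 Om sg, Om y & q = sg y].
    have [[Om [sg [h Oy]]]|no] := pselect (star_domain p0 y); last by exists p0.
    by exists (sg y) => _; exists Om, sg.
  by have [E EP] := choice ch; exists E.
have Eeq Om sg y : star_section p0 Om sg -> Om y -> E y = sg y.
  move=> h Oy; have [|Om' [sg' [h' O'y ->]]] := EP y; first by exists Om, sg.
  exact: star_section_agree h' h O'y Oy.
have star0 := star_section_exists s0.
exists E; split=> //.
- split.
    rewrite openE => y [Om [sg [h Oy]]]; have [[Oo _] _ _ _] := h.
    apply: (@filterS _ _ _ Om); last by apply: open_nbhs_nbhs.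
    by move=> z Oz; exists Om, sg.
  move=> y [Om [sg [h Oy]]]; have [[Oo OP] _ _ _] := h.
  have [sc sy gy] := OP y Oy; rewrite (Eeq _ _ _ h Oy); split=> //.
  apply: (near_eq_continuous _ sc).
  have : \forall z \near y, Om z by apply: open_nbhs_nbhs.
  by apply: filterS => z; exact: Eeq h.
- move=> y t [Om [sg [h Oy]]] t01; exists Om, sg; split=> //.
  by have [_ st _ _] := h; exact: st.
- have [Om [sg [h Oy]]] := star0; rewrite (Eeq _ _ _ h Oy).
  by have [_ _ _] := h.
Qed.

Lemma line_dot_le y0 v (t T : R) : 0 <= t <= T ->
  dot (y0 + t *: v) (y0 + t *: v) <= 2 * dot y0 y0 + 2 * (T ^+ 2 * dot v v).
Proof.
move=> /andP[t0 tT]; have := dot_ge0 (y0 - t *: v); rewrite !dotE (dotC v y0) => h.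
have : t ^+ 2 * dot v v <= T ^+ 2 * dot v v.
  apply: ler_wpM2r; first exact: dot_ge0.
  by rewrite ler_pXn2r ?nnegrE //; exact: le_trans tT.
lra.
Qed.

Lemma segment_cone y0 w z (m t : R) : z = y0 + m *: (w - y0) ->
  w + t *: (z - w) = y0 + (1 + t * (m - 1)) *: (w - y0).
Proof. by move=> ->; apply/rowP => i; rewrite !mxE; ring. Qed.

(** The images of the ball around [w0] under dilations of centre [y0] and ratio strictly between 1
    and [l]. As a union of preimages of the ball it is open. *)
Definition cone y0 w0 (e l : R) : set 'rV[R]_n :=
  [set z | exists2 m : R, 1 < m < l & ball w0 e (y0 + m^-1 *: (z - y0))].

Lemma cone_open y0 w0 e l : open (cone y0 w0 e l).
Proof.
have -> : cone y0 w0 e l = \bigcup_(m in [set m | 1 < m < l])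
    (fun z : 'rV[R]_n => y0 + m^-1 *: (z - y0)) @^-1` ball w0 e.
  by apply/seteqP; split=> z [m mP mb]; exists m.
apply: bigcup_open => m _; apply: open_comp; last exact: ball_open.
move=> z _; apply: (@continuousD _ _ _ (cst y0) (fun z : 'rV[R]_n => m^-1 *: (z - y0))).
  exact: cst_continuous.
apply: (@continuousZr _ _ _ (fun z : 'rV[R]_n => z - y0)).
by apply: (@continuousB _ _ _ id (cst y0)); [exact: cvg_id|exact: cst_continuous].
Qed.

(* Glues a section given near a boundary point [zT] of a star-shaped domain along
   the cone over a small ball of the domain seen from the centre. *)
Lemma star_section_extend p0 Om sg s1 (w0 zT : 'rV[R]_n) (e l r : R) :
  star_section p0 Om sg -> csection (ball zT r) s1 ->
  ball w0 e `<=` Om -> (forall w, ball w0 e w -> sg w = s1 w) ->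
  (forall w m, ball w0 e w -> 1 <= m < l -> ball zT r (gmap p0 + m *: (w - gmap p0))) ->
  cone (gmap p0) w0 e l `<=` star_domain p0.
Proof.
set y0 := gmap p0; move=> secO sec1 sub agree inb.
have [cO st O0 sg0] := secO; rewrite -/y0 in st O0 sg0.
set C := cone y0 w0 e l.
have Co : open C by exact: cone_open.
have Cpt z m : 1 < m -> z = y0 + m *: ((y0 + m^-1 *: (z - y0)) - y0).
  move=> m1; rewrite [y0 + _ - y0]addrC addKr scalerA mulfV ?scale1r; last first.
    by rewrite gt_eqF // (lt_trans ltr01).
  by rewrite addrC subrK.
have CB z : C z -> ball zT r z.
  move=> [m /andP[m1 ml] wb]; rewrite (Cpt z m m1); apply: inb => //.
  by rewrite (ltW m1).
(* From the point [w] of the small ball, where the sections agree, to [z] on the same ray, the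
   segment lies in both domains. *)
have agC z : C z -> Om z -> sg z = s1 z.
  move=> [m /andP[m1 ml] wb] Oz; set w := y0 + _ in wb.
  apply: (csection_agree H fr cO sec1 (y := w)); last exact: agree.
  move=> t /andP[t0 t1].
  have m0 : m != 0 by rewrite gt_eqF // (lt_trans ltr01).
  have tm0 : 0 <= t * (m - 1) by apply: mulr_ge0 => //; lra.
  have tm1 : t * (m - 1) <= m - 1 by apply: ler_piMl => //; lra.
  have E1 : w + t *: (z - w) = y0 + (1 + t * (m - 1)) *: (w - y0).
    exact: segment_cone (Cpt z m m1).
  have E2 : w + t *: (z - w) = y0 + ((1 + t * (m - 1)) / m) *: (z - y0).
    rewrite E1 [in RHS](Cpt z m m1) -/w; congr (_ + _).
    by rewrite [y0 + _ - y0]addrC addKr scalerA divfK.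
  split; last by rewrite E1; apply: inb => //; apply/andP; split; lra.
  rewrite E2; apply: st => //; apply/andP; split.
    by apply: divr_ge0; lra.
  by rewrite ler_pdivrMr; lra.
pose s' z := if pselect (Om z) then sg z else s1 z.
have s'O z : Om z -> s' z = sg z by rewrite /s'; case: pselect.
have s'C z : C z -> s' z = s1 z.
  by move=> Cz; rewrite /s'; case: pselect => // Oz; exact: agC.
have Oo : open Om by case: cO.
move=> z Cz; exists (Om `|` C), s'; split; last by right.
split.
- split; first exact: openU.
  move=> x [Ox|Cx].
    have [sc sx gx] := cO.2 _ Ox; rewrite (s'O x Ox); split=> //.
    apply: (near_eq_continuous _ sc).
    have : \forall u \near x, Om u by apply: open_nbhs_nbhs.
    by apply: filterS => u; exact: s'O.
  have [sc sx gx] := sec1.2 _ (CB x Cx); rewrite (s'C x Cx); split=> //.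
  apply: (near_eq_continuous _ sc).
  have : \forall u \near x, C u by apply: open_nbhs_nbhs.
  by apply: filterS => u; exact: s'C.
- move=> x t [Ox|[m /andP[m1 ml] wb]] /andP[t0 t1].
    by left; apply: st => //; rewrite t0.
  have m0 : 0 < m by rewrite (lt_trans ltr01).
  have E : y0 + t *: (x - y0) = y0 + (t * m) *: ((y0 + m^-1 *: (x - y0)) - y0).
    by rewrite [y0 + _ - y0]addrC addKr scalerA mulfK // gt_eqF.
  have [tm1|tm1] := leP (t * m) 1.
    left; rewrite E; apply: st; first exact: sub.
    by rewrite tm1 mulr_ge0 // ltW.
  right; exists (t * m).
    by rewrite tm1 /=; apply: le_lt_trans ml; rewrite ler_piMl // ltW.
  rewrite E [X in X - y0]addrC addrK scalerA mulVf ?scale1r; last first.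
    by rewrite gt_eqF // (lt_trans ltr01).
  by rewrite [X in y0 + X]addrC addKr.
- by left.
- by rewrite s'O.
Qed.

(** The ratio bound is such that m t runs from t to 2 T - t, symmetrically about T; so the dilated
    centre stays within T - t of the end of the ray. *)
Lemma cone_ball y0 w v (t T m d r e l : R) : 0 <= T - t -> 1 <= m < l ->
  l * t = 2 * T - t -> 0 < t -> T - t <= d -> d * `|v| <= r / 2 -> l * e <= r / 2 ->
  ball (y0 + t *: v) e w -> ball (y0 + T *: v) r (y0 + m *: (w - y0)).
Proof.
move=> tT /andP[m1 ml] lt t0 Td dv le; rewrite -!ball_normE /= => wb.
have l0 : 0 < l by apply: lt_trans ml; apply: lt_le_trans m1.
have -> : y0 + T *: v - (y0 + m *: (w - y0)) =
    (T - m * t) *: v + m *: (y0 + t *: v - w).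
  by apply/rowP => i; rewrite !mxE; ring.
apply: le_lt_trans (ler_normD _ _) _; rewrite !normrZ.
have h1 : `|T - m * t| * `|v| <= r / 2.
  apply: le_trans dv; apply: ler_wpM2r => //; apply: le_trans Td.
  have : t <= m * t by rewrite ler_peMl // ltW.
  have : m * t <= l * t by rewrite ler_pM2r // ltW.
  by rewrite lt ler_norml => h h'; apply/andP; split; lra.
have h2 : `|m| * `|y0 + t *: v - w| < r / 2.
  apply: lt_le_trans le; rewrite ger0_norm; last by rewrite (le_trans ler01).
  apply: (@le_lt_trans _ _ (l * `|y0 + t *: v - w|)).
    by apply: ler_wpM2r => //; exact: ltW.
  by rewrite ltr_pM2l.
by rewrite [ltRHS](splitr r) ler_ltD.
Qed.

(** Induction along the ray. At a limit time [T] the lift converges to some [p]; a section near [p]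
    agrees with the maximal one on a small ball around an earlier point of the ray, and gluing along
    the cone over that ball reaches the end point. *)
Lemma star_domain_ray p0 v : 0 < hscale p0 ->
  forall t : R, 0 <= t <= 1 -> star_domain p0 (gmap p0 + t *: v).
Proof.
move=> s0; have [E secE] := max_star_section s0.
have [cE st O0 E0] := secE; set y0 := gmap p0 in st O0 E0 *.
apply: real_induction; first by rewrite scale0r addr0.
- move=> t t0 _ Ot; have O1 : star_domain p0 (y0 + t *: v) by apply: Ot; rewrite t0 lexx.
  have xc : {for t, continuous (fun s : R => y0 + s *: v)}.
    apply: differentiable_continuous; apply/derivable1_diffP.
    by have [] := is_derive_affine y0 v t.
  have /nbhs_ballP[d /= d0 dP] : \forall s \near t, star_domain p0 (y0 + s *: v).
    by apply: xc; apply: open_nbhs_nbhs; split=> //; case: cE.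
  exists d => // s /andP[ts sd]; apply: dP; rewrite -ball_normE /=.
  by rewrite distrC ger0_norm; lra.
- move=> T T0 _ OT.
  have r0 : 0 <= 2 * dot y0 y0 + 2 * (T ^+ 2 * dot v v).
    have := dot_ge0 y0; have := mulr_ge0 (sqr_ge0 T) (dot_ge0 v); lra.
  have [C CP] := bounded r0.
  have sC t : 0 <= t < T -> hscale (E (y0 + t *: v)) <= C.
    move=> tT; have [_ Es Eg] := cE.2 _ (OT t tT); apply: CP => //.
    rewrite Eg; apply: line_dot_le; case/andP: tT => -> h /=; exact: ltW.
  have [p [sp gp pP]] := ray_limit H a20 fr complete cE T0 OT sC.
  have [r [s1 [rr sec1 nearP]]] := near_section H fr sp.
  rewrite gp in sec1 nearP.
  have v0 : 0 < `|v| + 1 by rewrite ltr_pwDr.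
  pose d := Num.min (T / 2) (r / 2 / (`|v| + 1)).
  have d0 : 0 < d by rewrite lt_min !divr_gt0.
  have [t [tT td [b0 sE]]] := pP _ _ nearP d0.
  have [_ Es Eg] := cE.2 _ (OT t tT); rewrite Eg in b0 sE.
  set w0 := y0 + t *: v in b0 sE Eg Es.
  have dT : d <= T / 2 by rewrite ge_min lexx.
  have dr : d * `|v| <= r / 2.
    apply: (@le_trans _ _ (d * (`|v| + 1))).
      by rewrite ler_pM2l // lerDl.
    by rewrite -ler_pdivlMr // ge_min lexx orbT.
  have t0 : 0 < t by lra.
  have tT' : t < T by case/andP: tT.
  pose l := (2 * T - t) / t.
  have lt : l * t = 2 * T - t by rewrite /l mulfVK // gt_eqF.
  have l0 : 0 < l by rewrite divr_gt0 //; lra.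
  have [s1c _ _] := sec1.2 w0 b0.
  have nw : \forall w \near w0, star_domain p0 w /\ E w = s1 w.
    have O0w : star_domain p0 (gmap (E w0)) by rewrite Eg; exact: OT.
    have Ew : E (gmap (E w0)) = E w0 by rewrite Eg.
    have n1 : \forall w \near w0, star_domain p0 (gmap (s1 w)) /\ E (gmap (s1 w)) = s1 w.
      have nq := near_csection H fr cE O0w Ew; rewrite -sE in nq.
      exact: (s1c _ nq).
    have n2 : \forall w \near w0, ball (y0 + T *: v) r w.
      by apply: open_nbhs_nbhs; split=> //; exact: ball_open.
    by apply: filterS (filterI n1 n2) => w [h /(sec1.2 w)[_ _ gw]]; move: h; rewrite gw.
  have /nbhs_ballP[e1 /= e10 e1P] := nw.
  pose e := Num.min e1 (r / 2 / l).
  have e0 : 0 < e by rewrite lt_min e10 /=; apply: divr_gt0 l0; exact: divr_gt0.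
  have le : l * e <= r / 2 by rewrite mulrC -ler_pdivlMr // ge_min lexx orbT.
  have ee1 : e <= e1 by rewrite ge_min lexx.
  apply: (@star_section_extend p0 (star_domain p0) E s1 w0 (y0 + T *: v) e l r) => //.
  + by move=> w /(le_ball ee1) /e1P[].
  + by move=> w /(le_ball ee1) /e1P[].
  + move=> w m wb ml; apply: (cone_ball (d := d) _ ml lt t0 _ dr le wb); lra.
  (* The end of the ray is the dilation of [w0] by T / t, which lies strictly between 1 and l = 2 T
     / t - 1. *)
  + exists (T / t).
      by rewrite ltr_pdivlMr // mul1r tT' /l ltr_pM2r ?invr_gt0 //; lra.
    rewrite addrAC subrr add0r scalerA invf_div mulfVK ?gt_eqF //.
    exact: ballxx.
Qed.

Lemma global_section p0 : 0 < hscale p0 ->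
  exists2 E, csection [set: 'rV[R]_n] E & E (gmap p0) = p0.
Proof.
move=> s0; have [E [cE _ _ E0]] := max_star_section s0; exists E => //.
apply: csection_sub cE _ _; first exact: openT.
move=> z _; have := @star_domain_ray p0 (z - gmap p0) s0 1.
by rewrite scale1r addrC subrK ler01 lexx; apply.
Qed.

End GlobalSection.

(** * Poles of the chart *)

Section AntipodalChart.
Context {R : realType} {n : nat}.
Implicit Types (y z v w : 'rV[R]_n).

(** Two linear conditions leave a nonzero vector in dimension at least 3; it is then stretched until
    long enough. *)
Lemma orth2 y z (C : R) : (2 < n)%N -> 0 < C ->
  exists w, [/\ dot w y = 0, dot w z = 0 & C < dot w w].
Proof.
move=> n3 C0; pose A : 'M[R]_(n, 1 + 1) := row_mx y^T z^T.
have : kermx A != 0.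
  rewrite -mxrank_eq0 mxrank_ker -lt0n subn_gt0.
  by apply: leq_ltn_trans n3; exact: rank_leq_col.
case/rowV0Pn => u /sub_kermxP uA u0.
move: uA; rewrite /A mul_mx_row => /eqP; rewrite row_mx_eq0 => /andP[/eqP uy /eqP uz].
have dE x : u *m x^T = 0 -> dot u x = 0.
  move=> /(congr1 (fun B : 'M[R]_1 => B ord0 ord0)); rewrite !mxE => h; rewrite -[RHS]h.
  by apply: eq_bigr => i _; rewrite !mxE.
have uu : 0 < dot u u by rewrite dot_gt0.
exists ((1 + C / dot u u) *: u).
have -> : dot ((1 + C / dot u u) *: u) ((1 + C / dot u u) *: u) =
    dot u u + C + (C + C ^+ 2 / dot u u).
  by rewrite dotZl dotZr; field; rewrite gt_eqF.
rewrite !dotZl (dE _ uy) (dE _ uz) !mulr0; split=> //.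
have := divr_gt0 (exprn_gt0 2 C0) uu; lra.
Qed.

(* The change of coordinates between the two horospherical charts. *)
Definition kinv y := (2 / dot y y) *: y.

Lemma dot_kinv y : y != 0 -> dot (kinv y) (kinv y) = 4 / dot y y.
Proof. by rewrite -dot_eq0 => y0; rewrite dotZl dotZr; field. Qed.

Lemma kinvK y : y != 0 -> kinv (kinv y) = y.
Proof.
move=> y0; have := y0; rewrite -dot_eq0 => d0.
rewrite {1}/kinv dot_kinv // /kinv scalerA -[RHS]scale1r; congr (_ *: _).
by field.
Qed.

Lemma kinv_neq0 y : y != 0 -> kinv y != 0.
Proof.
move=> y0; rewrite -dot_eq0 dot_kinv // mulf_neq0 ?invr_eq0 ?dot_eq0 //.
Qed.

Lemma kinv_continuous y : y != 0 -> {for y, continuous kinv}.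
Proof.
move=> y0; apply: continuousZ; last exact: cvg_id.
apply: continuousM; first exact: cst_continuous.
by apply: continuousV; [rewrite dot_eq0|exact: dotxx_continuous].
Qed.

Context {M : smoothManifold R n}.
Implicit Types (p q : M).
Variables (phi eta : M -> 'rV[R]_n.+2) (kappa : M -> 'I_n -> R) (a1 a2 : R).
Hypothesis H : pinched phi eta kappa a1 a2.
Variables (fa fb : 'rV[R]_n.+2) (P : 'M[R]_(n.+2, n)).
Hypothesis fr : null_frame fa fb P.

Lemma gmap_swap q : 0 < hscale phi eta fa q -> 0 < hscale phi eta fb q ->
  gmap phi eta fb P q = kinv (gmap phi eta fa P q).
Proof.
move=> sa sb; have := psi_fb H fr sa.
rewrite -/(hscale phi eta fb q) => E.
rewrite {1}/gmap (psi_mulmx P sa) /kinv scalerA; congr (_ *: _).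
have d0 : dot (gmap phi eta fa P q) (gmap phi eta fa P q) != 0.
  by apply/eqP => d0; move: sb; rewrite E d0 mulr0 mul0r ltxx.
by rewrite E; field; rewrite d0 gt_eqF.
Qed.

Lemma hscale_swap q : 0 < hscale phi eta fb q -> gmap phi eta fb P q != 0 ->
  0 < hscale phi eta fa q.
Proof.
move=> sb g0; have E := psi_fb H (null_frame_sym fr) sb.
by rewrite /hscale E divr_gt0 // mulr_gt0 // dot_gt0.
Qed.

Lemma gmap_eq0 f p : psi phi eta p *m P = 0 -> gmap phi eta f P p = 0.
Proof. by rewrite /gmap => ->; rewrite scaler0. Qed.

(** In the exchanged chart the pole is the regular point over the origin. The domain is a Euclidean
    ball so that [kinv] turns it into the exterior of a ball. *)
Lemma near_pole p : hscale phi eta fa p = 0 -> exists (d : R) s2,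
  [/\ 0 < d,
      csection phi eta fb P [set z : 'rV[R]_n | dot z z < d] s2,
      s2 0 = p
    & \forall q \near p, [/\ 0 < hscale phi eta fb q,
        dot (gmap phi eta fb P q) (gmap phi eta fb P q) < d &
        s2 (gmap phi eta fb P q) = q]].
Proof.
move=> s0; have [PP t0] := hscale_eq0 H fr s0.
have [r [s2 [r0 sec nearP]]] := near_section H (null_frame_sym fr) t0.
have g0 : gmap phi eta fb P p = 0 by rewrite /gmap PP scaler0.
rewrite g0 in sec nearP.
have dsub z : dot z z < (r / 2) ^+ 2 -> ball (0 : 'rV[R]_n) r z.
  move=> zd; rewrite -ball_normE /= sub0r normrN.
  have : `|z| <= r / 2 by apply: norm_le_dot; [lra|exact: ltW].
  lra.
have d0 : 0 < (r / 2) ^+ 2 by rewrite exprn_gt0 // divr_gt0.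
exists ((r / 2) ^+ 2), s2; split=> //.
- apply: csection_sub sec _ _; last by move=> z /dsub.
  rewrite (_ : [set z | _] = (fun z : 'rV[R]_n => dot z z) @^-1` [set t | t < (r / 2) ^+ 2]) //.
  by apply: open_comp; [move=> z _; exact: dotxx_continuous|exact: open_lt].
- by have [_] := nbhs_singleton nearP; rewrite g0.
- have t0' : 0 < hscale phi eta fb p by exact: t0.
  have gc : {for p, continuous (gmap phi eta fb P)}.
    by apply: gmap_continuous t0'; exact: H.
  have nd : \forall q \near p, dot (gmap phi eta fb P q) (gmap phi eta fb P q) < (r / 2) ^+ 2.
    apply: near_lt; last by rewrite g0 dot0l.
    by apply: continuous_dot.
  have ns : \forall q \near p, 0 < hscale phi eta fb q.
    by apply: near_gt t0'; exact: (hscale_continuous H).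
  by apply: filterS (filterI nd (filterI ns nearP)) => q [? [? [_ ?]]].
Qed.

Local Notation gmap_b := (gmap phi eta fb P).
Local Notation csection_b := (csection phi eta fb P).
Local Notation hscale := (hscale phi eta fa).
Local Notation gmap := (gmap phi eta fa P).
Local Notation csection := (csection phi eta fa P).

Lemma nonpole_exists p : (0 < n)%N -> exists q, 0 < hscale q.
Proof.
move=> n0; have [sp|] := ltP 0 (hscale p); first by exists p.
rewrite le_eqVlt ltNge (hscale_ge0 H fr) orbF => /eqP s0.
have [d [s2 [d0 sec _ _]]] := near_pole s0.
pose e : 'rV[R]_n := delta_mx ord0 (Ordinal n0).
have e1 : dot e e = 1 by rewrite dot_delta mxE !eqxx.
(* Less than 1 and less than [d], hence k^2 < d. *)
pose k := d / (1 + d).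
have k0 : 0 < k by rewrite divr_gt0 //; lra.
have kd : k * k < d.
  have k1 : k < 1 by rewrite ltr_pdivrMr; lra.
  have kd : k < d by rewrite ltr_pdivrMr ?ltr_pMr; lra.
  by apply: lt_trans kd; rewrite gtr_pMr.
have [|_ sb gb] := sec.2 (k *: e); first by rewrite /= dotZl dotZr e1 mulr1.
exists (s2 (k *: e)); apply: hscale_swap => //.
by rewrite gb -dot_eq0 dotZl dotZr e1 mulr1 mulf_neq0 // gt_eqF.
Qed.

Hypothesis n3 : (2 < n)%N.

Definition exterior (r : R) : set 'rV[R]_n := [set y | r < dot y y].

(** The path y, y + w, z + w, z, with [w] long and orthogonal to both points, stays outside the
    ball; lifts along its three segments are unique. *)
Lemma exterior_agree (r : R) E s y z : 0 < r -> csection [set: 'rV[R]_n] E ->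
  csection (exterior r) s -> exterior r y -> E y = s y -> exterior r z -> E z = s z.
Proof.
move=> r0 cE cs; rewrite /exterior /= => ry Ey rz.
have [w [wy wz rw]] := orth2 y z n3 r0.
have step u v : E u = s u ->
    (forall t, 0 <= t <= 1 -> r < dot (u + t *: (v - u)) (u + t *: (v - u))) -> E v = s v.
  by move=> Eu seg; apply: (csection_agree H fr cE cs _ Eu) => t t01; split=> //; exact: seg.
have E1 : E (y + w) = s (y + w).
  apply: step Ey _ => t _; rewrite addrAC subrr add0r !dotE (dotC y w) wy.
  by have := mulr_ge0 (sqr_ge0 t) (ltW (lt_trans r0 rw)); rewrite expr2; lra.
have E2 : E (z + w) = s (z + w).
  apply: step E1 _ => t _.
  have -> : y + w + t *: (z + w - (y + w)) = w + (y + t *: (z - y)).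
    by apply/rowP => i; rewrite !mxE; ring.
  have : dot w (y + t *: (z - y)) = 0 by rewrite !dotE wy wz; ring.
  move: (y + _) => u wu; have := dot_ge0 u.
  by rewrite dotDl !dotDr (dotC u w) wu; lra.
apply: step E2 _ => t _.
have -> : z + w + t *: (z - (z + w)) = z + (1 - t) *: w.
  by apply/rowP => i; rewrite !mxE; ring.
rewrite !dotE (dotC z w) wz.
by have := mulr_ge0 (sqr_ge0 (1 - t)) (ltW (lt_trans r0 rw)); rewrite expr2; lra.
Qed.

Lemma csection_kinv (d : R) s2 : 0 < d ->
  csection_b [set z : 'rV[R]_n | dot z z < d] s2 ->
  csection (exterior (4 / d)) (s2 \o kinv).
Proof.
move=> d0 sec; split.
  by apply: (@open_comp _ _ (fun z : 'rV[R]_n => dot z z) [set t | 4 / d < t]);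
    [move=> z _; exact: dotxx_continuous|exact: open_gt].
move=> y; rewrite /exterior /= => yd.
have y0 : y != 0 by rewrite -dot_eq0 gt_eqF // (lt_trans _ yd) // divr_gt0.
have kd : dot (kinv y) (kinv y) < d.
  rewrite dot_kinv // ltr_pdivrMr ?dot_gt0 //.
  by rewrite mulrC -ltr_pdivrMr.
have [sc sb gb] := sec.2 _ kd.
have sa : 0 < hscale (s2 (kinv y)) by apply: hscale_swap => //; rewrite gb kinv_neq0.
split=> //; first by apply: continuous_comp; [exact: kinv_continuous|exact: sc].
have := gmap_swap sa sb; rewrite gb => /(congr1 kinv); rewrite kinvK // kinvK //.
apply/eqP => g0; have := gmap_swap sa sb; rewrite gb g0 => /eqP.
by rewrite /kinv scaler0 (negbTE (kinv_neq0 y0)).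
Qed.

Hypothesis unbounded : forall C : R, exists p, C < phi p ord0 ord0.
Hypothesis hconn : connected [set: M].

Lemma not_compact : ~ compact [set: M].
Proof.
move=> cM; pose f p := phi p ord0 ord0.
have cf : compact (f @` setT).
  apply: continuous_compact => //; apply: continuous_subspaceT => p.
  by apply: cvg_coord; exact: (phi_continuous H).
have [C [_ CP]] := compact_bounded cf.
have [p] := unbounded (C + 1); rewrite ltNge => /negP; apply.
have : C < C + 1 by rewrite ltrDl.
by move=> /CP /(_ (f p)) h; apply: le_trans (ler_norm _) (h _); exists p.
Qed.

(** Near a pole in the closure, [E] meets the section of the exchanged chart, hence agrees with it
    on a whole exterior domain. Then the range of [E] together with the pole is compact and open, so
    it is all of M, which is not compact. *)
Lemma no_pole E p : csection [set: 'rV[R]_n] E -> closure (range E) p -> 0 < hscale p.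
Proof.
move=> cE clp; rewrite lt_def (hscale_ge0 H fr) andbT; apply/eqP => s0.
have [d [s2 [d0 sec s2p nearP]]] := near_pole s0.
have cs := csection_kinv d0 sec.
have [q [[y _ yq] [[sb qd sq] rq]]] := clp _
  (filterI nearP (pole_repels H fr (4 / d) s0)).
have [_ Es Eg] := cE.2 y I.
have ext_y : exterior (4 / d) y.
  by move: rq; rewrite -yq Eg; apply.
have Ey : E y = (s2 \o kinv) y.
  rewrite yq /= -[LHS]sq; congr s2; rewrite gmap_swap -?yq ?Eg //.
  by rewrite yq.
have d4 : 0 < 4 / d by rewrite divr_gt0.
have agree z : exterior (4 / d) z -> E z = s2 (kinv z).
  exact: (exterior_agree d4 cE cs ext_y Ey).
(* The exchange map sends |z|^2 to 4 / |z|^2, so the complement of [K1] goes into [K2], a compact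
   part of the domain of [s2]. *)
pose K1 := [set z : 'rV[R]_n | 0 <= dot z z <= 8 / d].
pose K2 := [set z : 'rV[R]_n | 0 <= dot z z <= d / 2].
have cK1 : compact K1 by exact: compact_annulus.
have cK2 : compact K2 by exact: compact_annulus.
have K2d : K2 `<=` [set z : 'rV[R]_n | dot z z < d].
  by move=> z /= /andP[_ h]; lra.
pose S := E @` K1 `|` s2 @` K2.
have ES z : S (E z).
  have [zl|zl] := leP (dot z z) (8 / d); first by left; exists z => //; rewrite /K1 /= dot_ge0.
  have z0 : z != 0 by rewrite -dot_gt0 (lt_trans _ zl) // divr_gt0.
  right; exists (kinv z); last first.
    rewrite agree //; apply: lt_trans zl; rewrite ltr_pM2r ?invr_gt0 //; lra.
  rewrite /K2 /= dot_ge0 dot_kinv // ler_pdivrMr ?dot_gt0 //.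
  by move: zl; rewrite ltr_pdivrMr //; lra.
have s2S z : K2 z -> z != 0 -> range E (s2 z).
  move=> /andP[_ zd] z0; exists (kinv z) => //.
  rewrite agree ?kinvK // /exterior /= dot_kinv // ltr_pM2l // ltf_pV2 ?posrE ?dot_gt0 //; lra.
have So : open S.
  rewrite openE => q' qS.
  have nE z : nbhs (E z) S.
    have [_ _ Egz] := cE.2 z I.
    have Ez : E (gmap (E z)) = E z by rewrite Egz.
    apply: filterS (near_csection H fr cE (I : setT (gmap (E z))) Ez) => x [_ <-].
    exact: ES.
  case: qS => [[z _ <-]|[z zK <-]]; first exact: nE.
  have [->|z0] := eqVneq z 0; last by have [x _ <-] := s2S z zK z0; exact: nE.
  (* The pole is the only point of [S] outside the range of [E]; its neighbours are values of [s2]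
     on [K2]. *)
  rewrite s2p; have [_ t0] := hscale_eq0 H fr s0.
  have gc : {for p, continuous gmap_b}.
    by apply: gmap_continuous; [exact: H|exact: t0].
  have g0 : gmap_b p = 0 by have [PP _] := hscale_eq0 H fr s0; exact: (gmap_eq0 fb PP).
  have nd : \forall x \near p, dot (gmap_b x) (gmap_b x) < d / 2.
    by apply: near_lt; [exact: continuous_dot|rewrite g0 dot0l divr_gt0].
  apply: filterS (filterI nd nearP) => x [xd [_ _ <-]].
  by right; exists (gmap_b x) => //; rewrite /K2 /= dot_ge0 ltW.
have Sc : closed S.
  apply: closedU; last exact: (csection_closed sec cK2 K2d).
  by apply: (csection_closed cE cK1).
have ST : S = setT.
  by apply: hconn; [exists (E 0); exact: ES|exists S; rewrite ?setTI|exists S; rewrite ?setTI].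
apply: not_compact; rewrite -ST; apply: compactU; apply: continuous_compact => //.
  by apply: continuous_in_subspaceT => z _; have [] := cE.2 z I.
by apply: continuous_in_subspaceT => z /[!inE] /K2d /sec.2[].
Qed.

End AntipodalChart.

(** * The section solves the curvature equation *)

Lemma near_eq_differentiable (R : realType) (V W : normedModType R) (f g : V -> W) x :
  (\forall z \near x, g z = f z) -> differentiable f x -> differentiable g x.
Proof.
move=> fg fx; have [dc _] := (diff_locallyP x f).1 fx.
have fe : forall e : R, 0 < e -> \forall h \near (0 : V),
    `|(f \o shift x - (cst (f x) + 'd f x)) h| <= e * `|h|.
  by have /diff_locally/eqaddoP := fx.
have gx := nbhs_singleton fg.
have G : g \o shift x = cst (g x) + 'd f x +o_ 0 id.
  apply/eqaddoP => e e0; rewrite (near_shift 0 x) in fg.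
  apply: filterS (filterI (fe e e0) fg) => h [/= he].
  rewrite subr0 => hE.
  suff -> : (g \o shift x - (cst (g x) + 'd f x)) h = (f \o shift x - (cst (f x) + 'd f x)) h by [].
  by rewrite !fctE /= hE gx.
have dE := diff_unique dc G.
by apply/diff_locallyP; rewrite dE.
Qed.
Section SectionDerivative.
Context {R : realType} {n : nat} {M : smoothManifold R n}.
Implicit Types (p q : M) (y z v w : 'rV[R]_n).
Variables (phi eta : M -> 'rV[R]_n.+2) (kappa : M -> 'I_n -> R) (a1 a2 : R).
Hypothesis H : pinched phi eta kappa a1 a2.
Variables (fa fb : 'rV[R]_n.+2) (P : 'M[R]_(n.+2, n)).
Hypothesis fr : null_frame fa fb P.

Local Notation psi := (psi phi eta).
Local Notation hscale := (hscale phi eta fa).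
Local Notation gmap := (gmap phi eta fa P).
Local Notation csection := (csection phi eta fa P).

Variable E : 'rV[R]_n -> M.
Hypothesis cE : csection [set: 'rV[R]_n] E.

Lemma hscale_section y : 0 < hscale (E y). Proof. by have [] := cE.2 y I. Qed.
Lemma gmap_section y : gmap (E y) = y. Proof. by have [] := cE.2 y I. Qed.
Let s0 := hscale_section.
Let gE := gmap_section.

(** [L] is the differential of the section read in the chart, inverse to that of the Gauss map. It
    transfers everything known in charts to functions on R^n. *)
Lemma section_chart y : exists (a : chart R n M) z (L : 'rV[R]_n -> 'rV[R]_n),
  [/\ atlas a /\ cim a z, cinv a z = E y,
      forall (W : normedModType R) (F : M -> W), differentiable (F \o cinv a) z ->
        differentiable (F \o E) y /\
        forall v, 'D_v (F \o E) y = 'D_(L v) (F \o cinv a) z,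
      forall v, 'D_(L v) (gmap \o cinv a) z = v
    & forall w, exists v, L v = w].
Proof.
have [a aa ay] := atlas_cover (E y).
have [e ey eP] := csection_chart H fr cE (I : setT y) aa ay.
have [_ az Ez [ed ec] eD] := nbhs_singleton eP.
have nE : \forall w \near y, E w = cinv a (e w) by apply: filterS eP => w [].
have sz : 0 < hscale (cinv a (e y)) by rewrite -Ez.
exists a, (e y), (fun v => 'D_v e y); split=> //.
- move=> W F Fd.
  have nF : \forall w \near y, ((F \o cinv a) \o e) w = (F \o E) w.
    by apply: filterS nE => w /= ->.
  have cd : differentiable ((F \o cinv a) \o e) y by exact: differentiable_comp.
  have Dv v : is_derive y v (F \o E) ('D_('D_v e y) (F \o cinv a) (e y)).
    apply: near_eq_is_derive nF _.
    exact: (is_derive_chain (derivableP (diff_derivable (v := v) ed)) Fd).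
  split; last by move=> v; have [_ ->] := Dv v.
  by apply: near_eq_differentiable cd; apply: filterS nF => w ->.
- move=> w; exists ('D_w (gmap \o cinv a) (e y)).
  have gd := gmap_chart_diff H P aa az sz.
  set u := 'D_ _ e y; apply/eqP; rewrite -subr_eq0; apply/eqP.
  apply: (gmap_chart_inj H fr aa az sz).
  rewrite deriveE // linearB /= -!deriveE // /u eD subrr //.
Qed.

Let Phi := phi \o E.
Let Psi := psi \o E.

Lemma section_facts y :
  [/\ differentiable Phi y, differentiable Psi y,
      forall v, lorentz ('D_v Phi y) (Psi y) = 0
    & exists w : 'I_n -> 'rV[R]_n,
      [/\ forall i j, lorentz ('D_(w i) Phi y) ('D_(w j) Phi y) = (i == j)%:R,
          forall i, 'D_(w i) Psi y = (1 - kappa (E y) i) *: 'D_(w i) Phi y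
        & forall u v, lorentz ('D_u Psi y) ('D_v Psi y) = hscale (E y) ^+ 2 * dot u v]].
Proof.
have [a [z [L [[aa az] zE chain Lg Lsurj]]]] := section_chart y.
have [Fd FD] := chain _ phi (phi_chart_diff H aa az).
have [Gd GD] := chain _ psi (psi_chart_diff H aa az).
have sz : 0 < hscale (cinv a z) by rewrite zE.
split=> //.
  by move=> v; rewrite /Phi FD /Psi /= -zE; exact: (lorentz_Dphi_psi H aa az).
have [e [e1 e2 _]] := principal_frame H aa az.
have [w wP] := choice (fun i => Lsurj (e i)).
exists w; split.
- by move=> i j; rewrite /Phi !FD !wP; exact: e1.
- by move=> i; rewrite /Phi FD /Psi GD wP -zE; exact: e2.
- move=> u v; rewrite /Psi !GD (gmap_conformal H fr aa az sz) zE.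
  by rewrite !Lg.
Qed.

Definition stau y : R := (hscale (E y))^-1.
Definition sla y : R := dot (phi (E y)) fa.
(** The gradient of [stau], expressed by [phi] without derivatives; its own differentiability then
    needs only that of [phi]. *)
Definition sgrad y : 'rV[R]_n := sla y *: y - phi (E y) *m P.

Lemma stau_gt0 y : 0 < stau y. Proof. by rewrite invr_gt0. Qed.

(** This is <phi, psi> = -1 divided by [hscale]. *)
Lemma stauE y : stau y =
  sla y * dot y y / 2 + dot (phi (E y)) fb - dot y (phi (E y) *m P).
Proof.
have := lorentz_phi_psi H (E y); rewrite (nf_lorentz fr) (psi_mulmx P (s0 y)) (psi_fb H fr (s0 y)).
rewrite -/(hscale (E y)) gE dotZr (dotC _ y) -/(sla y) => E1.
apply: (mulIf (lt0r_neq0 (s0 y))); rewrite mulVf ?gt_eqF //; lra.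
Qed.

(** This is <phi, phi> = -1, with [stau] substituted from [stauE]. *)
Lemma sla_grad y : sla y = (1 + dot (sgrad y) (sgrad y)) / (2 * stau y).
Proof.
have E1 := lorentz_phi_phi H (E y); rewrite (nf_lorentz fr) -/(sla y) in E1.
have E2 := stauE y; have t0 := stau_gt0 y.
rewrite /sgrad; move: (sla y) (phi (E y) *m P) (stau y) E1 E2 t0 => l pe t E1 E2 t0.
have -> : 1 + dot (l *: y - pe) (l *: y - pe) = l * (2 * t).
  by rewrite !dotE (dotC pe y) E2; lra.
by rewrite mulfK // mulf_neq0 // gt_eqF.
Qed.

Lemma sla_diff y : differentiable sla y.
Proof. by apply: differentiable_dotl; have [] := section_facts y. Qed.

Lemma sgrad_diff y : differentiable sgrad y.
Proof.
apply: differentiableB; first by apply: differentiable_scale => //; exact: sla_diff.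
by apply: differentiable_mulmx; have [] := section_facts y.
Qed.

Lemma stau_diff y : differentiable stau y.
Proof.
apply: differentiableV; last by rewrite gt_eqF.
by apply: (differentiable_dotl (f := Psi)); have [] := section_facts y.
Qed.

(** When [stauE] is differentiated, the terms with the derivative of [phi] add up to a multiple of
    <d phi, psi> = 0. *)
Lemma stau_derive y v : 'D_v stau y = dot (sgrad y) v.
Proof.
have [Fd _ FP _] := section_facts y.
have DF := derivableP (diff_derivable (v := v) Fd).
have Di : is_derive y v (@id 'rV[R]_n) v by exact: is_derive_id.
have Dla := is_derive_dot DF (@is_derive_cst _ _ _ (fa : 'rV[R]_n.+2) y v).
have Dmu := is_derive_dot DF (@is_derive_cst _ _ _ (fb : 'rV[R]_n.+2) y v).
have Dpe := is_derive_dot Di (is_derive_mulmx P DF).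
have Dyy := is_deriveMf (is_derive_dot Di Di) (@is_derive_cst _ _ _ (2^-1 : R) y v).
have D := is_deriveB (is_deriveD (is_deriveMf Dla Dyy) Dmu) Dpe.
rewrite (_ : stau = (fun w => dot (Phi w) fa * (dot w w * 2^-1)) +
   (fun w => dot (Phi w) fb) - (fun w => dot w (Phi w *m P))); last first.
  by rewrite funeqE => w; rewrite stauE !fctE mulrA.
rewrite (@derive_val _ _ _ _ _ _ _ D) /cst /= !dot0r !addr0.
have := FP v; rewrite (nf_lorentz fr) /Psi /= (psi_mulmx P (s0 y)) (psi_fb H fr (s0 y)).
rewrite -/(hscale (E y)) gE dotZr => E1.
move: ('D_v Phi y) E1 => DPhi E1.
have E2 : dot DPhi fa * dot y y / 2 + dot DPhi fb - dot (DPhi *m P) y = 0.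
  apply: (mulIf (lt0r_neq0 (s0 y))); rewrite mul0r; lra.
rewrite /sgrad /sla !dotE (dotC v y) (dotC v (_ *m _)) (dotC y (DPhi *m P)) /Phi /=; lra.
Qed.

(** [D] stands for d phi(v) and [ak *: D] for d psi(v), in a principal direction. Comparing it with
    the derivative of psi P = s y shows that the derivative of the gradient is (l - s / ak) v. *)
Lemma frame_algebra (D : 'rV[R]_n.+2) y v (s ak t l gg : R) :
  (ak *: D) *m P = dot (ak *: D) fa *: y + s *: v -> l = (1 + gg) / (2 * t) -> 0 < t ->
  t * s = 1 -> 0 < ak ->
  ((1 + gg) / 2) *: ((s / ak) *: v) -
    t *: ((s / ak) *: (dot D fa *: y + l *: v - D *m P)) = ak^-1 *: ((s / ak) *: v).
Proof.
move=> E1 E2 t0 ts a0.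
have a' : ak != 0 by rewrite gt_eqF.
have t' : t != 0 by rewrite gt_eqF.
have DP : D *m P = dot D fa *: y + (s / ak) *: v.
  have : ak^-1 *: ((ak *: D) *m P) = ak^-1 *: (dot (ak *: D) fa *: y + s *: v) by rewrite E1.
  rewrite -scalemxAl dotZl scalerDr !scalerA mulVf // scale1r => ->.
  by rewrite mulrA mulVf // mul1r [_^-1 * s]mulrC.
have gE' : (1 + gg) / 2 = l * t by rewrite E2; field.
have -> : dot D fa *: y + l *: v - D *m P = (l - s / ak) *: v.
  by rewrite DP opprD addrACA subrr add0r -scalerBl.
rewrite gE' !scalerA -scalerBl; congr (_ *: _).
have -> : l * t * (s / ak) - t * (s / ak) * (l - s / ak) = (t * s) * (s / ak) / ak by field.
by rewrite ts mul1r mulrC.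
Qed.

(** Principal directions are orthogonal for both metrics; having horospherical length a_i, the
    direction [w i] becomes a Euclidean unit vector after multiplication by s / a_i. *)
Lemma sgrad_frame y : curvature_frame stau sgrad a1 (\sum_i (1 - kappa (E y) i)) y.
Proof.
have [Fd Gd _ [w [w1 w2 w3]]] := section_facts y.
pose a i := 1 - kappa (E y) i.
have a0 i : 0 < a i by apply: lt_le_trans (pc_gt0 H) (pc_ge H _ _).
pose s := hscale (E y).
have sy0 : 0 < s by exact: s0.
exists (fun i => (s / a i) *: w i), a; split=> //.
- move=> i j; have := w3 (w i) (w j); rewrite !w2 -/(a i) -/(a j) -/s.
  rewrite lorentzZl lorentzZr (w1 i j) dotZl dotZr => E1.
  have ai := lt0r_neq0 (a0 i); have aj := lt0r_neq0 (a0 j).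
  have -> : s / a i * (s / a j * dot (w i) (w j)) =
     (s ^+ 2 * dot (w i) (w j)) / (a i * a j) by field; rewrite ai aj.
  rewrite -E1; case: eqP => [->|_]; field; rewrite ?ai ?aj //.
- by move=> k; exact: (pc_ge H).
- move=> k; pose v := w k.
  have DF := derivableP (diff_derivable (v := v) Fd).
  have DG := derivableP (diff_derivable (v := v) Gd).
  have Di : is_derive y v (@id 'rV[R]_n) v by exact: is_derive_id.
  have Dla := is_derive_dot DF (@is_derive_cst _ _ _ (fa : 'rV[R]_n.+2) y v).
  have Dg : is_derive y v sgrad _ :=
    is_deriveB (is_deriveZf Dla Di) (is_derive_mulmx P DF).
  have Ds := is_derive_dot DG (@is_derive_cst _ _ _ (fa : 'rV[R]_n.+2) y v).
  have DsY := is_deriveZf Ds Di.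
  have E1 : 'D_v Psi y *m P = dot ('D_v Psi y) fa *: y + s *: v.
    have D1 := is_derive_mulmx P DG.
    have Eq : (fun u => Psi u *m P) = fun u => dot (Psi u) fa *: u.
      by rewrite funeqE => u; rewrite /Psi /= (psi_mulmx P (s0 u)) gE.
    have := @derive_val _ _ _ _ _ _ _ D1; rewrite Eq (@derive_val _ _ _ _ _ _ _ DsY).
    by rewrite /cst /= dot0r addr0 => <-.
  have DgE := @derive_val _ _ _ _ _ _ _ Dg.
  rewrite /cst /= dot0r addr0 in DgE.
  have Dlin : 'D_((s / a k) *: v) sgrad y = (s / a k) *: 'D_v sgrad y.
    by rewrite !deriveE ?linearZ //; exact: sgrad_diff.
  rewrite Dlin DgE; rewrite (w2 k) -/(a k) in E1.
  have E2 := sla_grad y; have t0 := stau_gt0 y; have ts : stau y * s = 1.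
    by rewrite mulVf // gt_eqF.
  have ak := a0 k.
  exact: frame_algebra E1 E2 t0 ts ak.
Qed.

Lemma section_solution c : (forall p, \sum_i (1 - kappa p i) = c) ->
  solution stau sgrad a1 c.
Proof.
move=> cE'; split; [exact: stau_gt0|exact: stau_diff|exact: stau_derive|exact: sgrad_diff|].
by move=> y; rewrite -(cE' (E y)); exact: sgrad_frame.
Qed.

End SectionDerivative.

(** * The gradient bound *)

Section QuadraticGrowth.
Context {R : realType}.

Lemma derive_ge0_le (h dh : R -> R) (a b : R) : a <= b ->
  (forall t, a <= t <= b -> is_derive t (1 : R) h (dh t)) ->
  (forall t, a < t < b -> 0 <= dh t) -> h a <= h b.
Proof.
rewrite le_eqVlt => /orP[/eqP -> //|ab] hD dh0.
have [s sab E] : exists2 s, s \in `]a, b[%R & h b - h a = dh s * (b - a).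
  apply: MVT => // [t|].
    by rewrite in_itv /= => /andP[at_ tb]; apply: hD; rewrite !ltW.
  apply: continuous_in_subspaceT => t /[!inE] /=; rewrite in_itv /= => /hD [hd _].
  by apply: differentiable_continuous; apply/derivable1_diffP.
rewrite -subr_ge0 E; apply: mulr_ge0; last by rewrite subr_ge0 ltW.
by apply: dh0; move: sab; rewrite in_itv.
Qed.

(** The inequality says that (f'^2 - A) / f is nondecreasing as long as f' > 0, and its positivity
    in turn keeps f' positive. So f'' stays above a positive constant, and two integrations
    conclude. *)
Lemma quadratic_growth (f f1 f2 : R -> R) (A : R) : 0 <= A -> (forall t, 0 < f t) ->
  (forall t, is_derive t (1 : R) f (f1 t)) -> (forall t, is_derive t (1 : R) f1 (f2 t)) ->
  (forall t, f1 t ^+ 2 - A <= 2 * f t * f2 t) -> 0 < f1 0 -> A < f1 0 ^+ 2 ->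
  exists2 m, 0 < m & forall t, 0 <= t -> m * (1 + t) ^+ 2 <= f t.
Proof.
move=> A0 f0 fD f1D ineq f10 Af1.
pose Q t := (f1 t * f1 t - A) * (f t)^-1.
have fn t : f t != 0 by rewrite gt_eqF.
have QD t : is_derive t (1 : R) Q (f1 t * (2 * f t * f2 t - (f1 t ^+ 2 - A)) / f t ^+ 2).
  have D := is_deriveMf (is_deriveB (is_deriveMf (f1D t) (f1D t))
    (@is_derive_cst _ _ _ (A : R) t (1 : R))) (is_deriveVf (fD t) (fn t)).
  by apply: is_derive_eq D _; rewrite ?fctE /cst /=; field.
pose q := Q 0.
have q0 : 0 < q by rewrite /q /Q divr_gt0 // -expr2 subr_gt0.
have f1c (t : R) : {for t, continuous f1}.
  by apply: differentiable_continuous; apply/derivable1_diffP; case: (f1D t).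
have Qmono (t : R) : 0 <= t -> (forall s, 0 <= s < t -> 0 < f1 s) -> q <= Q t.
  move=> t0 f1p; apply: (@derive_ge0_le Q _ 0 t t0 (fun s _ => QD s)) => s /andP[s0 st].
  apply: divr_ge0; last exact: sqr_ge0.
  apply: mulr_ge0; last by rewrite subr_ge0.
  by apply: ltW; apply: f1p; rewrite ltW.
have f1pos (T : R) : 0 <= T -> 0 < f1 T.
  move=> T0; apply: (@real_induction R (fun t => 0 < f1 t) 0 T) => //; last first.
  - by rewrite T0 lexx.
  - move=> t t0 _ f1p; have := Qmono t (ltW t0) f1p.
    have f1ge : 0 <= f1 t.
      rewrite leNgt; apply/negP => f1n.
      have /nbhs_ballP[d /= d0 dP] := near_lt (f1c t) f1n.
      pose s := Num.max (t / 2) (t - d / 2).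
      have st : s < t by rewrite gt_max; apply/andP; split; lra.
      have s0 : 0 <= s by rewrite le_max; apply/orP; left; lra.
      have sd : t - d / 2 <= s by rewrite le_max lexx orbT.
      have := f1p s; rewrite s0 st => /(_ isT); rewrite ltNge ltW //.
      by apply: dP; rewrite -ball_normE /= ger0_norm; lra.
    move=> qQ; rewrite lt_def f1ge andbT; apply/eqP => f10'.
    move: qQ; rewrite /Q f10' mul0r sub0r mulNr => qQ.
    have : 0 <= A / f t by apply: divr_ge0 => //; exact: ltW.
    lra.
  - move=> t t0 _ f1p; have f1t : 0 < f1 t by apply: f1p; rewrite t0 lexx.
    have /nbhs_ballP[d /= d0 dP] := near_gt (f1c t) f1t.
    exists d => // s /andP[ts sd]; apply: dP; rewrite -ball_normE /= distrC ger0_norm; lra.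
have f2ge (t : R) : 0 <= t -> q / 2 <= f2 t.
  move=> t0; have := Qmono t t0 (fun s h => f1pos s (andP h).1).
  rewrite /Q ler_pdivlMr // -expr2 => h; have := ineq t => h'.
  have : q * f t <= 2 * f2 t * f t by lra.
  rewrite ler_pM2r //; lra.
have f1ge (t : R) : 0 <= t -> q / 2 * t <= f1 t.
  move=> t0; pose h s := f1 s - q / 2 * s.
  have hD s : is_derive s (1 : R) h (f2 s - q / 2).
    have D := is_deriveB (f1D s) (is_deriveMf (@is_derive_cst _ _ _ (q / 2 : R) s (1 : R))
      (@is_derive_id R R s 1)).
    by apply: is_derive_eq D _; rewrite ?fctE /cst /=; ring.
  have := @derive_ge0_le h _ 0 t t0 (fun s _ => hD s); rewrite /h mulr0 subr0 => hh.
  have : f1 0 <= f1 t - q / 2 * t.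
    by apply: hh => s /andP[s0 _]; rewrite subr_ge0; apply: f2ge; exact: ltW.
  lra.
have fge (t : R) : 0 <= t -> f 0 + q / 4 * t ^+ 2 <= f t.
  move=> t0; pose h s := f s - q / 4 * (s * s).
  have hD s : is_derive s (1 : R) h (f1 s - q / 2 * s).
    have D := is_deriveB (fD s) (is_deriveMf (@is_derive_cst _ _ _ (q / 4 : R) s (1 : R))
      (is_deriveMf (@is_derive_id R R s 1) (@is_derive_id R R s 1))).
    by apply: is_derive_eq D _; rewrite ?fctE /cst /=; field.
  have := @derive_ge0_le h _ 0 t t0 (fun s _ => hD s); rewrite /h !mulr0 subr0 => hh.
  have : f 0 <= f t - q / 4 * (t * t).
    by apply: hh => s /andP[s0 _]; rewrite subr_ge0; apply: f1ge; exact: ltW.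
  by rewrite expr2; lra.
pose m := Num.min (f 0) (q / 4).
have m0 : 0 < m by rewrite lt_min f0 divr_gt0.
(* The factor 1/2 is for (1 + t)^2 <= 2 (1 + t^2). *)
exists (m / 2); first by rewrite divr_gt0.
move=> t t0; apply: le_trans (fge t t0).
have mf : m <= f 0 by rewrite ge_min lexx.
have mq : m <= q / 4 by rewrite ge_min lexx orbT.
have : m * t ^+ 2 <= q / 4 * t ^+ 2 by apply: ler_wpM2r => //; exact: sqr_ge0.
have : m / 2 * (1 + t) ^+ 2 = m + m * t ^+ 2 - m / 2 * (1 - t) ^+ 2 by field.
have : 0 <= m / 2 * (1 - t) ^+ 2.
  by apply: mulr_ge0; [rewrite divr_ge0 // ltW|exact: sqr_ge0].
lra.
Qed.

(** In the gradient direction e the equation and 1/a_k <= 1/a0 give 2 tau Hess tau(e, e) >= (1 +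
    |g|^2 - 2/a0) |e|^2, and Cauchy-Schwarz brings in <g, e>^2. The strict hypothesis says that the
    initial slope |e|^2 exceeds the threshold. *)
Lemma ray_quadratic_growth n (tau : 'rV[R]_n -> R) (g : 'rV[R]_n -> 'rV[R]_n) (a0 c : R) y0 :
  solution tau g a0 c -> 0 < a0 -> a0 <= 2 -> 2 / a0 - 1 < dot (g y0) (g y0) ->
  exists2 m, 0 < m & forall t, 0 <= t -> m * (1 + t) ^+ 2 <= tau (y0 + t *: g y0).
Proof.
move=> sol a00 a02 gK; set e := g y0 in gK *.
have K0 : 0 <= 2 / a0 - 1 by rewrite subr_ge0 ler_pdivlMr // mul1r.
have e0 : 0 < dot e e by apply: le_lt_trans gK.
pose f1 t := dot (g (y0 + t *: e)) e.
pose f2 t := dot ('D_e g (y0 + t *: e)) e.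
apply: (@quadratic_growth (fun t => tau (y0 + t *: e)) f1 f2 ((2 / a0 - 1) * dot e e)).
- by apply: mulr_ge0 => //; exact: dot_ge0.
- by move=> t; exact: (sol_gt0 sol).
- move=> t; have := is_derive_line (x := y0) (v := e) (t := t) (sol_diff sol _).
  by rewrite (sol_grad sol).
- move=> t; have D := is_derive_line (x := y0) (v := e) (t := t) (sol_gdiff sol _).
  have D2 := is_derive_dot D (@is_derive_cst _ _ _ (e : 'rV[R]_n) t (1 : R)).
  by apply: is_derive_eq D2 _; rewrite /cst dot0r addr0.
- move=> t; rewrite /f1 /f2; set y := y0 + t *: e.
  have [f [a [fo fa0 _ fB]]] := sol_frame sol y.
  have := Bquad_frame e (sol_gdiff sol y) fo fB; rewrite /Bquad => E.
  have S : \sum_k dot e (f k) ^+ 2 / a k <= dot e e / a0.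
    rewrite (orthonormal_parseval e fo) mulr_suml; apply: ler_sum => k _.
    apply: ler_wpM2l; first exact: sqr_ge0.
    exact: inv_le.
  have cs := CauchySchwarz_dot (g y) e.
  have -> : 2 * tau y * dot ('D_e g y) e = (1 + dot (g y) (g y)) * dot e e
     - 2 * \sum_k dot e (f k) ^+ 2 / a k by rewrite -E; field.
  have : dot e e / a0 = a0^-1 * dot e e by rewrite mulrC.
  lra.
- by rewrite /f1 scale0r addr0.
- by rewrite /f1 scale0r addr0 -/e expr2 ltr_pM2r.
Qed.

End QuadraticGrowth.

Section GradientBound.
Context {R : realType} {n : nat} {M : smoothManifold R n}.
Implicit Types (p q : M) (y z v w : 'rV[R]_n).
Variables (phi eta : M -> 'rV[R]_n.+2) (kappa : M -> 'I_n -> R) (a1 a2 : R).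
Hypothesis H : pinched phi eta kappa a1 a2.
Hypothesis a20 : 0 < a2.
Variables (fa fb : 'rV[R]_n.+2) (P : 'M[R]_(n.+2, n)).
Hypothesis fr : null_frame fa fb P.
Hypothesis complete : complete_hypersurface phi.

Local Notation hscale := (hscale phi eta fa).
Local Notation gmap := (gmap phi eta fa P).
Local Notation csection := (csection phi eta fa P).

(** In the parameter w = 1 / (1 + t) the decay of [hscale] cancels dt = -dw / w^2, so the lifted ray
    has bounded speed on the bounded range 0 < w <= 1. *)
Lemma finite_ray_dist E y0 e (C L w0 w1 : R) : csection [set: 'rV[R]_n] E ->
  0 <= C -> 0 <= L -> dot e e <= L ^+ 2 ->
  (forall t : R, 0 <= t -> hscale (E (y0 + t *: e)) <= C / (1 + t) ^+ 2) ->
  0 < w0 <= 1 -> 0 < w1 <= 1 ->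
  (induced_dist phi (E (y0 + (w0^-1 - 1) *: e)%R) (E (y0 + (w1^-1 - 1) *: e)%R)
    <= (2 * C * L * `|w1 - w0| / a1)%:E)%E.
Proof.
move=> cE C0 L0 eL sC /andP[w00 w01] /andP[w10 w11].
pose w (t : R) := w0 + smoothstep t * (w1 - w0).
pose dw (t : R) := pi / 2 * sin (pi * t) * (w1 - w0).
have wD (t : R) : is_derive t (1 : R) w (dw t).
  have D := is_deriveD (@is_derive_cst _ _ _ (w0 : R) t (1 : R))
   (is_deriveMf (is_derive_smoothstep t) (@is_derive_cst _ _ _ (w1 - w0 : R) t (1 : R))).
  by apply: is_derive_eq D _; rewrite /cst /dw mulr0 addr0 add0r.
have wP (t : R) : 0 < w t <= 1.
  have /andP[s0 s1] := smoothstep01 t; rewrite /w.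
  have -> : w0 + smoothstep t * (w1 - w0) = (1 - smoothstep t) * w0 + smoothstep t * w1 by ring.
  have h1 : (1 - smoothstep t) * w0 <= 1 - smoothstep t by rewrite ler_piMr // subr_ge0.
  have h2 : smoothstep t * w1 <= smoothstep t by rewrite ler_piMr.
  apply/andP; split; last lra.
  have [h|h] := leP (smoothstep t) (1 / 2).
    have : 0 < (1 - smoothstep t) * w0 by rewrite mulr_gt0 // subr_gt0; lra.
    have : 0 <= smoothstep t * w1 by rewrite mulr_ge0 // ltW.
    lra.
  have : 0 <= (1 - smoothstep t) * w0 by rewrite mulr_ge0 ?subr_ge0 // ltW.
  have : 0 < smoothstep t * w1 by rewrite mulr_gt0 //; lra.
  lra.
have w_gt0 t : 0 < w t by have /andP[] := wP t.
have wn t : w t != 0 by rewrite gt_eqF.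
pose x (t : R) := y0 + ((w t)^-1 - 1) *: e.
have x0 : x 0 = y0 + (w0^-1 - 1) *: e.
  by rewrite /x /w /smoothstep mulr0 cos0 subrr !mul0r addr0.
have x1 : x 1 = y0 + (w1^-1 - 1) *: e.
  have w1E : w 1 = w1 by rewrite /w /smoothstep mulr1 cospi opprK divff // mul1r addrC subrK.
  by rewrite /x w1E.
have xD (t : R) : is_derive t (1 : R) x ((- (dw t / w t ^+ 2)) *: e).
  have D1 := is_deriveB (is_deriveVf (wD t) (wn t)) (@is_derive_cst _ _ _ (1 : R) t (1 : R)).
  have D2 := is_deriveZf D1 (@is_derive_cst _ _ _ (e : 'rV[R]_n) t (1 : R)).
  have D := is_deriveD (@is_derive_cst _ _ _ (y0 : 'rV[R]_n) t (1 : R)) D2.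
  by apply: is_derive_eq D _; rewrite /cst scaler0 addr0 add0r subr0.
have := @csection_dist _ _ _ _ _ _ _ _ H _ _ _ fr [set: 'rV[R]_n] E x
  (2 * C * L * `|w1 - w0|) cE.
rewrite x0 x1; apply.
- by [].
- by move=> t; have [] := xD t.
- rewrite (_ : (fun t : R => _) = fun t : R => (- (dw t / w t ^+ 2)) *: e); last first.
    by rewrite funeqE => t; have [_ ->] := xD t.
  move=> t; apply: (@continuousZ _ _ _ (fun s : R => - (dw s / w s ^+ 2)) (cst e));
    last exact: cst_continuous.
  have wc : {for t, continuous w}.
    by apply: differentiable_continuous; apply/derivable1_diffP; case: (wD t).
  apply: continuousN; apply: continuousM.
    apply: continuousM; last exact: cst_continuous.
    apply: continuousM; first exact: cst_continuous.
    apply: (@continuous_comp _ _ _ (fun t : R => pi * t) (@sin R)); last exact: continuous_sin.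
    by apply: continuousM; [exact: cst_continuous|exact: cvg_id].
  apply: continuousV; first by rewrite expf_neq0.
  by rewrite (_ : (fun s => w s ^+ 2) = fun s => w s * w s) //; exact: continuousM.
- by rewrite !mulr_ge0.
- move=> t t01; have -> := @derive_val _ _ _ _ _ _ _ (xD t).
  rewrite dotZl dotZr.
  have sx : hscale (E (x t)) <= C * w t ^+ 2.
    have h0 : 0 <= (w t)^-1 - 1.
      by rewrite subr_ge0 -[leLHS]invr1; apply: inv_le => //; have /andP[] := wP t.
    have wE : 1 + ((w t)^-1 - 1) = (w t)^-1 by rewrite addrC subrK.
    by have := sC _ h0; rewrite wE exprVn invrK.
  have sx0 := hscale_ge0 H fr (E (x t)).
  have sx2 : hscale (E (x t)) ^+ 2 <= (C * w t ^+ 2) ^+ 2.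
    by rewrite ler_pXn2r ?nnegrE // mulr_ge0 // sqr_ge0.
  have dw2 : dw t ^+ 2 <= 2 ^+ 2 * `|w1 - w0| ^+ 2.
    rewrite /dw exprMn real_normK ?num_real //; apply: ler_wpM2r; first exact: sqr_ge0.
    have ph := pihalf_ge1 R; have ph2 := pihalf_lt2 R.
    rewrite -[leLHS]real_normK ?num_real // ler_pXn2r ?nnegrE //.
    rewrite normrM ger0_norm; last lra.
    rewrite -[leRHS]mulr1; apply: ler_pM => //; [lra|exact: ltW|exact: sin_max].
  have -> : hscale (E (x t)) ^+ 2 * (- (dw t / w t ^+ 2) * (- (dw t / w t ^+ 2) * dot e e)) =
    (hscale (E (x t)) ^+ 2 / (w t ^+ 2) ^+ 2) * (dw t ^+ 2 * dot e e).
    by field.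
  have -> : (2 * C * L * `|w1 - w0|) ^+ 2 = C ^+ 2 * ((2 ^+ 2 * `|w1 - w0| ^+ 2) * L ^+ 2).
    by ring.
  apply: ler_pM.
  + by apply: divr_ge0; exact: sqr_ge0.
  + by apply: mulr_ge0; [exact: sqr_ge0|exact: dot_ge0].
  + by rewrite ler_pdivrMr ?exprn_gt0 // -exprMn.
  + by apply: ler_pM => //; [exact: sqr_ge0|exact: dot_ge0].
Qed.

(** Otherwise the points of the lifted ray at integer times form a Cauchy sequence along which
    [hscale] tends to 0. Its limit would be a pole in the closure of the section. *)
Lemma section_grad_bound E (c : R) : csection [set: 'rV[R]_n] E ->
  (forall p, closure (range E) p -> 0 < hscale p) ->
  (forall p, \sum_i (1 - kappa p i) = c) -> a1 <= 2 ->
  forall y, dot (sgrad phi fa P E y) (sgrad phi fa P E y) <= 2 / a1 - 1.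
Proof.
move=> cE nopole sumc a12 y0; rewrite leNgt; apply/negP => gK.
set e := sgrad phi fa P E y0 in gK.
have a10 := pc_gt0 H.
have [m m0 mP] := ray_quadratic_growth (section_solution H fr cE sumc) a10 a12 gK.
have s0 y : 0 < hscale (E y) by have [] := cE.2 y I.
have m1 (t : R) : 0 <= t -> 0 < (1 + t) ^+ 2 :> R by move=> t0; rewrite exprn_gt0 //; lra.
have sC (t : R) : 0 <= t -> hscale (E (y0 + t *: e)) <= m^-1 / (1 + t) ^+ 2.
  move=> t0; have := mP t t0; rewrite /stau -/e => h.
  rewrite -[leLHS]invrK -invfM; apply: inv_le => //.
  by apply: mulr_gt0 => //; exact: m1.
pose L := 1 + dot e e.
have eL : dot e e <= L ^+ 2.
  have := dot_ge0 e; have := sqr_ge0 (dot e e).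
  have -> : L ^+ 2 = 1 + 2 * dot e e + dot e e ^+ 2 by rewrite /L; ring.
  lra.
have L0 : 0 <= L by rewrite /L; have := dot_ge0 e; lra.
have mi : 0 <= m^-1 by rewrite invr_ge0 ltW.
pose W k : R := k.+1%:R^-1.
have W01 k : 0 < W k <= 1.
  by rewrite /W invr_gt0 ltr0n /= invf_le1 ?ltr0n // ler1n.
have WE k : (W k)^-1 - 1 = k%:R by rewrite invrK -natr1 addrK.
have Wle N k : (N <= k)%N -> W k <= W N.
  by move=> Nk; apply: inv_le; rewrite ?ltr0n ?ler_nat.
pose u k := E (y0 + k%:R *: e).
pose K := 2 * m^-1 * L / a1.
have K0 : 0 <= K by rewrite divr_ge0 ?mulr_ge0 // ltW.
have [|p pP] := complete (u := u).
  move=> eps eps0; have [N NP] := archi_lt K0 eps0; exists N => i j Ni Nj.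
  have := finite_ray_dist cE mi L0 eL sC (W01 i) (W01 j); rewrite !WE => d.
  apply: le_lt_trans d _; rewrite lte_fin; apply: le_lt_trans NP.
  have -> : 2 * m^-1 * L * `|W j - W i| / a1 = K * `|W j - W i| by rewrite /K; field; rewrite !gt_eqF.
  apply: ler_wpM2l => //; rewrite -/(W N).
  have := Wle N i Ni; have := Wle N j Nj; have /andP[] := W01 i; have /andP[] := W01 j.
  by move=> *; rewrite ler_norml; apply/andP; split; lra.
have nP U : nbhs p U -> exists N : nat, forall i, (N <= i)%N -> U (u i).
  move=> pU; have [d d0 dP] := near_of_dist H a20 fr pU.
  have [N NP] := pP d d0; exists N => i Ni; exact: dP (NP i Ni).
have sp : 0 < hscale p.
  apply: nopole => U /nP[N NP]; exists (u N); split; last exact: NP.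
  by exists (y0 + N%:R *: e).
have nh : \forall q \near p, hscale p / 2 < hscale q.
  by apply: near_gt; [exact: (hscale_continuous H)|lra].
have [N NP] := nP _ nh.
have s20 : 0 < hscale p / 2 by rewrite divr_gt0.
have [N' N'P] := archi_lt mi s20.
have := NP (maxn N N') (leq_maxl _ _); rewrite ltNge => /negP; apply.
apply: le_trans (sC _ (ler0n _ _)) _; apply: le_trans (ltW N'P).
apply: ler_wpM2l => //; rewrite nat1r; apply: inv_le; first by rewrite ltr0n.
apply: (@le_trans _ _ ((maxn N N').+1%:R)); first by rewrite ler_nat ltnS leq_maxr.
by rewrite expr2 ler_peMl ?ler0n // ler1n.
Qed.

End GradientBound.

(** * Conclusion *)

Section Horosphere.
Context {R : realType} {n : nat} {M : smoothManifold R n}.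
Implicit Types (p q : M) (y z v w : 'rV[R]_n).
Variables (phi eta : M -> 'rV[R]_n.+2) (kappa : M -> 'I_n -> R) (a1 a2 : R).
Hypothesis H : pinched phi eta kappa a1 a2.
Variables (fa fb : 'rV[R]_n.+2) (P : 'M[R]_(n.+2, n)).
Hypothesis fr : null_frame fa fb P.

Local Notation psi := (psi phi eta).
Local Notation hscale := (hscale phi eta fa).
Local Notation gmap := (gmap phi eta fa P).
Local Notation csection := (csection phi eta fa P).

Lemma boundary_unbounded (x : 'rV[R]_n.+1) : boundary_at_infinity phi x ->
  forall C : R, exists p, C < phi p ord0 ord0.
Proof.
move=> [x1 [u ux]] C; apply: contrapT => /forallNP noC.
have x1' : dot x x = 1 by rewrite -[RHS]x1; apply: eq_bigr => i _; rewrite expr2.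
have pC p : phi p ord0 ord0 <= C by rewrite leNgt; apply/negP; exact: noC.
have C0 : 0 < C by apply: lt_le_trans (pC (u 0%N)); exact: (phi0_gt0 H).
have l : (fun k => dot (poincare_ball (phi (u k))) (poincare_ball (phi (u k)))) @ \oo
    --> (1 : R) by rewrite -x1'; exact: cvg_dot.
have d0 : 1 - 2 / (1 + C) < 1 :> R.
  by rewrite ltrBlDr ltrDl divr_gt0 //; lra.
have [N _ /(_ N (leqnn N))] : \forall k \near \oo, 1 - 2 / (1 + C) <
    dot (poincare_ball (phi (u k))) (poincare_ball (phi (u k))).
  exact: (cvgr_gt (1 : R) l).
rewrite (poincare_dot H) ltNge => /negP; apply; rewrite lerD2l lerN2.
apply: ler_wpM2l => //; apply: inv_le; last by rewrite lerD2l.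
by have := phi0_gt0 H (u N); lra.
Qed.

Variable E : 'rV[R]_n -> M.
Hypothesis cE : csection [set: 'rV[R]_n] E.

(** The range is open by [near_csection]. It is closed because a point of its closure is no pole,
    and the local section around it agrees with [E] along segments of a ball. *)
Lemma section_onto : connected [set: M] ->
  (forall p, closure (range E) p -> 0 < hscale p) -> range E = [set: M].
Proof.
move=> hconn nopole.
have Eo : open (range E).
  rewrite openE => _ [y _ <-]; have [_ _ Eg] := cE.2 y I.
  have Ey : E (gmap (E y)) = E y by rewrite Eg.
  apply: filterS (near_csection H fr cE (I : setT (gmap (E y))) Ey) => x [_ <-].
  by exists (gmap x).
have Ec : closed (range E).
  move=> p clp; have sp := nopole p clp.
  have [r [s1 [r0 sec nearP]]] := near_section H fr sp.
  have [_ s1p] := nbhs_singleton nearP.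
  have [q [[y _ yq] [qb sq]]] := clp _ nearP.
  have [_ _ Eg] := cE.2 y I.
  have gq : gmap q = y by rewrite -yq Eg.
  rewrite gq in qb sq.
  exists (gmap p) => //; rewrite -[RHS]s1p.
  apply: (csection_agree H fr cE sec (y := y)); last by rewrite yq sq.
  move=> t /andP[t0 t1]; split=> //.
  move: qb; rewrite -!ball_normE /= => qb.
  have -> : gmap p - (y + t *: (gmap p - y)) = (1 - t) *: (gmap p - y).
    by move: (gmap p) => g; apply/rowP => i; rewrite !mxE; ring.
  rewrite normrZ ger0_norm; last lra.
  by apply: le_lt_trans qb; rewrite ler_piMl //; lra.
by apply: hconn; [exists (E 0); exists 0|exists (range E); rewrite ?setTI|
  exists (range E); rewrite ?setTI].
Qed.

Hypothesis grad0 : forall y, sgrad phi fa P E y = 0.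

Local Notation stau := (stau phi eta fa E).
Local Notation sla := (sla phi fa E).

Lemma stau_const y : stau y = stau 0.
Proof.
have D (t : R) : is_derive t (1 : R) (fun s : R => stau (0 + s *: y)) 0.
  have := is_derive_line (x := 0) (v := y) (t := t) (stau_diff H fr cE _).
  by rewrite (stau_derive H fr cE) grad0 dot0l.
have DN (t : R) : is_derive t (1 : R) (fun s : R => - stau (0 + s *: y)) 0.
  by have := is_deriveN (D t); rewrite oppr0.
have h1 := @derive_ge0_le R _ (fun=> 0) 0 1 ler01 (fun t _ => D t) (fun _ _ => lexx 0).
have h2 := @derive_ge0_le R _ (fun=> 0) 0 1 ler01 (fun t _ => DN t) (fun _ _ => lexx 0).
rewrite /= lerN2 in h2.
move: h1 h2; rewrite !scale0r !addr0 scale1r add0r => h1 h2.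
by apply/eqP; rewrite eq_le h1 h2.
Qed.

Let t0 := stau 0.
Let t0_gt0 : 0 < t0. Proof. exact: (stau_gt0 cE). Qed.

Lemma sla_const y : dot (phi (E y)) fa = (2 * t0)^-1.
Proof.
have := sla_grad H fr cE y; rewrite /sla => ->.
by rewrite grad0 dot0l addr0 stau_const div1r.
Qed.

Lemma phi_mulmx y : phi (E y) *m P = (2 * t0)^-1 *: y.
Proof. by have /eqP := grad0 y; rewrite /sgrad subr_eq0 /sla sla_const => /eqP. Qed.

(** With constant [stau], phi (E y) has constant [fa] coordinate and transverse coordinates
    proportional to [y]; the last coordinate is then fixed by <phi, phi> = -1. *)
Lemma horosphere_range : range E = [set: M] -> injective phi /\ is_horosphere (range phi).
Proof.
move=> onto; have t2 : 2 * t0 != 0 by rewrite mulf_neq0 // gt_eqF.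
have surj p : exists y, E y = p.
  by have : range E p by [rewrite onto]; move=> [y _ <-]; exists y.
split.
  move=> p q pq; have [y yp] := surj p; have [z zq] := surj q.
  have : phi (E y) *m P = phi (E z) *m P by rewrite yp zq pq.
  have t3 : (2 * t0)^-1 != 0 by rewrite invr_eq0.
  by rewrite !phi_mulmx => /(scalerI t3) yz; rewrite -yp -zq yz.
(* This is phi - eta at [E 0]. Only its [fb] coordinate, 2 t0, is nonzero, so <X, nu> = -1
   prescribes the [fa] coordinate of X. *)
pose nu := 2 *: phi (E 0) - psi (E 0).
have s0 : hscale (E 0) = t0^-1 by rewrite /t0 /stau invrK.
have s0_gt0 : 0 < hscale (E 0) by rewrite s0 invr_gt0.
have [_ _ gE0] := cE.2 0 I.
have nua : dot nu fa = 0.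
  rewrite /nu dotBl dotZl sla_const -/(hscale (E 0)) s0; field.
  by rewrite gt_eqF.
have nup : nu *m P = 0.
  rewrite /nu mulmxBl -scalemxAl phi_mulmx (psi_mulmx P s0_gt0) gE0.
  by rewrite !scaler0 subrr.
have nub : dot nu fb = 2 * t0.
  rewrite /nu dotBl dotZl (psi_fb H fr s0_gt0) gE0 dot0l mulr0 mul0r subr0.
  congr (_ * _); rewrite /t0 (stauE H fr cE) dot0l mulr0 mul0r add0r.
  by rewrite dot0l subr0.
have nuL X : lorentz X nu = - (dot X fa * (2 * t0)).
  by rewrite (nf_lorentz fr) nua nup nub mulr0 dot0r; ring.
exists nu.
  split; first by rewrite nuL nua mul0r oppr0.
  by have := psi0_lt H (E 0); rewrite /nu !mxE; lra.
apply/seteqP; split=> [_ [p _ <-]|X [[XX X0] Xnu]].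
  have [y <-] := surj p; split.
    by split; [exact: (lorentz_phi_phi H)|exact: (phi0_gt0 H)].
  by rewrite nuL sla_const mulVf.
have laX : dot X fa = (2 * t0)^-1.
  by move: Xnu; rewrite nuL => /eqP; rewrite eqr_opp => /eqP h; apply: (mulIf t2); rewrite h mulVf.
(* The parameter obtained by inverting [phi_mulmx]. *)
exists (E ((2 * t0) *: (X *m P))) => //.
have pE : phi (E ((2 * t0) *: (X *m P))) *m P = X *m P.
  by rewrite phi_mulmx scalerA mulVf // scale1r.
apply: (null_frame_inj fr _ _ pE); first by rewrite sla_const laX.
have := lorentz_phi_phi H (E ((2 * t0) *: (X *m P))).
rewrite -XX !(nf_lorentz fr) pE sla_const laX => h.
have t3 : (2 * t0)^-1 != 0 by rewrite invr_eq0.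
apply: (mulfI t3); lra.
Qed.

End Horosphere.

Theorem theorem1p4 (R : realType) (n : nat) (hn : (3 <= n)%N)
    (M : smoothManifold R n) (hconn : connected [set: M])
    (phi eta : M -> 'rV[R]_n.+2)
    (himm : immersed_hypersurface phi)
    (hnormal : unit_normal phi eta)
    (hcomplete : complete_hypersurface phi)
    (hconvex : horospherically_convex phi eta)
    (kappa : M -> 'I_n -> R)
    (hkappa : principal_curvatures phi eta kappa)
    (horient : forall p i, kappa p i < 1)
    (H : R) (hcmc : forall p, \sum_(i < n) kappa p i = H)
    (hsum : forall p, \sum_(i < n) 2 / (1 - kappa p i) <= n%:R)
    (hbdry : exists x : 'rV[R]_n.+1, boundary_at_infinity phi = [set x]) :
  injective phi /\ is_horosphere (range phi).
Proof.
have [x bx] := hbdry.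
have bdx : boundary_at_infinity phi x by rewrite bx.
have n1 : (0 < n)%N by apply: leq_trans hn.
have n0 : 0 < n%:R :> R by rewrite ltr0n.
have n2 : 2 < n%:R :> R by rewrite ltr_nat.
have a_gt0 p i : 0 < 1 - kappa p i by rewrite subr_gt0.
have sum_a p : \sum_i (1 - kappa p i) = n%:R - H.
  by rewrite sumrB hcmc sumr_const card_ord.
(* A single term of the sum of the 2 / a_k is at most n, so a_k >= 2/n; a single a_k is at most the
   sum n - H, all of them being positive. *)
have pin : pinched phi eta kappa (2 / n%:R) (n%:R - H).
  split=> // [|p i|p i]; first by rewrite divr_gt0.
  - have : 2 / (1 - kappa p i) <= n%:R.
      apply: le_trans (hsum p); rewrite (bigD1 i) //= lerDl.
      by apply: sumr_ge0 => j _; rewrite divr_ge0 // ltW.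
    by rewrite ler_pdivrMr // ler_pdivrMr // mulrC.
  - rewrite -(sum_a p) (bigD1 i) //= lerDl.
    by apply: sumr_ge0 => j _; exact: ltW.
have unb := boundary_unbounded pin bdx.
have [p1 _] := unb 0.
have a20 : 0 < n%:R - H.
  apply: lt_le_trans (a_gt0 p1 (Ordinal n1)) _; exact: (pc_le pin).
have x1 : dot x x = 1.
  by case: bdx => x1 _; rewrite -[RHS]x1; apply: eq_bigr => i _; rewrite expr2.
have [fa [fb [P [fr faE fbE _]]]] := null_frame_at x1.
have [p0 s0] := nonpole_exists pin fr p1 n1.
have bounded r : 0 <= r -> exists C : R, forall p, 0 < hscale phi eta fa p ->
    dot (gmap phi eta fa P p) (gmap phi eta fa P p) <= r -> hscale phi eta fa p <= C.
  exact: (hscale_bounded pin fr faE fbE bx).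
have [E cE _] := global_section pin a20 fr hcomplete bounded s0.
have nopole p : closure (range E) p -> 0 < hscale phi eta fa p.
  exact: (no_pole pin fr hn unb hconn cE).
have a12 : 2 / n%:R <= 2 :> R by rewrite ler_pdivrMr //; lra.
have gb := section_grad_bound pin a20 fr hcomplete cE nopole sum_a a12.
have sol := section_solution pin fr cE sum_a.
have g0 := solution_grad_eq0 sol (pc_gt0 pin) gb.
exact: (horosphere_range pin fr cE g0 (section_onto pin fr cE hconn nopole)).
Qed.
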